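(* Let $D$ be good, with $r$ distinct prime factors, and assume $\operatorname{sign}(D) = -\epsilon_D$. Let $R_D(X)$ be the number of integers $q$ with $|q|\le X$, $Dq$ square-free, such that $\mathbb{Q}(\sqrt{Dq})$ is a real quadratic field over which there exists an elliptic curve with everywhere good reduction and rational $j$-invariant. Then $$R_D(X) \gg \frac{X}{(\log X)^{1-1/2^r}}.$$
   Context: Let $\mathcal{R}=\{A\in\mathbb{Z} : \text{if } 2\mid A \text{ then } 16\mid A \text{ or } 16\mid A-4;\ \text{if } 3\mid A \text{ then } 27\mid A-12\}$. A square-free integer $D$ is called good if there exist $A\in\mathcal{R}$ and $t\in\mathbb{Z}$ with $Dt^2 = A^3-1728$. For good $D$, set $\epsilon_D = 1$ if $D\equiv 1 \pmod 4$ and $\epsilon_D=-1$ otherwise. An elliptic curve $E/K$ has everywhere good reduction if it has good reduction at every prime of $\mathcal{O}_K$. *)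

(* Defs.v *)
From HB Require Import structures.
From mathcomp Require Import all_boot all_order all_algebra all_field.
Set Implicit Arguments. Unset Strict Implicit. Unset Printing Implicit Defensive.
Import Order.TTheory GRing.Theory Num.Theory.
Local Open Scope ring_scope.

Definition squarefree (z : int) : Prop :=
  z != 0 /\ forall n : nat, (n * n %| `|z|)%N -> n = 1%N.

Definition inR (A : int) : Prop :=
  ((2 %| A)%Z -> (16 %| A)%Z \/ (16 %| A - 4)%Z) /\
  ((3 %| A)%Z -> (27 %| A - 12)%Z).

Definition good (D : int) : Prop :=
  squarefree D /\ exists (A t : int), inR A /\ D * t ^+ 2 = A ^+ 3 - 1728.

Definition eps (D : int) : int := if (D %% 4)%Z == 1 then 1 else -1.

Definition sgnz (D : int) : int := if D > 0 then 1 else if D < 0 then -1 else 0.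

Definition nprimes (D : int) : nat := size (primes `|D|%N).

Definition inK (m : int) (x : algC) : Prop :=
  exists a b : rat, x = ratr a + ratr b * sqrtC (m%:~R).

Definition inOK (m : int) (x : algC) : Prop := inK m x /\ x \in Aint.

(* A (nonzero) prime P of O_K is represented as the kernel of a unital ring
   homomorphism phi : O_K -> F into a finite field F (every nonzero prime P
   arises this way with F = O_K/P, and every such kernel is a nonzero prime). *)
Definition OK_hom (m : int) (F : finFieldType) (phi : algC -> F) : Prop :=
  phi 1 = 1 /\
  (forall x y, inOK m x -> inOK m y -> phi (x + y) = phi x + phi y) /\
  (forall x y, inOK m x -> inOK m y -> phi (x * y) = phi x * phi y).

Definition P_integral (m : int) (F : finFieldType) (phi : algC -> F) (x : algC) : Prop :=
  exists a b, inOK m a /\ inOK m b /\ phi b != 0 /\ x = a / b.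

Definition P_unit (m : int) (F : finFieldType) (phi : algC -> F) (x : algC) : Prop :=
  exists a b, inOK m a /\ inOK m b /\ phi a != 0 /\ phi b != 0 /\ x = a / b.

(* y^2 + a1 xy + a3 y = x^3 + a2 x^2 + a4 x + a6 *)
Record weier := Weier { a1 : algC; a2 : algC; a3 : algC; a4 : algC; a6 : algC }.

Definition b2 (E : weier) := a1 E ^+ 2 + 4 * a2 E.
Definition b4 (E : weier) := 2 * a4 E + a1 E * a3 E.
Definition b6 (E : weier) := a3 E ^+ 2 + 4 * a6 E.
Definition b8 (E : weier) :=
  a1 E ^+ 2 * a6 E + 4 * a2 E * a6 E - a1 E * a3 E * a4 E
  + a2 E * a3 E ^+ 2 - a4 E ^+ 2.
Definition disc (E : weier) :=
  - b2 E ^+ 2 * b8 E - 8 * b4 E ^+ 3 - 27 * b6 E ^+ 2 + 9 * b2 E * b4 E * b6 E.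
Definition c4 (E : weier) := b2 E ^+ 2 - 24 * b4 E.
Definition jinv (E : weier) := c4 E ^+ 3 / disc E.

(* the model obtained by x = u^2 x' + r, y = u^3 y' + s u^2 x' + t *)
Definition change (E : weier) (u r s t : algC) : weier :=
  Weier ((a1 E + 2 * s) / u)
        ((a2 E - s * a1 E + 3 * r - s ^+ 2) / u ^+ 2)
        ((a3 E + r * a1 E + 2 * t) / u ^+ 3)
        ((a4 E - s * a3 E + 2 * r * a2 E - (t + r * s) * a1 E + 3 * r ^+ 2
          - 2 * s * t) / u ^+ 4)
        ((a6 E + r * a4 E + r ^+ 2 * a2 E + r ^+ 3 - t * a3 E - t ^+ 2
          - r * t * a1 E) / u ^+ 6).

Definition ell_over (m : int) (E : weier) : Prop :=
  [/\ inK m (a1 E), inK m (a2 E), inK m (a3 E), inK m (a4 E) & inK m (a6 E)]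
  /\ disc E != 0.

Definition good_red_at (m : int) (E : weier) (F : finFieldType) (phi : algC -> F) : Prop :=
  exists u r s t, [/\ inK m u, u != 0, inK m r, inK m s & inK m t] /\
    let E' := change E u r s t in
    [/\ P_integral m phi (a1 E'), P_integral m phi (a2 E'),
        P_integral m phi (a3 E'), P_integral m phi (a4 E')
      & P_integral m phi (a6 E')] /\ P_unit m phi (disc E').

Definition everywhere_good (m : int) (E : weier) : Prop :=
  forall (F : finFieldType) (phi : algC -> F), OK_hom m phi -> good_red_at m E phi.

Definition has_egr_rational_j (m : int) : Prop :=
  exists E : weier, [/\ ell_over m E, everywhere_good m E
                       & exists j : rat, jinv E = ratr j].

Definition counted (D q : int) : Prop :=
  [/\ squarefree (D * q), 1 < D * q & has_egr_rational_j (D * q)].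

(* Main.v *)
(* Write d = |D|; the sign condition says that - eps D * D = d. For q of the sign of D
   put Q = |q| and m = D q = d Q. If z^2 + d x^2 = Q y^2 with x, y, z having no common
   prime factor and suitable 2-adic shape, then K = Q(sqrt m) contains an integer s with
   norm - d zeta^2 (zeta = z or z/2), and the curve with c4 = A D s^2, c6 = D^2 t s^3, of
   discriminant D^3 s^6 and j-invariant A^3, has good reduction at every prime.
   If - d is a square modulo Q, Thue's lemma gives z^2 + d x^2 = k Q with k <= d + 1, and
   by the pigeonhole principle multiplication by fixed norms turns a positive proportion
   of these identities into conics of the required shape.
   The primes p with (-d/p) = 1 are those at which a real character chi is 1, and
   L(1, chi) > 0 together with Mertens' estimates gives >> X / sqrt (log X) squarefree
   Q <= X composed of such primes. This is enough because D has a prime factor. *)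
Require Import Defs.
From mathcomp Require Import all_boot all_order all_algebra all_solvable all_field.
From mathcomp Require Import ring lra zify boolp classical_sets reals Rstruct.
Set Implicit Arguments. Unset Strict Implicit. Unset Printing Implicit Defensive.
Import Order.TTheory GRing.Theory Num.Theory.
Local Open Scope ring_scope.

(** * Quadratic fields and their residue homomorphisms *)

(** That -d is a square modulo Q does not by itself solve the conic: genus conditions at the primes
    dividing 2d remain, and they are what the exponent 1/2^r reflects. They are never checked here.
    Thue's lemma leaves a multiplier k, which becomes the harmless square k^2 when two numbers with
    the same k are multiplied; equal residues modulo a power of 2 make one norm element times the
    conjugate of the other nearly rational at 2. So each Q is completed by a fixed partner from its
    class, at the cost of a constant factor in X. The count avoids Tauberian theorems: the sum of
    1/m over split squarefree m is at least of order sqrt(log X), because its square dominates the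
    sum of r(n)/n, which grows like L(1, chi) log X; one large split prime per m turns this into a
    count. The character is built from Gauss sums in finite fields, so that chi(p) = 1 directly
    yields a square root of -d modulo p. The logarithm is a function [lg] known only by its
    functional equation and lg x <= x - 1 until it becomes the real [ln] at the end. *)

Section QuadraticField.
Variable m : int.
Local Notation "'pi'" := (sqrtC (m%:~R : algC)).

Lemma sqr_pi : pi ^+ 2 = m%:~R.
Proof. exact: sqrtCK. Qed.

Lemma inK_rat (a : rat) : inK m (ratr a).
Proof. by exists a, 0; rewrite rmorph0 mul0r addr0. Qed.

Lemma inK_int (n : int) : inK m n%:~R.
Proof. by rewrite -[n%:~R](ratr_int algC); apply: inK_rat. Qed.

Lemma inK_pi : inK m pi.
Proof. by exists 0, 1; rewrite rmorph0 rmorph1 mul1r add0r. Qed.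

Lemma inKD x y : inK m x -> inK m y -> inK m (x + y).
Proof.
move=> [a [b ->]] [c [d ->]]; exists (a + c), (b + d); rewrite !rmorphD /=; ring.
Qed.

Lemma inKN x : inK m x -> inK m (- x).
Proof. by move=> [a [b ->]]; exists (- a), (- b); rewrite !rmorphN /=; ring. Qed.

Lemma inKM x y : inK m x -> inK m y -> inK m (x * y).
Proof.
move=> [a [b ->]] [c [d ->]]; exists (a * c + m%:~R * (b * d)), (a * d + b * c).
have := sqr_pi; set p := sqrtC _ => e.
rewrite !(rmorphD, rmorphM) /= ratr_int -e; ring.
Qed.

Lemma inKX x n : inK m x -> inK m (x ^+ n).
Proof.
move=> Kx; elim: n => [|n IH]; first exact: (inK_int 1).
by rewrite exprS; apply: inKM.
Qed.

Lemma inKV x : inK m x -> inK m x^-1.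
Proof.
move=> [a [b ->]].
have [e|nz] := eqVneq (ratr a - ratr b * pi) 0.
  have -> : ratr a + ratr b * pi = ratr (a + a).
    by rewrite rmorphD /=; move/eqP: e; rewrite subr_eq0 => /eqP <-.
  by rewrite -fmorphV; apply: inK_rat.
have -> : (ratr a + ratr b * pi)^-1 =
  ratr ((a ^+ 2 - m%:~R * b ^+ 2)^-1) * (ratr a - ratr b * pi).
  have := sqr_pi; move: nz; set p := sqrtC _ => nz e.
  rewrite fmorphV /= !(rmorphB, rmorphXn, rmorphM) /= ratr_int /= -e.
  have -> : ratr a ^+ 2 - p ^+ 2 * ratr b ^+ 2 =
     (ratr a + ratr b * p) * (ratr a - ratr b * p) :> algC by ring.
  by rewrite invfM mulfVK.
apply: inKM; first exact: inK_rat.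
by exists a, (- b); rewrite rmorphN /= mulNr.
Qed.

Lemma inKf x y : inK m x -> inK m y -> inK m (x / y).
Proof. by move=> Kx Ky; apply: inKM => //; apply: inKV. Qed.

Lemma inOK_int (n : int) : inOK m n%:~R.
Proof. by split; [apply: inK_int | apply: rpred_int]. Qed.

Lemma inOKD x y : inOK m x -> inOK m y -> inOK m (x + y).
Proof. by move=> [? ?] [? ?]; split; [apply: inKD | apply: rpredD]. Qed.

Lemma inOKN x : inOK m x -> inOK m (- x).
Proof. by move=> [? ?]; split; [apply: inKN | rewrite rpredN]. Qed.

Lemma inOKM x y : inOK m x -> inOK m y -> inOK m (x * y).
Proof. by move=> [? ?] [? ?]; split; [apply: inKM | apply: rpredM]. Qed.

Lemma inOKX x n : inOK m x -> inOK m (x ^+ n).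
Proof. by move=> [? ?]; split; [apply: inKX | apply: rpredX]. Qed.

Lemma inOK_quadratic x (b c : int) :
  inK m x -> x ^+ 2 = b%:~R * x + c%:~R -> inOK m x.
Proof.
move=> Kx e; split=> //.
apply: (@root_monic_Aint ('X^2 - (b%:~R *: 'X + c%:~R%:P))).
- by rewrite rootE !hornerE e; apply/eqP; ring.
- rewrite monicE lead_coefDl ?lead_coefXn //.
  rewrite size_polyXn size_polyN (leq_ltn_trans (size_polyD _ _)) //.
  rewrite gtn_max (leq_ltn_trans (size_scale_leq _ _)) ?size_polyX //.
  by rewrite (leq_ltn_trans (size_polyC_leq1 _)).
- apply/polyOverP => i; rewrite coefB coefD coefXn coefZ coefX coefC.
  apply: rpredB; first exact: rpred_nat.
  apply: rpredD; first by apply: rpredM; [apply: rpred_int | apply: rpred_nat].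
  by case: ifP => _; [apply: rpred_int | apply: rpred0].
Qed.

Lemma inOK_pi : inOK m pi.
Proof.
apply: (@inOK_quadratic _ 0 m); first exact: inK_pi.
by rewrite sqr_pi mul0r add0r.
Qed.

Section LocalRing.
Variables (F : finFieldType) (phi : algC -> F).
Hypothesis phiP : OK_hom m phi.

Lemma OK_homD x y : inOK m x -> inOK m y -> phi (x + y) = phi x + phi y.
Proof. by case: phiP => _ [h _]; apply: h. Qed.

Lemma OK_homM x y : inOK m x -> inOK m y -> phi (x * y) = phi x * phi y.
Proof. by case: phiP => _ [_ h]; apply: h. Qed.

Lemma OK_hom0 : phi 0 = 0.
Proof.
have /eqP := OK_homD (inOK_int 0) (inOK_int 0).
by rewrite addr0 -subr_eq subrr eq_sym => /eqP.
Qed.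

Lemma OK_homN x : inOK m x -> phi (- x) = - phi x.
Proof.
move=> Ox; apply/eqP; rewrite -addr_eq0 addrC -OK_homD //; last exact: inOKN.
by rewrite subrr OK_hom0.
Qed.

Lemma OK_homX x n : inOK m x -> phi (x ^+ n) = phi x ^+ n.
Proof.
move=> Ox; elim: n => [|n IH]; first by rewrite !expr0; case: phiP.
by rewrite !exprS OK_homM ?IH //; apply: inOKX.
Qed.

Lemma OK_hom_nat (n : nat) : phi n%:R = n%:R.
Proof.
elim: n => [|n IH]; first exact: OK_hom0.
rewrite -addn1 !natrD -[n%:R in LHS]/((Posz n)%:~R).
rewrite (OK_homD (inOK_int n) (inOK_int 1)) IH.
by congr (_ + _); case: phiP.
Qed.

Lemma OK_hom_int (n : int) : phi n%:~R = n%:~R.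
Proof.
case: n => n; first exact: OK_hom_nat.
by rewrite NegzE !rmorphN /= OK_homN ?OK_hom_nat //; apply: (inOK_int n.+1).
Qed.

Lemma P_integral_OK x : inOK m x -> P_integral m phi x.
Proof.
move=> Ox; exists x, 1; split=> //; split; first exact: (inOK_int 1).
by rewrite divr1; case: phiP => -> _; rewrite oner_neq0.
Qed.

Lemma P_integral_int (n : int) : P_integral m phi n%:~R.
Proof. exact/P_integral_OK/inOK_int. Qed.

Lemma phi_neq0 x : phi x != 0 -> x != 0.
Proof. by apply: contraNneq => ->; rewrite OK_hom0. Qed.

Lemma P_integralD x y :
  P_integral m phi x -> P_integral m phi y -> P_integral m phi (x + y).
Proof.
move=> [a [b [Oa [Ob [nb ->]]]]] [c [d [Oc [Od [nd ->]]]]].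
exists (a * d + c * b), (b * d); split; first by apply: inOKD; apply: inOKM.
split; first exact: inOKM.
by rewrite OK_homM // mulf_neq0 // addf_div //; apply: phi_neq0.
Qed.

Lemma P_integralM x y :
  P_integral m phi x -> P_integral m phi y -> P_integral m phi (x * y).
Proof.
move=> [a [b [Oa [Ob [nb ->]]]]] [c [d [Oc [Od [nd ->]]]]].
exists (a * c), (b * d); split; first exact: inOKM.
split; first exact: inOKM.
by rewrite OK_homM // mulf_neq0 // mulf_div.
Qed.

Lemma P_integralN x : P_integral m phi x -> P_integral m phi (- x).
Proof.
move=> [a [b [Oa [Ob [nb ->]]]]]; exists (- a), b; split; first exact: inOKN.
by rewrite mulNr.
Qed.

Lemma P_integralX x n : P_integral m phi x -> P_integral m phi (x ^+ n).
Proof.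
move=> Px; elim: n => [|n IH]; first exact: (P_integral_int 1).
by rewrite exprS; apply: P_integralM.
Qed.

Lemma P_unitW x : P_unit m phi x -> P_integral m phi x.
Proof. by move=> [a [b [? [? [? [? ->]]]]]]; exists a, b. Qed.

Lemma P_unit_neq0 x : P_unit m phi x -> x != 0.
Proof.
move=> [a [b [? [? [na [nb ->]]]]]].
by rewrite mulf_neq0 ?invr_eq0 ?phi_neq0.
Qed.

Lemma P_unitV x : P_unit m phi x -> P_unit m phi x^-1.
Proof. by move=> [a [b [? [? [? [? ->]]]]]]; exists b, a; rewrite invf_div. Qed.

Lemma P_unitM x y : P_unit m phi x -> P_unit m phi y -> P_unit m phi (x * y).
Proof.
move=> [a [b [Oa [Ob [na [nb ->]]]]]] [c [d [Oc [Od [nc [nd ->]]]]]].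
exists (a * c), (b * d); rewrite !OK_homM // !mulf_neq0 // mulf_div.
by do !split=> //; try exact: inKM; case: Oa Oc Ob Od => ? ? [? ?] [? ?] [? ?];
   rewrite ?rpredM //; apply: inKM.
Qed.

Lemma P_unit_OK x : inOK m x -> phi x != 0 -> P_unit m phi x.
Proof.
move=> Ox nx; exists x, 1; split=> //; split; first exact: (inOK_int 1).
by rewrite nx divr1; case: phiP => -> _; rewrite oner_neq0.
Qed.

Lemma P_unit_int (n : int) : (n%:~R : F) != 0 -> P_unit m phi n%:~R.
Proof. by move=> nn; apply: P_unit_OK; [apply: inOK_int | rewrite OK_hom_int]. Qed.

Lemma P_unitX x n : P_unit m phi x -> P_unit m phi (x ^+ n).
Proof.
move=> Px; elim: n => [|n IH]; last by rewrite exprS; apply: P_unitM.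
by apply: (P_unit_int (n := 1)); rewrite oner_neq0.
Qed.

Lemma P_integral_div x y :
  P_integral m phi x -> P_unit m phi y -> P_integral m phi (x / y).
Proof. by move=> ? ?; apply: P_integralM => //; apply/P_unitW/P_unitV. Qed.

(* The model reached by u, r = u^2 theta/12, s = u al1/2, t = u^3 al3/2, where
   theta = al1^2 + 4 al2 is the new b2. *)
Lemma good_red_of_model (c4 c6 u al1 al2 al3 : algC) :
  let theta := al1 ^+ 2 + 4 * al2 in
  inK m c4 -> inK m c6 ->
  inK m u -> u != 0 -> inK m al1 -> inK m al2 -> inK m al3 ->
  P_integral m phi al1 -> P_integral m phi al2 -> P_integral m phi al3 ->
  P_integral m phi ((theta ^+ 2 - c4 / u ^+ 4) / 48 - al1 * al3 / 2) ->
  P_integral m phi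
    ((theta ^+ 3 - 3 * theta * (c4 / u ^+ 4) - 2 * (c6 / u ^+ 6)) / 1728 - al3 ^+ 2 / 4) ->
  P_unit m phi ((c4 ^+ 3 - c6 ^+ 2) / 1728 / u ^+ 12) ->
  good_red_at m (Weier 0 0 0 (- (c4 / 48)) (- (c6 / 864))) phi.
Proof.
move=> theta Kc4 Kc6 Ku u0 K1 K2 K3 P1 P2 P3 P4 P6 PD.
exists u, (u ^+ 2 * theta / 12), (u * al1 / 2), (u ^+ 3 * al3 / 2).
split.
  have Kn := inK_int 12; have K2n := inK_int 2; have K4n := inK_int 4.
  split=> //; rewrite /theta;
  by repeat first [assumption | apply: inKf | apply: inKM | apply: inKD | apply: inKX].
set E' := change _ _ _ _ _; cbv zeta.
have E1 : a1 E' = al1 by rewrite /=; field.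
have E2 : a2 E' = al2 by rewrite /= /theta; field.
have E3 : a3 E' = al3 by rewrite /=; field.
have E4 : a4 E' = (theta ^+ 2 - c4 / u ^+ 4) / 48 - al1 * al3 / 2.
  by rewrite /=; field.
have E6 : a6 E' = (theta ^+ 3 - 3 * theta * (c4 / u ^+ 4) - 2 * (c6 / u ^+ 6)) / 1728
    - al3 ^+ 2 / 4.
  by rewrite /=; field.
have ED : disc E' = (c4 ^+ 3 - c6 ^+ 2) / 1728 / u ^+ 12.
  by rewrite /disc /b2 /b4 /b6 /b8 E1 E2 E3 E4 E6 /theta; field.
by rewrite E1 E2 E3 E4 E6 ED.
Qed.

End LocalRing.
End QuadraticField.

(** * Good reduction of the twisted curve *)

Lemma Euclid_dvdzM (p : nat) (a b : int) : prime p ->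
  (p %| a * b)%Z = (p %| a)%Z || (p %| b)%Z.
Proof. by move=> pp; rewrite !dvdzE abszM Euclid_dvdM. Qed.

Lemma Euclid_dvdzX (p n : nat) (a : int) : prime p ->
  (p %| a ^+ n.+1)%Z = (p %| a)%Z.
Proof. by move=> pp; rewrite !dvdzE abszX Euclid_dvdX // andbT. Qed.

Lemma squarefree_prime (n : int) (p : nat) :
  squarefree n -> prime p -> ((p%:Z) ^+ 2 %| n)%Z = false.
Proof.
move=> [_ h] pp; apply/negP; rewrite dvdzE abszX => dv.
by have := h p; rewrite mulnn => /(_ dv) p1; rewrite p1 in pp.
Qed.

Lemma Gauss_dvdz_sqr (p : nat) (a b : int) : prime p ->
  ~~ (p %| a)%Z -> ((p%:Z) ^+ 2 %| a * b)%Z -> ((p%:Z) ^+ 2 %| b)%Z.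
Proof.
move=> pp npa; rewrite Gauss_dvdzr //; apply: coprimezXl.
by rewrite coprimezE prime_coprime // -dvdzE.
Qed.

Lemma finField_dvdz (F : finFieldType) :
  exists2 p : nat, prime p & forall n : int, ((n%:~R : F) == 0) = (p %| n)%Z.
Proof.
have [p pp pF] := finPcharP F; exists p => // n.
by rewrite (dvdz_pcharf pF).
Qed.

(** * Rescaling the twist at a given prime *)

Section LocalScaling.
Variables (D d Q x y zeta kappa lam delta : int) (s sb : algC).
Local Notation m := (d * Q).
Local Notation "'pi'" := (sqrtC (m%:~R : algC)).
Hypotheses (Dd : D = delta * d) (delta2 : delta ^+ 2 = 1).
Hypothesis sf : squarefree m.
Hypotheses (Os : inOK m s) (Osb : inOK m sb).
Hypothesis norm_s : s * sb = - d%:~R * zeta%:~R ^+ 2.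
Hypothesis trace_s : s + sb = kappa%:~R * d%:~R * x%:~R.
Hypothesis s_pi : lam%:~R * Q%:~R * s = pi * (Q%:~R * y%:~R + x%:~R * pi).
Hypothesis conic : Q * y ^+ 2 = lam ^+ 2 * zeta ^+ 2 + d * x ^+ 2.
Hypothesis prim : forall p : nat, prime p ->
  (p %| x)%Z -> (p %| y)%Z -> (p %| zeta)%Z -> False.
Hypothesis zeta0 : zeta != 0.

Variables (F : finFieldType) (phi : algC -> F).
Hypothesis phiP : OK_hom m phi.

(** After scaling by [u] the invariants become c4 = A w and c6 = t g, with w and g the two quotients
    here, and the discriminant becomes w^3. *)
Definition scaling (u : algC) := [/\ inK m u, u != 0,
  P_unit m phi (D%:~R * s ^+ 2 / u ^+ 4) &
  P_integral m phi (D%:~R ^+ 2 * s ^+ 3 / u ^+ 6)].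

Let phi_int := OK_hom_int phiP.

Let d_neq0 : (d%:~R : algC) != 0.
Proof. by case: sf; rewrite intr_eq0 mulf_eq0 negb_or => /andP[]. Qed.
Let Q_neq0 : (Q%:~R : algC) != 0.
Proof. by case: sf; rewrite intr_eq0 mulf_eq0 negb_or => /andP[]. Qed.
Let pi2 : pi ^+ 2 = d%:~R * Q%:~R.
Proof. by rewrite sqr_pi rmorphM. Qed.
Let pi_neq0 : pi != 0.
Proof. by rewrite -sqrf_eq0 pi2 mulf_neq0. Qed.
Let DE : (D%:~R : algC) = delta%:~R * d%:~R.
Proof. by rewrite Dd rmorphM. Qed.
Let delta2C : (delta%:~R : algC) ^+ 2 = 1.
Proof. by rewrite -rmorphXn delta2. Qed.

Let phi_delta : (delta%:~R : F) != 0.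
Proof.
apply/negP => /eqP e; have := congr1 (fun n : int => (n%:~R : F)) delta2.
by rewrite /= rmorphXn /= e expr0n /= => /eqP; rewrite eq_sym oner_eq0.
Qed.

Lemma scaling_one : (d%:~R : F) != 0 -> phi s != 0 -> scaling 1.
Proof.
move=> nd ns; split; [exact: (inK_int _ 1) | exact: oner_neq0 | |]; rewrite expr1n divr1.
  apply: (P_unitM phiP); last by apply: (P_unitX phiP); apply: P_unit_OK.
  by apply: (P_unit_int phiP); rewrite Dd rmorphM mulf_neq0.
apply: (P_integralM phiP); apply: (P_integralX phiP); last exact: P_integral_OK.
exact: (P_integral_int phiP).
Qed.

(** A prime that misses the conjugate [sb] sees s = -d zeta^2 / sb as a unit times zeta^2, so u =
    zeta absorbs whatever part of [s] it divides. *)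
Lemma scaling_zeta : (d%:~R : F) != 0 -> phi sb != 0 -> scaling zeta%:~R.
Proof.
move=> nd nsb.
have sb0 : sb != 0 := phi_neq0 phiP nsb.
have z0 : (zeta%:~R : algC) != 0 by rewrite intr_eq0.
have sE : s = - d%:~R * zeta%:~R ^+ 2 / sb by rewrite -norm_s mulfK.
split=> //; first exact: inK_int.
  have -> : D%:~R * s ^+ 2 / zeta%:~R ^+ 4 = D%:~R * d%:~R ^+ 2 * sb^-1 ^+ 2.
    by rewrite sE; field; rewrite ?z0 ?sb0.
  apply: (P_unitM phiP); last by apply/(P_unitX phiP)/P_unitV/P_unit_OK.
  apply: (P_unitM phiP); last by apply/(P_unitX phiP)/P_unit_int.
  by apply: (P_unit_int phiP); rewrite Dd rmorphM mulf_neq0.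
have -> : D%:~R ^+ 2 * s ^+ 3 / zeta%:~R ^+ 6 = - (D%:~R ^+ 2 * d%:~R ^+ 3 * sb^-1 ^+ 3).
  by rewrite sE; field; rewrite ?z0 ?sb0.
apply: P_integralN; apply: (P_integralM phiP).
  by apply: (P_integralM phiP); apply/(P_integralX phiP)/P_integral_int.
by apply/(P_integralX phiP)/P_unitW/P_unitV/P_unit_OK.
Qed.

(** A prime dividing both [s] and [sb] divides their trace and norm, hence x and zeta. The conic
    then puts p^2 into Q y^2, and Q being squarefree, p divides y as well, against [prim]. *)
Lemma phi_s_or_sb : (d%:~R : F) != 0 -> (kappa%:~R : F) != 0 ->
  phi s != 0 \/ phi sb != 0.
Proof.
move=> nd nk; have [|s0] := boolP (phi s != 0); [by left|right].
apply/negP => /eqP sb0; move/negPn/eqP: s0 => s0.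
have [p pp pF] := finField_dvdz F.
have px : (p %| x)%Z.
  have := congr1 phi trace_s; rewrite (OK_homD phiP) // s0 sb0 addr0 -!rmorphM phi_int.
  move/esym/eqP; rewrite pF !Euclid_dvdzM // => /orP[/orP[]|//]; rewrite -pF.
    by rewrite (negPf nk).
  by rewrite (negPf nd).
have pz : (p %| zeta)%Z.
  have := congr1 phi norm_s; rewrite (OK_homM phiP) // s0 mul0r -rmorphN -rmorphXn -rmorphM phi_int.
  move/esym/eqP; rewrite pF Euclid_dvdzM // Euclid_dvdzX // => /orP[|//].
  by rewrite -pF rmorphN oppr_eq0 (negPf nd).
have [py|npy] := boolP (p %| y)%Z; first exact: (prim pp).
have := squarefree_prime sf pp; rewrite dvdz_mull //.
apply: (Gauss_dvdz_sqr (a := y ^+ 2)) => //; first by rewrite Euclid_dvdzX.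
by rewrite mulrC conic; apply: rpredD; apply: dvdz_mull; rewrite dvdz_exp2r.
Qed.

(** Over a prime dividing d, pi vanishes and tau reduces to Q y. If p divided y, the conic would
    give p | zeta, then p^2 | d x^2, and squarefreeness of d would put p into x. *)
Lemma phi_tau : (d%:~R : F) = 0 -> (lam%:~R : F) != 0 ->
  phi (Q%:~R * y%:~R + x%:~R * pi) != 0 /\ (Q%:~R : F) != 0.
Proof.
move=> d0 nl; have [p pp pF] := finField_dvdz F.
have pd : (p %| d)%Z by rewrite -pF d0.
have nQ : ~~ (p %| Q)%Z.
  apply/negP => pQ; have := squarefree_prime sf pp.
  by rewrite expr2 dvdz_mul.
have OI := inOK_int m.
rewrite pF nQ; split=> //.
have phipi : phi pi = 0.
  apply/eqP; rewrite -sqrf_eq0 -(OK_homX phiP 2 (inOK_pi _)) pi2 -rmorphM phi_int.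
  by rewrite intrM d0 mul0r.
have O1 : inOK m (Q%:~R * y%:~R) by apply: inOKM.
have O2 : inOK m (x%:~R * pi) by apply: inOKM => //; apply: inOK_pi.
rewrite (OK_homD phiP) //.
rewrite (OK_homM phiP (OI x)) ?phipi ?mulr0 ?addr0; last exact: inOK_pi.
rewrite -rmorphM phi_int pF Euclid_dvdzM // (negPf nQ) /=.
apply/negP => py.
have py2 : (p%:Z ^+ 2 %| Q * y ^+ 2)%Z by rewrite dvdz_mull // dvdz_exp2r.
have pz : (p %| zeta)%Z.
  have : (p %| lam ^+ 2 * zeta ^+ 2)%Z.
    have -> : lam ^+ 2 * zeta ^+ 2 = Q * y ^+ 2 - d * x ^+ 2 by rewrite conic addrK.
    by apply: rpredB; [apply: dvdz_mull; rewrite Euclid_dvdzX | apply: dvdz_mulr].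
  by rewrite Euclid_dvdzM // !Euclid_dvdzX // -pF (negPf nl).
have [px|npx] := boolP (p %| x)%Z; first exact: (prim pp).
have := squarefree_prime sf pp; rewrite dvdz_mulr //.
apply: (Gauss_dvdz_sqr (a := x ^+ 2)) => //; first by rewrite Euclid_dvdzX.
have -> : x ^+ 2 * d = Q * y ^+ 2 - lam ^+ 2 * zeta ^+ 2 by rewrite conic; ring.
by apply: rpredB => //; apply: dvdz_mull; rewrite dvdz_exp2r.
Qed.

(** As pi^2 = d Q, the factor d of D and the factor pi^2 of s^2 are both absorbed by pi^4; only
    delta, tau, lam and Q remain in the first quotient, and over d these are units. *)
Lemma scaling_pi_eqs : (lam%:~R : algC) != 0 ->
  let tau := Q%:~R * y%:~R + x%:~R * pi in
  D%:~R * s ^+ 2 / pi ^+ 4 = delta%:~R * tau ^+ 2 / (lam%:~R ^+ 2 * Q%:~R ^+ 3) /\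
  D%:~R ^+ 2 * s ^+ 3 / pi ^+ 6 = pi * tau ^+ 3 / (lam%:~R ^+ 3 * Q%:~R ^+ 5).
Proof.
move=> l0 tau.
have sE : s = pi * tau / (lam%:~R * Q%:~R).
  by rewrite -s_pi mulrC mulKf // mulf_neq0.
have e4 : pi ^+ 4 = d%:~R * Q%:~R * pi ^+ 2 by rewrite -pi2; ring.
have e6 : pi ^+ 6 = d%:~R ^+ 2 * Q%:~R ^+ 2 * pi ^+ 2 by rewrite -exprMn -pi2; ring.
rewrite e4 e6 sE DE; split; first by field; rewrite l0 Q_neq0 d_neq0 pi_neq0.
rewrite [X in _ = X](_ : _ = delta%:~R ^+ 2 * (pi * tau ^+ 3 / (lam%:~R ^+ 3 * Q%:~R ^+ 5))).
  by field; rewrite l0 Q_neq0 d_neq0 pi_neq0.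
by rewrite delta2C mul1r.
Qed.

Lemma scaling_pi : (d%:~R : F) = 0 -> (lam%:~R : F) != 0 -> scaling pi.
Proof.
move=> d0 nl.
have l0 : (lam%:~R : algC) != 0.
  by rewrite intr_eq0; apply: contraNneq nl => ->; rewrite eqxx.
have [ntau nQ] := phi_tau d0 nl.
have Otau : inOK m (Q%:~R * y%:~R + x%:~R * pi).
  by apply: inOKD; apply: inOKM; try exact: inOK_int; apply: inOK_pi.
have [e1 e2] := scaling_pi_eqs l0.
have Ul := P_unit_int phiP nl; have UQ := P_unit_int phiP nQ.
split=> //; first exact: inK_pi.
  rewrite e1; apply: (P_unitM phiP).
    apply: (P_unitM phiP); first exact: P_unit_int.
    by apply/(P_unitX phiP)/P_unit_OK.
  by apply: P_unitV; apply: (P_unitM phiP); apply: (P_unitX phiP).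
rewrite e2; apply: (P_integral_div phiP).
  apply: (P_integralM phiP); first by apply/P_integral_OK => //; apply: inOK_pi.
  by apply/(P_integralX phiP)/P_integral_OK.
by apply: (P_unitM phiP); apply: (P_unitX phiP).
Qed.

End LocalScaling.

Section GoodReduction.
Variables (D A t m : int) (s : algC).
Hypothesis curve : D * t ^+ 2 = A ^+ 3 - 1728.
Variables (F : finFieldType) (phi : algC -> F).
Hypothesis phiP : OK_hom m phi.
Hypothesis Ks : inK m s.
Local Notation W := (D%:~R * s ^+ 2).
Local Notation G := (D%:~R ^+ 2 * s ^+ 3).

(** The twist by [s] of the rational curve with c4 = A D and c6 = D^2 t, which has discriminant D^3
    and j-invariant A^3. *)
Definition egr_curve : weier :=
  Weier 0 0 0 (- (A%:~R * W / 48)) (- (t%:~R * G / 864)).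

Let curveC : (D%:~R : algC) * t%:~R ^+ 2 = A%:~R ^+ 3 - 1728.
Proof.
have := congr1 (fun n : int => (n%:~R : algC)) curve.
by rewrite /= rmorphB rmorphM !rmorphXn.
Qed.

Let c4c6 : (A%:~R * W) ^+ 3 - (t%:~R * G) ^+ 2 = 1728 * (W ^+ 3 : algC).
Proof.
have -> : (t%:~R * G) ^+ 2 = D%:~R * t%:~R ^+ 2 * W ^+ 3 :> algC by ring.
by rewrite curveC; ring.
Qed.

Lemma egr_curve_good_red u al1 al2 al3 :
  let theta := al1 ^+ 2 + 4 * al2 in
  let w := W / u ^+ 4 in let g := G / u ^+ 6 in
  inK m u -> u != 0 -> P_unit m phi w ->
  inK m al1 -> inK m al2 -> inK m al3 ->
  P_integral m phi al1 -> P_integral m phi al2 -> P_integral m phi al3 ->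
  P_integral m phi ((theta ^+ 2 - A%:~R * w) / 48 - al1 * al3 / 2) ->
  P_integral m phi
    ((theta ^+ 3 - 3 * theta * (A%:~R * w) - 2 * (t%:~R * g)) / 1728 - al3 ^+ 2 / 4) ->
  good_red_at m egr_curve phi.
Proof.
move=> theta w g Ku u0 Uw K1 K2 K3 P1 P2 P3 P4 P6.
have KW : inK m W by apply: inKM; [apply: inK_int | apply: inKX].
have KG : inK m G by apply: inKM; apply: inKX => //; apply: inK_int.
apply: (@good_red_of_model m F phi _ _ u al1 al2 al3) => //.
- by apply: inKM => //; apply: inK_int.
- by apply: inKM => //; apply: inK_int.
- have -> : A%:~R * W / u ^+ 4 = A%:~R * w by rewrite /w [RHS]mulrA.
  exact: P4.
- have -> : A%:~R * W / u ^+ 4 = A%:~R * w by rewrite /w [RHS]mulrA.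
  have -> : t%:~R * G / u ^+ 6 = t%:~R * g by rewrite /g [RHS]mulrA.
  exact: P6.
have -> : ((A%:~R * W) ^+ 3 - (t%:~R * G) ^+ 2) / 1728 / u ^+ 12 = w ^+ 3.
  by rewrite c4c6 /w; field.
exact: (P_unitX phiP).
Qed.

Lemma w_g_eq (u : algC) : u != 0 ->
  (t%:~R * (G / u ^+ 6)) ^+ 2 = (A%:~R ^+ 3 - 1728) * (W / u ^+ 4) ^+ 3.
Proof. by move=> u0; rewrite -curveC; field. Qed.

(** Taking b2 = -c6/c4 makes a4 = -36 w/A^2 and a6 = t g/A^3, so neither 2 nor 3 remains in a
    denominator. What is left is to write this b2 as a1^2 + 4 a2 with integral a1 and a2. *)
Lemma good_red_A_unit (u a1 a2 : algC) : (A%:~R : F) != 0 ->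
  inK m u -> u != 0 ->
  P_unit m phi (W / u ^+ 4) -> P_integral m phi (G / u ^+ 6) ->
  inK m a1 -> inK m a2 -> P_integral m phi a1 -> P_integral m phi a2 ->
  a1 ^+ 2 + 4 * a2 = - (t%:~R * (G / u ^+ 6)) / (A%:~R * (W / u ^+ 4)) ->
  good_red_at m egr_curve phi.
Proof.
move=> nA Ku u0 Uw Pg K1 K2 P1 P2 th.
have UA := P_unit_int phiP nA; have A0 := P_unit_neq0 phiP UA.
have w0 := P_unit_neq0 phiP Uw.
apply: (@egr_curve_good_red u a1 a2 0) => //; try exact: (inK_int m 0).
- exact: (P_integral_int phiP 0).
- rewrite th; set w := W / u ^+ 4 in Uw w0 *; set g := G / u ^+ 6 in Pg *.
  have -> : ((- (t%:~R * g) / (A%:~R * w)) ^+ 2 - A%:~R * w) / 48 - a1 * 0 / 2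
     = ((t%:~R * g) ^+ 2 - A%:~R ^+ 3 * w ^+ 3) / (48 * (A%:~R * w) ^+ 2).
    by field; rewrite ?A0 ?w0.
  rewrite w_g_eq // -/w.
  have -> : ((A%:~R ^+ 3 - 1728) * w ^+ 3 - A%:~R ^+ 3 * w ^+ 3) / (48 * (A%:~R * w) ^+ 2)
    = - (36 * w / A%:~R ^+ 2) by field; rewrite ?A0 ?w0.
  apply: P_integralN; apply: (P_integral_div phiP); last exact: (P_unitX phiP).
  by apply: (P_integralM phiP); [apply: (P_integral_int phiP 36) | apply: P_unitW].
rewrite th; set w := W / u ^+ 4 in Uw w0 *; set g := G / u ^+ 6 in Pg *.
have -> : ((- (t%:~R * g) / (A%:~R * w)) ^+ 3 - 3 * (- (t%:~R * g) / (A%:~R * w)) * (A%:~R * w) -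
  2 * (t%:~R * g)) / 1728 - 0 ^+ 2 / 4
   = (t%:~R * g) * (A%:~R ^+ 3 * w ^+ 3 - (t%:~R * g) ^+ 2) / (1728 * (A%:~R * w) ^+ 3).
  by field; rewrite ?A0 ?w0.
rewrite w_g_eq // -/w.
have -> : t%:~R * g * (A%:~R ^+ 3 * w ^+ 3 - (A%:~R ^+ 3 - 1728) * w ^+ 3) /
   (1728 * (A%:~R * w) ^+ 3) = t%:~R * g / A%:~R ^+ 3 by field; rewrite ?A0 ?w0.
apply: (P_integral_div phiP); last exact: (P_unitX phiP).
by apply: (P_integralM phiP) => //; apply: (P_integral_int phiP).
Qed.

(** Only 3 needs care. If 3 divides A, then 27 divides t and the short model is integral; otherwise
    A is a unit at 3 and [good_red_A_unit] applies with a1 = 0, since 4 is invertible. *)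
Lemma good_red_not2 (u : algC) : (2%:R : F) != 0 ->
  ((3 %| A)%Z -> (27 %| t)%Z) ->
  inK m u -> u != 0 ->
  P_unit m phi (W / u ^+ 4) -> P_integral m phi (G / u ^+ 6) ->
  good_red_at m egr_curve phi.
Proof.
move=> n2 A3 Ku u0 Uw Pg.
have P0 := P_integral_int phiP 0; have K0 := inK_int m 0.
have U2 : P_unit m phi 2 := P_unit_int (n := 2) phiP n2.
have short : P_integral m phi (A%:~R * (W / u ^+ 4) / 48) ->
   P_integral m phi (t%:~R * (G / u ^+ 6) / 864) -> good_red_at m egr_curve phi.
  move=> I4 I6; apply: (@egr_curve_good_red u 0 0 0) => //.
    rewrite [X in P_integral _ _ X](_ : _ = - (A%:~R * (W / u ^+ 4) / 48)); first exact: P_integralN.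
    by field.
  rewrite [X in P_integral _ _ X](_ : _ = - (t%:~R * (G / u ^+ 6) / 864)); first exact: P_integralN.
  by field.
have [n3|z3] := boolP ((3%:R : F) != 0).
  have U3 : P_unit m phi 3 := P_unit_int (n := 3) phiP n3.
  apply: short; apply: (P_integral_div phiP).
  - by apply: (P_integralM phiP); [apply: P_integral_int | apply: P_unitW].
  - by rewrite (_ : 48 = 2 ^+ 4 * 3 :> algC); [apply: (P_unitM phiP) => //; apply: (P_unitX phiP) | ring].
  - by apply: (P_integralM phiP) => //; apply: P_integral_int.
  rewrite (_ : 864 = 2 ^+ 5 * 3 ^+ 3 :> algC); last by ring.
  by apply: (P_unitM phiP); apply: (P_unitX phiP).
move/negPn/eqP: z3 => z3.
have p3 (n : int) : ((n%:~R : F) == 0) = (3 %| n)%Z.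
  by rewrite -(@dvdz_pcharf F 3) // inE /= z3 eqxx.
have [dA|ndA] := boolP (3 %| A)%Z.
  have /dvdzP[B AB] := dA; have /dvdzP[v tv] := A3 dA.
  apply: short.
    rewrite (_ : A%:~R * _ / 48 = B%:~R * (W / u ^+ 4) / 2 ^+ 4).
      apply: (P_integral_div phiP); last exact: (P_unitX phiP).
      by apply: (P_integralM phiP); [apply: P_integral_int | apply: P_unitW].
    by rewrite AB rmorphM /=; field.
  rewrite (_ : t%:~R * _ / 864 = v%:~R * (G / u ^+ 6) / 2 ^+ 5).
    apply: (P_integral_div phiP); last exact: (P_unitX phiP).
    by apply: (P_integralM phiP) => //; apply: P_integral_int.
  by rewrite tv rmorphM /=; field.
have nA : (A%:~R : F) != 0 by rewrite p3.
have UA := P_unit_int phiP nA; have A0 := P_unit_neq0 phiP UA.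
have w0 := P_unit_neq0 phiP Uw.
have KW : inK m W by apply: inKM; [apply: inK_int | apply: inKX].
have KG : inK m G by apply: inKM; apply: inKX => //; apply: inK_int.
apply: (@good_red_A_unit u 0 (- (t%:~R * (G / u ^+ 6)) / (A%:~R * (W / u ^+ 4)) / 2 ^+ 2)) => //.
- apply: inKf; last by apply: inKX; apply: (inK_int m 2).
  have Kt := inK_int m t; have KA := inK_int m A.
  by repeat first [assumption | apply: inKf | apply: inKM | apply: inKN | apply: inKX].
- apply: (P_integral_div phiP); last exact: (P_unitX phiP).
  apply: (P_integral_div phiP); last exact: (P_unitM phiP).
  apply: P_integralN; apply: (P_integralM phiP) => //; exact: P_integral_int.
by set w := W / u ^+ 4 in w0 *; set g := G / u ^+ 6; field; rewrite A0 w0.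
Qed.

End GoodReduction.

Lemma odd_intP (n : int) : ~~ (2 %| n)%Z -> exists k, n = 2 * k + 1.
Proof. by move=> h; exists (n %/ 2)%Z; lia. Qed.

Lemma odd_sqr_mod8 (n : int) : ~~ (2 %| n)%Z -> exists k, n ^+ 2 = 8 * k + 1.
Proof.
move=> /odd_intP[k ->].
have [[j ->]|[j ->]] : (exists j, k = 2 * j) \/ (exists j, k = 2 * j + 1).
- have [e|e] : (k %% 2)%Z = 0 \/ (k %% 2)%Z = 1 by lia.
    by left; exists (k %/ 2)%Z; lia.
  by right; exists (k %/ 2)%Z; lia.
- by exists (j * (2 * j + 1)); ring.
by exists ((2 * j + 1) * (j + 1)); ring.
Qed.

Lemma dvdz2M (a b : int) : (2 %| a * b)%Z = (2 %| a)%Z || (2 %| b)%Z.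
Proof. exact: (@Euclid_dvdzM 2). Qed.

Lemma dvdz2X (a : int) n : (2 %| a ^+ n.+1)%Z = (2 %| a)%Z.
Proof. exact: (@Euclid_dvdzX 2). Qed.

Lemma dvdz_pow2_sqr (a b : int) (n : nat) : ~~ (2 %| a)%Z ->
  ((2 ^ n)%:Z ^+ 2 %| a * b ^+ 2)%Z -> ((2 ^ n)%:Z %| b)%Z.
Proof.
rewrite dvdzE => na; rewrite Gauss_dvdzr ?dvdz_pexp2r //.
  by apply: coprimezXl; rewrite coprimezE /= coprimeXl // prime_coprime.
Qed.

Lemma phi2_odd (F : finFieldType) (n : int) : (2%:R : F) = 0 ->
  ((n%:~R : F) != 0) = ~~ (2 %| n)%Z.
Proof. by move=> z2; rewrite -(@dvdz_pcharf F 2) // inE /= z2 eqxx. Qed.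

(** With D odd the branch A = 4 modulo 16 of [inR] cannot occur: t = 8 t' turns the equation into D
    t'^2 = (4a + 1)^3 - 27, whose right side is 2 modulo 4. *)
Lemma odd_curve_cases (D A t : int) : ~~ (2 %| D)%Z -> inR A ->
  D * t ^+ 2 = A ^+ 3 - 1728 ->
  ~~ (2 %| A)%Z \/ exists a t', [/\ A = 16 * a, t = 8 * t' & ~~ (2 %| t')%Z].
Proof.
move=> oD RA curve.
have [eA|oA] := boolP (2 %| A)%Z; last by left.
right; case: RA => /(_ eA) [] /dvdzP[a eAa] _.
  have e : D * t ^+ 2 = 8 ^+ 2 * (64 * a ^+ 3 - 27) by rewrite curve eAa; ring.
  have /dvdzP[t' et] : (8 %| t)%Z.
    by apply: (@dvdz_pow2_sqr D t 3 oD); rewrite e; apply: dvdz_mulr.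
  exists a, t'; rewrite eAa et; split; try ring.
  have e2 : D * t' ^+ 2 = 64 * a ^+ 3 - 27.
    by apply: (@mulfI _ (8 ^+ 2)) => //; rewrite -e et; ring.
  by apply/negP => /dvdzP[k ek]; move: e2; rewrite ek; clear; lia.
have e : D * t ^+ 2 = 8 ^+ 2 * ((4 * a + 1) ^+ 3 - 27).
  by rewrite curve (_ : A = 16 * a + 4); [ring | clear -eAa; lia].
have /dvdzP[t' et] : (8 %| t)%Z.
  by apply: (@dvdz_pow2_sqr D t 3 oD); rewrite e; apply: dvdz_mulr.
have e2 : D * t' ^+ 2 = (4 * a + 1) ^+ 3 - 27.
  apply: (@mulfI _ (8 ^+ 2)) => //; rewrite -e et; ring.
have et2 : (2 %| t')%Z.
  have : (2 %| D * t' ^+ 2)%Z by rewrite e2; clear; lia.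
  by rewrite dvdz2M (negPf oD) dvdz2X.
have /dvdzP[k ek] := et2.
by exfalso; move: e2; rewrite ek; clear; lia.
Qed.

Section EverywhereGood.
Variables (D A t m : int) (s : algC).
Hypothesis curve : D * t ^+ 2 = A ^+ 3 - 1728.

Lemma has_egr_of_local : D != 0 -> s != 0 -> inK m s ->
  (forall (F : finFieldType) (phi : algC -> F), OK_hom m phi ->
     good_red_at m (egr_curve D A t s) phi) ->
  has_egr_rational_j m.
Proof.
move=> D0 s0 Ks good; exists (egr_curve D A t s).
have K0 := inK_int m 0; have KD := inK_int m D; have KA := inK_int m A.
have Kt := inK_int m t; have K48 := inK_int m 48; have K864 := inK_int m 864.
set W := D%:~R * s ^+ 2.
have W0 : W != 0 by rewrite mulf_neq0 ?intr_eq0 ?sqrf_eq0.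
have curveC : (D%:~R : algC) * t%:~R ^+ 2 = A%:~R ^+ 3 - 1728.
  have := congr1 (fun n : int => (n%:~R : algC)) curve.
  by rewrite /= rmorphB rmorphM !rmorphXn.
have dE : disc (egr_curve D A t s) = W ^+ 3.
  transitivity (W ^+ 3 * (A%:~R ^+ 3 - D%:~R * t%:~R ^+ 2) / 1728).
    by rewrite /disc /b2 /b4 /b6 /b8 /= /W; field.
  by rewrite curveC; field.
have cE : c4 (egr_curve D A t s) = A%:~R * W.
  by rewrite /c4 /b2 /b4 /= /W; field.
split=> //.
- split; last by rewrite dE expf_neq0.
  by split=> //=;
    repeat first [assumption | apply: inKN | apply: inKf | apply: inKM | apply: inKX].
by exists ((A ^+ 3)%:~R); rewrite ratr_int /jinv cE dE rmorphXn /=; field.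
Qed.

End EverywhereGood.

(** * Good reduction for odd [D] *)

Section OddCase.
Variables (D d Q A t x y zeta delta : int).
Local Notation m := (d * Q).
Local Notation "'pi'" := (sqrtC (m%:~R : algC)).
Hypotheses (Dd : D = delta * d) (delta2 : delta ^+ 2 = 1).
Hypothesis sf : squarefree m.
Hypothesis curve : D * t ^+ 2 = A ^+ 3 - 1728.
Hypothesis RA : inR A.
Hypothesis A3t : (3 %| A)%Z -> (27 %| t)%Z.
Hypothesis d3 : (4 %| d - 3)%Z.
Hypotheses (ox : ~~ (2 %| x)%Z) (oz : ~~ (2 %| zeta)%Z).
Hypothesis conic : Q * y ^+ 2 = 2 ^+ 2 * zeta ^+ 2 + d * x ^+ 2.
Hypothesis prim : forall p : nat, prime p ->
  (p %| x)%Z -> (p %| y)%Z -> (p %| zeta)%Z -> False.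
Hypothesis sign_x : if (2 %| A)%Z then (32 %| t * x - 8)%Z
  else (4 %| t * D + x * A)%Z.

Let s : algC := (d%:~R * x%:~R + y%:~R * pi) / 2.
Let sb : algC := (d%:~R * x%:~R - y%:~R * pi) / 2.

Let pi2 : pi ^+ 2 = d%:~R * Q%:~R.
Proof. by rewrite sqr_pi rmorphM. Qed.

Let conicC : Q%:~R * y%:~R ^+ 2 = 4 * zeta%:~R ^+ 2 + d%:~R * x%:~R ^+ 2 :> algC.
Proof.
have := congr1 (fun n : int => (n%:~R : algC)) conic.
by rewrite /= !(rmorphD, rmorphXn, rmorphM) /= => ->; ring.
Qed.

Let norm_s : s * sb = - d%:~R * zeta%:~R ^+ 2.
Proof.
transitivity ((d%:~R ^+ 2 * x%:~R ^+ 2 - y%:~R ^+ 2 * pi ^+ 2) / 4 : algC).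
  by rewrite /s /sb; field.
rewrite pi2; transitivity ((d%:~R ^+ 2 * x%:~R ^+ 2 - d%:~R * (Q%:~R * y%:~R ^+ 2)) / 4 : algC).
  by field.
by rewrite conicC; field.
Qed.

Let trace_s : s + sb = d%:~R * x%:~R.
Proof. by rewrite /s /sb; field. Qed.

(** Trace and norm are integers, so [s] is integral in spite of its denominator 2. *)
Let sqr_s : s ^+ 2 = (d * x)%:~R * s + (d * zeta ^+ 2)%:~R.
Proof.
transitivity ((s + sb) * s - s * sb); first by ring.
by rewrite trace_s norm_s !(rmorphXn, rmorphM) /=; ring.
Qed.

Let Ks : inK m s.
Proof.
apply: inKf; last exact: (inK_int _ 2).
by apply: inKD; apply: inKM; try exact: inK_int; apply: inK_pi.
Qed.
Let Os : inOK m s. Proof. exact: inOK_quadratic Ks sqr_s. Qed.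
Let Osb : inOK m sb.
Proof.
have -> : sb = d%:~R * x%:~R - s by rewrite -trace_s; ring.
by apply: inOKD; [apply: inOKM; apply: inOK_int | apply: inOKN].
Qed.

Let od : ~~ (2 %| d)%Z. Proof. by clear -d3; lia. Qed.
Let z0 : zeta != 0. Proof. by apply: contraNneq oz => ->. Qed.
Let d0 : d != 0. Proof. by apply: contraNneq od => ->. Qed.
Let s0 : s != 0.
Proof.
apply/eqP => e; have := norm_s; rewrite e mul0r => /esym/eqP.
by rewrite mulf_eq0 oppr_eq0 sqrf_eq0 !intr_eq0 (negPf d0) (negPf z0).
Qed.
Let delta_pm : delta = 1 \/ delta = -1.
Proof. by move/eqP: delta2; rewrite sqrf_eq1 => /orP[] /eqP; [left|right]. Qed.
Let oD : ~~ (2 %| D)%Z. Proof. by rewrite Dd dvdz2M (negPf od) orbF; case: delta_pm => ->. Qed.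

(* zeta and x being odd and d = 3 mod 4, s is a cube root of x = +-1 modulo 4. *)
Let cube_s : exists c e : int, s ^+ 3 = 4 * (c%:~R * s + e%:~R) + x%:~R.
Proof.
have [c hc] : exists c, d ^+ 2 * x ^+ 2 + d * zeta ^+ 2 = 4 * c.
  have [k1 ->] := odd_sqr_mod8 od; have [k2 ->] := odd_sqr_mod8 ox.
  have [k3 ->] := odd_sqr_mod8 oz; have /dvdzP[k4 e] := d3.
  have -> : d = 4 * k4 + 3 by clear -e; lia.
  by exists (16 * k1 * k2 + 2 * k1 + 2 * k2 + 1 + 8 * k3 * k4 + 6 * k3 + k4); ring.
have [e he] : exists e, d ^+ 2 * x * zeta ^+ 2 = x + 4 * e.
  have [k1 ->] := odd_sqr_mod8 od; have [k3 ->] := odd_sqr_mod8 oz.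
  by exists (x * (16 * k1 * k3 + 2 * k1 + 2 * k3)); ring.
exists c, e.
have -> : s ^+ 3 = (d ^+ 2 * x ^+ 2 + d * zeta ^+ 2)%:~R * s + (d ^+ 2 * x * zeta ^+ 2)%:~R.
  rewrite exprS sqr_s mulrDr mulrCA -expr2 sqr_s !(rmorphD, rmorphXn, rmorphM) /=; ring.
by rewrite hc he !(rmorphM, rmorphD) /=; ring.
Qed.

(** [s] has odd norm, hence is a unit at 2 and u = 1 serves. The two shapes of (A, t) call for
    different models, and the sign condition on x makes each of them integral. *)
Let curve_good_at2 (F : finFieldType) (phi : algC -> F) : OK_hom m phi ->
  (2%:R : F) = 0 -> good_red_at m (egr_curve D A t s) phi.
Proof.
move=> phiP z2.
have nd : (d%:~R : F) != 0 by rewrite phi2_odd.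
have ns : phi s != 0.
  have := congr1 phi norm_s; rewrite (OK_homM phiP) // -rmorphN -rmorphXn -rmorphM.
  rewrite (OK_hom_int phiP) => e; apply: contraTneq isT => es.
  have : ((- d * zeta ^+ 2)%:~R : F) != 0 by rewrite phi2_odd // dvdz2M dvdz2X negb_or oz andbT dvdzE abszN -dvdzE.
  by rewrite -e es mul0r eqxx.
have [K1 u10 Uw Pg] := scaling_one Dd delta2 Os phiP nd ns.
have [c [e es]] := cube_s.
have PI := P_integral_int phiP; have Ps := P_integral_OK phiP Os.
have OI := inOK_int m; have KI := inK_int m.
case: (odd_curve_cases oD RA curve) => [oA|[a [t' [eA et _]]]].
- have nA : (A%:~R : F) != 0 by rewrite phi2_odd.
  have UA := P_unit_int phiP nA; have A0 := P_unit_neq0 phiP UA.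
  move: sign_x; rewrite (negPf oA) => /dvdzP[k ek].
  have ekC : (t%:~R : algC) * D%:~R = 4 * k%:~R - x%:~R * A%:~R.
    have := congr1 (fun n : int => (n%:~R : algC)) ek.
    by rewrite /= rmorphD !rmorphM /= => h; rewrite (mulrC 4) -h; ring.
  (* Here a1 = s^2. Modulo 4, s^4 = s s^3 is x s and the sign condition says t D = - x A, so b2 = -
     t D s/A agrees with a1^2 modulo 4. *)
  apply: (@good_red_A_unit D A t m s curve F phi phiP Ks 1 (s ^+ 2)
    (- (s * (A%:~R * (c%:~R * s + e%:~R) + k%:~R) / A%:~R))) => //.
  + exact: inKX.
  + by repeat first [assumption | apply: inKN | apply: inKf | apply: inKM | apply: inKD].
  + exact: (P_integralX phiP).
  + apply: P_integralN; apply: (P_integral_div phiP) => //.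
    apply: (P_integralM phiP) => //; apply: (P_integralD phiP) => //.
    apply: (P_integralM phiP) => //; apply: (P_integralD phiP) => //.
    exact: (P_integralM phiP).
  have D0 : (D%:~R : algC) != 0 by rewrite intr_eq0; apply: contraNneq oD => ->.
  have -> : - (t%:~R * (D%:~R ^+ 2 * s ^+ 3 / 1 ^+ 6)) / (A%:~R * (D%:~R * s ^+ 2 / 1 ^+ 4))
     = - (t%:~R * D%:~R) * s / A%:~R by field; rewrite A0 D0 s0.
  have -> : (s ^+ 2) ^+ 2 = s * s ^+ 3 by ring.
  by rewrite es ekC; field; rewrite A0.
have n3 : ((3 : int)%:~R : F) != 0 by rewrite phi2_odd.
have U3 : P_unit m phi 3 := P_unit_int phiP n3.
have eA2 : (2 %| A)%Z by rewrite eA; clear; lia.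
move: sign_x; rewrite eA2 => /dvdzP[k ek].
have ek2 : t' * x = 4 * k + 1 by move: ek; rewrite et; clear; lia.
have [k2 ek3] := odd_sqr_mod8 oD.
have hD : t' * D ^+ 2 * x + 27 = 4 * (D ^+ 2 * k + 2 * k2 + 7).
  have -> : t' * D ^+ 2 * x = D ^+ 2 * (t' * x) by ring.
  by rewrite ek2 ek3; ring.
have hDC : (t'%:~R : algC) * D%:~R ^+ 2 * x%:~R = 4 * (D ^+ 2 * k + 2 * k2 + 7)%:~R - 27.
  apply: (addIr 27); rewrite subrK.
  transitivity ((t' * D ^+ 2 * x + 27)%:~R : algC); last by rewrite hD rmorphM.
  by rewrite !(rmorphD, rmorphXn, rmorphM).
(* For A = 16 a the model has a1 = a2 = 0 and a3 = 1. Its a6 needs 4 to divide t' D^2 s^3 + 27, and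
   modulo 4 one has s^3 = x, t' x = 1 and D^2 = 1. *)
apply: (@egr_curve_good_red D A t m s curve F phi phiP Ks 1 0 0 1) => //.
- exact: (KI 0).
- exact: (KI 0).
- exact: (PI 0).
- exact: (PI 0).
- exact: (PI 1).
- have -> : ((0 ^+ 2 + 4 * 0) ^+ 2 - A%:~R * (D%:~R * s ^+ 2 / 1 ^+ 4)) / 48 - 0 * 1 / 2
    = - (a%:~R * (D%:~R * s ^+ 2)) / 3 by rewrite eA rmorphM /=; field.
  apply: (P_integral_div phiP) => //; apply: P_integralN; apply: (P_integralM phiP) => //.
  by apply: (P_integralM phiP) => //; apply: (P_integralX phiP).
have -> : ((0 ^+ 2 + 4 * 0) ^+ 3 - 3 * (0 ^+ 2 + 4 * 0) * (A%:~R * (D%:~R * s ^+ 2 / 1 ^+ 4)) -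
     2 * (t%:~R * (D%:~R ^+ 2 * s ^+ 3 / 1 ^+ 6))) / 1728 - 1 ^+ 2 / 4
   = - (t'%:~R * D%:~R ^+ 2 * (c%:~R * s + e%:~R) + (D ^+ 2 * k + 2 * k2 + 7)%:~R) / 3 ^+ 3.
  rewrite es et rmorphM /=.
  transitivity (- (t'%:~R * D%:~R ^+ 2 * (4 * (c%:~R * s + e%:~R)) + t'%:~R * D%:~R ^+ 2 * x%:~R
      + 27) / 108 : algC); first by field.
  by rewrite hDC; field.
apply: (P_integral_div phiP); last exact: (P_unitX phiP).
apply: P_integralN; apply: (P_integralD phiP) => //.
apply: (P_integralM phiP); last by apply: (P_integralD phiP) => //; apply: (P_integralM phiP).
by apply: (P_integralM phiP) => //; apply: (P_integralX phiP).
Qed.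

(** Away from 2, [u] is pi over the primes of d, and elsewhere 1 or zeta according to which of [s]
    and its conjugate is a unit. *)
Lemma has_egr_odd : has_egr_rational_j m.
Proof.
have D0 : D != 0 by apply: contraNneq oD => ->.
apply: (has_egr_of_local curve D0 s0 Ks) => F phi phiP.
have [z2|n2] := eqVneq (2%:R : F) 0; first exact: curve_good_at2.
have trace1 : s + sb = (1 : int)%:~R * d%:~R * x%:~R by rewrite trace_s mul1r.
have s_pi : (2 : int)%:~R * Q%:~R * s = pi * (Q%:~R * y%:~R + x%:~R * pi).
  transitivity (Q%:~R * y%:~R * pi + x%:~R * pi ^+ 2 : algC); last by ring.
  by rewrite pi2 /s /=; field.
have good u : scaling D d Q s phi u -> good_red_at m (egr_curve D A t s) phi.
  by case=> Ku u0 Uw Pg; apply: (good_red_not2 curve phiP Ks n2 A3t Ku u0 Uw Pg).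
have [zd|nd] := eqVneq (d%:~R : F) 0.
  exact: good (scaling_pi Dd delta2 sf s_pi conic prim phiP zd n2).
have [ns|nsb] := phi_s_or_sb sf Os Osb norm_s trace1 conic prim phiP nd (oner_neq0 _).
  exact: good (scaling_one Dd delta2 Os phiP nd ns).
exact: good (scaling_zeta Dd delta2 Osb norm_s z0 phiP nd nsb).
Qed.

End OddCase.

(** * Good reduction for even [D] *)

Section EvenCongruences.
Variables (Q a x y z t d : int).
Hypotheses (oQ : ~~ (2 %| Q)%Z) (ox : ~~ (2 %| x)%Z) (oy : ~~ (2 %| y)%Z)
  (oz : ~~ (2 %| z)%Z) (ot : ~~ (2 %| t)%Z) (od : ~~ (2 %| d)%Z).

(** In the model with a1 = pi and a3 = 1, the numbers 12 Q^2 a4 and 216 Q^3 a6 are split along 1 and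
    pi; the four congruences give divisibility by 4 and 8, the powers of 2 in 12 and 216. Here [t]
    and [d] stand for t/8 and d/2 of the curve. *)
Lemma even_a4_rat :
  (4 %| Q ^+ 2 * (1 - 2 * a) ^+ 2 - (1 + 4 * a) * (z ^+ 2 + 2 * (2 * d) * x ^+ 2))%Z.
Proof.
have [q' ->] := odd_sqr_mod8 oQ; have [x' ->] := odd_sqr_mod8 ox.
have [z' ->] := odd_sqr_mod8 oz; clear; lia.
Qed.

Lemma even_a4_irr : (4 %| 2 * (1 + 4 * a) * x * y + 6 * Q ^+ 2)%Z.
Proof.
have [q' ->] := odd_sqr_mod8 oQ; have [X ->] := odd_intP ox.
have [Y ->] := odd_intP oy; clear; lia.
Qed.

Lemma even_a6_rat :
  (8 %| Q ^+ 3 * (1 - 2 * a) ^+ 3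
    - 3 * (1 - 2 * a) * (1 + 4 * a) * Q * (z ^+ 2 + 2 * (2 * d) * x ^+ 2)
    - 2 * t * (2 * d) * x * (3 * Q * y ^+ 2 + 2 * d * x ^+ 2) - 54 * Q ^+ 3)%Z.
Proof.
have [q' eQ] := odd_sqr_mod8 oQ.
have [h eh] : exists k, (1 - 2 * a) ^+ 2 = 8 * k + 1.
  by apply: odd_sqr_mod8; clear; lia.
have [x' ex] := odd_sqr_mod8 ox; have [y' ey] := odd_sqr_mod8 oy.
have [z' ez] := odd_sqr_mod8 oz.
rewrite !(exprS _ 2) eQ eh ex ey ez.
have [q ->] := odd_intP oQ; have [X ->] := odd_intP ox.
have [tt ->] := odd_intP ot; have [dd ->] := odd_intP od.
clear; lia.
Qed.

(** The one congruence of the four that is sensitive to signs; it dictates the sign of x. *)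
Lemma even_a6_irr : (4 %| x * (1 - 2 * a) + t)%Z ->
  (8 %| 6 * (1 - 2 * a) * (1 + 4 * a) * Q * x * y
    + 2 * t * y * (Q * y ^+ 2 + 3 * (2 * d) * x ^+ 2))%Z.
Proof.
move=> /dvdzP[k ek].
have [x' ->] := odd_sqr_mod8 ox; have [y' ->] := odd_sqr_mod8 oy.
have -> : t = 4 * k - x * (1 - 2 * a) by clear -ek; lia.
have [q ->] := odd_intP oQ; have [X ->] := odd_intP ox.
have [dd ->] := odd_intP od.
clear; lia.
Qed.

End EvenCongruences.

Lemma squarefree_even_half (d : int) : squarefree d -> (2 %| d)%Z ->
  exists d', d = 2 * d' /\ ~~ (2 %| d')%Z.
Proof.
move=> sf /dvdzP[d' ed]; exists d'; split; first by rewrite ed mulrC.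
apply/negP => /dvdzP[k ek].
have := @squarefree_prime _ 2 sf isT; rewrite ed ek -mulrA.
by rewrite dvdz_mull.
Qed.

(** Opposite to the odd case. If 16 divided A, then d/2 times a square would equal 2 (64 a^3 - 27),
    twice an odd number, although d/2 is odd. For A = 16 a + 4 the cofactor (2a - 1)(16 a^2 + 20 a +
    13) is odd, whence t/8 is odd. *)
Lemma even_curve_form (d A t : int) : squarefree d -> (2 %| d)%Z -> inR A ->
  d * t ^+ 2 = A ^+ 3 - 1728 ->
  exists a t', [/\ A = 16 * a + 4, t = 8 * t' & ~~ (2 %| t')%Z].
Proof.
move=> sfd d2 RA curve; have [d' [ed od']] := squarefree_even_half sfd d2.
have eA : (2 %| A)%Z.
  have : (2 %| A ^+ 3)%Z.
    have -> : A ^+ 3 = d * t ^+ 2 + 1728 by rewrite curve; ring.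
    by rewrite ed; clear; lia.
  by rewrite dvdz2X.
case: RA => /(_ eA) [] /dvdzP[a ea] _.
  exfalso.
  have e : d' * t ^+ 2 = 4 ^+ 2 * (2 * (64 * a ^+ 3 - 27)).
    by apply: (@mulfI _ 2) => //; transitivity (d * t ^+ 2); [rewrite ed | rewrite curve ea]; ring.
  have /dvdzP[u eu] : (4 %| t)%Z.
    by apply: (@dvdz_pow2_sqr d' t 2 od'); rewrite e; apply: dvdz_mulr.
  have e2 : d' * u ^+ 2 = 2 * (64 * a ^+ 3 - 27).
    by apply: (@mulfI _ (4 ^+ 2)) => //; rewrite -e eu; ring.
  have : (2 %| d' * u ^+ 2)%Z by rewrite e2; apply: dvdz_mulr.
  rewrite dvdz2M (negPf od') dvdz2X /= => /dvdzP[v ev].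
  by move: e2; rewrite ev; clear; lia.
have eA4 : A = 16 * a + 4 by clear -ea; lia.
have e : d' * t ^+ 2 = 8 ^+ 2 * ((2 * a - 1) * (16 * a ^+ 2 + 20 * a + 13)).
  by apply: (@mulfI _ 2) => //; transitivity (d * t ^+ 2); [rewrite ed | rewrite curve eA4]; ring.
have /dvdzP[u eu] : (8 %| t)%Z.
  by apply: (@dvdz_pow2_sqr d' t 3 od'); rewrite e; apply: dvdz_mulr.
exists a, u; split=> //; first by rewrite eu mulrC.
have e2 : d' * u ^+ 2 = (2 * a - 1) * (16 * a ^+ 2 + 20 * a + 13).
  by apply: (@mulfI _ (8 ^+ 2)) => //; rewrite -e eu; ring.
apply/negP => /dvdzP[v ev].
by move: e2; rewrite ev; clear; lia.
Qed.

Section EvenCase.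
Variables (d Q A t x y z : int).
Local Notation m := (d * Q).
Local Notation "'pi'" := (sqrtC (m%:~R : algC)).
Hypothesis sf : squarefree m.
Hypothesis curve : d * t ^+ 2 = A ^+ 3 - 1728.
Hypothesis RA : inR A.
Hypothesis A3t : (3 %| A)%Z -> (27 %| t)%Z.
Hypothesis d2 : (2 %| d)%Z.
Hypotheses (ox : ~~ (2 %| x)%Z) (oz : ~~ (2 %| z)%Z).
Hypothesis conic : Q * y ^+ 2 = z ^+ 2 + d * x ^+ 2.
Hypothesis prim : forall p : nat, prime p ->
  (p %| x)%Z -> (p %| y)%Z -> (p %| z)%Z -> False.
Hypothesis sign_x : forall a t', A = 16 * a + 4 -> t = 8 * t' -> (4 %| x * (1 - 2 * a) + t')%Z.

Let s : algC := d%:~R * x%:~R + y%:~R * pi.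
Let sb : algC := d%:~R * x%:~R - y%:~R * pi.

Let pi2 : pi ^+ 2 = d%:~R * Q%:~R.
Proof. by rewrite sqr_pi rmorphM. Qed.

Let conicC : Q%:~R * y%:~R ^+ 2 = z%:~R ^+ 2 + d%:~R * x%:~R ^+ 2 :> algC.
Proof.
have := congr1 (fun n : int => (n%:~R : algC)) conic.
by rewrite /= !(rmorphD, rmorphXn, rmorphM).
Qed.

Let norm_s : s * sb = - d%:~R * z%:~R ^+ 2.
Proof.
transitivity (d%:~R ^+ 2 * x%:~R ^+ 2 - y%:~R ^+ 2 * pi ^+ 2 : algC).
  by rewrite /s /sb; ring.
rewrite pi2; transitivity (d%:~R ^+ 2 * x%:~R ^+ 2 - d%:~R * (Q%:~R * y%:~R ^+ 2) : algC).
  by ring.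
by rewrite conicC; ring.
Qed.

Let trace_s : s + sb = (2 : int)%:~R * d%:~R * x%:~R.
Proof. by rewrite /s /sb; ring. Qed.

Let Os : inOK m s.
Proof. by apply: inOKD; apply: inOKM; try exact: inOK_int; apply: inOK_pi. Qed.
Let Ks : inK m s. Proof. by case: Os. Qed.
Let Osb : inOK m sb.
Proof.
have -> : sb = d%:~R * x%:~R + - (y%:~R * pi) by [].
apply: inOKD; first by apply: inOKM; apply: inOK_int.
by apply: inOKN; apply: inOKM; [apply: inOK_int | apply: inOK_pi].
Qed.

Let s_pi : (1 : int)%:~R * Q%:~R * s = pi * (Q%:~R * y%:~R + x%:~R * pi).
Proof.
transitivity (Q%:~R * y%:~R * pi + x%:~R * pi ^+ 2 : algC); last by ring.
by rewrite pi2 /s /=; ring.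
Qed.

Let d0 : d != 0. Proof. by case: sf; rewrite mulf_eq0 negb_or => /andP[]. Qed.
Let z0 : z != 0. Proof. by apply: contraNneq oz => ->. Qed.
Let s0 : s != 0.
Proof.
apply/eqP => e; have := norm_s; rewrite e mul0r => /esym/eqP.
by rewrite mulf_eq0 oppr_eq0 sqrf_eq0 !intr_eq0 (negPf d0) (negPf z0).
Qed.

Let sfd : squarefree d.
Proof.
have [m0 h] := sf; split; first by apply: contraNneq m0 => ->; rewrite mul0r.
by move=> n nd; apply: h; rewrite abszM dvdn_mulr.
Qed.

Let oQ : ~~ (2 %| Q)%Z.
Proof.
apply/negP => Q2; have := @squarefree_prime _ 2 sf isT.
by rewrite expr2 dvdz_mul.
Qed.

Let oy : ~~ (2 %| y)%Z.
Proof.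
have : ~~ (2 %| Q * y ^+ 2)%Z.
  have [k1 e1] := odd_sqr_mod8 oz; have [d' [ed _]] := squarefree_even_half sfd d2.
  by rewrite conic e1 ed; clear; lia.
by rewrite dvdz2M dvdz2X negb_or => /andP[].
Qed.

(** 2 divides d, so u = pi is the scaling here. The model takes a1 = pi and a3 = 1, and a1^2 = d Q
    is twice an odd number. *)
Let curve_good_at2 (F : finFieldType) (phi : algC -> F) : OK_hom m phi ->
  (2%:R : F) = 0 -> good_red_at m (egr_curve d A t s) phi.
Proof.
move=> phiP z2.
have zd : (d%:~R : F) = 0 by apply/eqP; rewrite -[_ == 0]negbK phi2_odd // negbK.
have Dd : d = 1 * d by rewrite mul1r.
have n1 : ((1 : int)%:~R : F) != 0 := oner_neq0 F.
have conic' : Q * y ^+ 2 = 1 ^+ 2 * z ^+ 2 + d * x ^+ 2 by rewrite expr1n mul1r.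
have [Kpi pi0 Uw Pg] := scaling_pi Dd (expr1n _ 2) sf s_pi conic' prim phiP zd n1.
have [eqw eqg] := scaling_pi_eqs Dd (expr1n _ 2) sf s_pi (oner_neq0 _).
have PI := P_integral_int phiP; have KI := inK_int m.
have Ppi := P_integral_OK phiP (inOK_pi m).
have nQ : (Q%:~R : F) != 0 by rewrite phi2_odd.
have UQ := P_unit_int phiP nQ; have Q0 := P_unit_neq0 phiP UQ.
have n3 : ((3 : int)%:~R : F) != 0 by rewrite phi2_odd.
have U3 : P_unit m phi 3 := P_unit_int phiP n3.
have [a [t' [eA et ot']]] := even_curve_form sfd d2 RA curve.
have [d' [ed od']] := squarefree_even_half sfd d2.
have sx := sign_x eA et.
have oQd : ~~ (2 %| d' * Q)%Z by rewrite dvdz2M negb_or od'.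
(* [al] is chosen to make b2 = pi^2 + 4 al equal to 2 (1 - 2 a), whatever the odd number d' Q is. *)
have [al eal] : exists al, d' * Q + 2 * al = 1 - 2 * a.
  have [k ek] := odd_intP oQd; exists (- k - a); rewrite ek; ring.
have etaC : pi ^+ 2 + 4 * al%:~R = 2 * (1 - 2 * a)%:~R.
  rewrite pi2 -eal ed !(rmorphD, rmorphM) /=; ring.
have wE : d%:~R * s ^+ 2 / pi ^+ 4 =
   (z%:~R ^+ 2 + 2 * d%:~R * x%:~R ^+ 2 + 2 * x%:~R * y%:~R * pi) / Q%:~R ^+ 2.
  rewrite eqw; transitivity ((Q%:~R ^+ 2 * y%:~R ^+ 2 + x%:~R ^+ 2 * pi ^+ 2
     + 2 * x%:~R * y%:~R * pi * Q%:~R) / Q%:~R ^+ 3); first by field.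
  rewrite pi2.
  transitivity ((Q%:~R * y%:~R ^+ 2 + x%:~R ^+ 2 * d%:~R
     + 2 * x%:~R * y%:~R * pi) / Q%:~R ^+ 2 : algC); first by field.
  by rewrite conicC; field.
have gE : d%:~R ^+ 2 * s ^+ 3 / pi ^+ 6 =
   (d%:~R * x%:~R * (3 * Q%:~R * y%:~R ^+ 2 + d%:~R * x%:~R ^+ 2)
    + pi * (y%:~R * (Q%:~R * y%:~R ^+ 2 + 3 * d%:~R * x%:~R ^+ 2))) / Q%:~R ^+ 3.
  rewrite eqg; transitivity ((pi ^+ 2 * (3 * Q%:~R ^+ 2 * y%:~R ^+ 2 * x%:~R + x%:~R ^+ 3 * pi ^+ 2)
     + pi * (Q%:~R ^+ 3 * y%:~R ^+ 3 + 3 * Q%:~R * y%:~R * x%:~R ^+ 2 * pi ^+ 2)) / Q%:~R ^+ 5).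
    by field.
  by rewrite pi2; field.
have /dvdzP[k1 e1] := even_a4_rat a d' oQ ox oz.
have /dvdzP[k2 e2] := even_a4_irr a oQ ox oy.
have /dvdzP[k3 e3] := even_a6_rat a oQ ox oy oz ot' od'.
have /dvdzP[k4 e4] := even_a6_irr oQ ox oy od' sx.
rewrite -ed in e1; rewrite -!ed in e3; rewrite -ed in e4.
have castE (u v : int) : u = v -> u%:~R = v%:~R :> algC by move->.
move: (castE _ _ e1) (castE _ _ e2) (castE _ _ e3) (castE _ _ e4).
rewrite !(rmorphB, rmorphD, rmorphXn, rmorphM) /= => c1 c2 c3 c4.
apply: (@egr_curve_good_red d A t m s curve F phi phiP Ks pi pi al%:~R 1) => //.
- exact: (KI 1).
- exact: (PI 1).
- rewrite etaC wE.
  have -> : ((2 * (1 - 2 * a)%:~R) ^+ 2 - A%:~R *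
     ((z%:~R ^+ 2 + 2 * d%:~R * x%:~R ^+ 2 + 2 * x%:~R * y%:~R * pi) / Q%:~R ^+ 2)) / 48 - pi * 1 / 2
    = (k1%:~R - k2%:~R * pi) / (3 * Q%:~R ^+ 2).
    transitivity ((k1%:~R * 4 - (k2%:~R * 4) * pi) / (12 * Q%:~R ^+ 2)); last by field.
    rewrite -c1 -c2 eA !(rmorphB, rmorphD, rmorphM) /=; by field.
  apply: (P_integral_div phiP); last by apply: (P_unitM phiP) => //; apply: (P_unitX phiP).
  apply: (P_integralD phiP) => //; apply: P_integralN; exact: (P_integralM phiP).
rewrite etaC wE gE.
rewrite [X in P_integral _ _ X](_ : _ = (k3%:~R - k4%:~R * pi) / (3 ^+ 3 * Q%:~R ^+ 3)); last first.
  transitivity ((k3%:~R * 8 - (k4%:~R * 8) * pi) / (216 * Q%:~R ^+ 3)); last by field.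
  rewrite -c3 -c4 eA et !(rmorphB, rmorphD, rmorphM) /=; by field.
apply: (P_integral_div phiP); last by apply: (P_unitM phiP); apply: (P_unitX phiP).
apply: (P_integralD phiP) => //; apply: P_integralN; exact: (P_integralM phiP).
Qed.

Lemma has_egr_even : has_egr_rational_j m.
Proof.
apply: (has_egr_of_local curve d0 s0 Ks) => F phi phiP.
have [z2|n2] := eqVneq (2%:R : F) 0; first exact: curve_good_at2.
have Dd : d = 1 * d by rewrite mul1r.
have conic' : Q * y ^+ 2 = 1 ^+ 2 * z ^+ 2 + d * x ^+ 2 by rewrite expr1n mul1r.
have good u : scaling d d Q s phi u -> good_red_at m (egr_curve d A t s) phi.
  by case=> Ku u0 Uw Pg; apply: (good_red_not2 curve phiP Ks n2 A3t Ku u0 Uw Pg).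
have [zd|nd] := eqVneq (d%:~R : F) 0.
  exact: good (scaling_pi Dd (expr1n _ 2) sf s_pi conic' prim phiP zd (oner_neq0 _)).
have [ns|nsb] := phi_s_or_sb sf Os Osb norm_s trace_s conic' prim phiP nd n2.
  exact: good (scaling_one Dd (expr1n _ 2) Os phiP nd ns).
exact: good (scaling_zeta Dd (expr1n _ 2) Osb norm_s z0 phiP nd nsb).
Qed.

End EvenCase.

(** * From solutions of the conic to counted integers *)

Lemma prime_dvdz1 (p : nat) : prime p -> (p %| (1 : int))%Z = false.
Proof. by move=> pp; rewrite dvdzE; exact: Euclid_dvd1. Qed.

Lemma squarefree_dvdz_sqr (D t : int) (p n : nat) : squarefree D -> prime p ->
  ((p ^ n)%:Z ^+ 2 %| D * t ^+ 2)%Z -> ((p ^ n)%:Z %| t)%Z.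
Proof.
move=> sfD pp; elim: n t => [|n IH] t; first by rewrite dvd1z.
move=> dv; have [/dvdzP[u tu]|npt] := boolP (p %| t)%Z.
  rewrite tu expnSr PoszM dvdz_mul //; apply: IH.
  have p0 : (p%:Z) ^+ 2 != 0 by rewrite expf_neq0 // -lt0n prime_gt0.
  rewrite -(@dvdz_mul2r (p%:Z ^+ 2)) //.
  by move: dv; rewrite tu expnSr PoszM !exprMn !mulrA.
have : (p%:Z ^+ 2 %| D)%Z.
  apply: (Gauss_dvdz_sqr (a := t ^+ 2)); rewrite ?Euclid_dvdzX // mulrC.
  apply: dvdz_trans dv; rewrite dvdz_exp2r //.
  by rewrite expnSr PoszM dvdz_mull.
by rewrite squarefree_prime.
Qed.

(** 12^3 = 1728: for A = 12 + 27 a the right side acquires the factor 27^2, and D being squarefree,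
    27 passes to t. *)
Lemma curve_dvd3 (D A t : int) : squarefree D -> inR A ->
  D * t ^+ 2 = A ^+ 3 - 1728 -> (3 %| A)%Z -> (27 %| t)%Z.
Proof.
move=> sfD [_ R3] curve /R3 /dvdzP[a ea].
apply: (@squarefree_dvdz_sqr D t 3 3) => //.
rewrite curve (_ : A = 27 * a + 12); last by clear -ea; lia.
have -> : (27 * a + 12) ^+ 3 - 1728 = a * (16 + 36 * a + 27 * a ^+ 2) * 27 ^+ 2 by ring.
exact: dvdz_mull.
Qed.

Lemma odd_sign (a b c : int) : ~~ (2 %| a)%Z -> ~~ (2 %| b)%Z -> ~~ (2 %| c)%Z ->
  (4 %| a + b * c)%Z \/ (4 %| a - b * c)%Z.
Proof.
move=> oa ob oc; have : ~~ (2 %| b * c)%Z by rewrite dvdz2M negb_or ob.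
by move: (b * c) => e; clear -oa; lia.
Qed.

(** The conic does not see the sign [e] of x, and for odd residues one of the two signs satisfies
    the condition at 2 that [has_egr_odd] asks for. *)
Lemma counted_of_primitive_odd (D d Q x y z delta : int) :
  good D -> D = delta * d -> delta ^+ 2 = 1 -> (4 %| d - 3)%Z ->
  squarefree (d * Q) -> ~~ (2 %| x)%Z -> ~~ (2 %| z)%Z ->
  Q * y ^+ 2 = 2 ^+ 2 * z ^+ 2 + d * x ^+ 2 ->
  (forall p : nat, prime p -> (p %| x)%Z -> (p %| y)%Z -> (p %| z)%Z -> False) ->
  has_egr_rational_j (d * Q).
Proof.
move=> [sfD [A [t [RA curve]]]] Dd delta2 d3 sf ox oz conic prim.
have A3t := curve_dvd3 sfD RA curve.
have od : ~~ (2 %| d)%Z by clear -d3; lia.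
have oD : ~~ (2 %| D)%Z.
  rewrite Dd dvdz2M negb_or od andbT -(dvdz2X _ 1) delta2 //.
have egr e : e ^+ 2 = 1 ->
   (if (2 %| A)%Z then (32 %| t * (e * x) - 8)%Z else (4 %| t * D + e * x * A)%Z) ->
   has_egr_rational_j (d * Q).
  move=> e2 sx; have oe : ~~ (2 %| e)%Z by rewrite -(dvdz2X _ 1) e2.
  apply: (has_egr_odd Dd delta2 sf curve RA A3t d3 (x := e * x) (y := y) (zeta := z)) => //.
  - by rewrite dvdz2M negb_or oe.
  - by rewrite conic exprMn e2 mul1r.
  move=> p pp; rewrite Euclid_dvdzM // => /orP[pe|px]; last exact: prim px.
  have : (p %| e ^+ 2)%Z by rewrite expr2 dvdz_mulr.
    by rewrite e2 prime_dvdz1.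
have [oA|[a [t' [eA et ot']]]] := odd_curve_cases oD RA curve.
  have ot : ~~ (2 %| t)%Z.
    have : ~~ (2 %| D * t ^+ 2)%Z.
      have : ~~ (2 %| A ^+ 3)%Z by rewrite dvdz2X.
      by rewrite curve; move: (A ^+ 3) => B; clear; lia.
    by rewrite dvdz2M dvdz2X negb_or => /andP[].
  have oDt : ~~ (2 %| t * D)%Z by rewrite dvdz2M negb_or ot.
  by have [h|h] := odd_sign oDt ox oA; [apply: (egr 1) | apply: (egr (-1))] => //;
    rewrite (negPf oA) ?mul1r ?mulN1r ?mulNr.
have eA2 : (2 %| A)%Z by rewrite eA; clear; lia.
have [h|h] := @odd_sign (-1) t' x isT ot' ox; [apply: (egr 1) | apply: (egr (-1))] => //;
  rewrite eA2 et ?mul1r ?mulN1r ?mulrN -mulrA; move: h; move: (t' * x) => w; clear; lia.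
Qed.

Lemma counted_of_primitive_even (d Q x y z : int) :
  good d -> (2 %| d)%Z ->
  squarefree (d * Q) -> ~~ (2 %| x)%Z -> ~~ (2 %| z)%Z ->
  Q * y ^+ 2 = z ^+ 2 + d * x ^+ 2 ->
  (forall p : nat, prime p -> (p %| x)%Z -> (p %| y)%Z -> (p %| z)%Z -> False) ->
  has_egr_rational_j (d * Q).
Proof.
move=> [sfd [A [t [RA curve]]]] d2 sf ox oz conic prim.
have A3t := curve_dvd3 sfd RA curve.
have [a [t' [eA et ot']]] := even_curve_form sfd d2 RA curve.
have egr e : e ^+ 2 = 1 -> (4 %| e * x * (1 - 2 * a) + t')%Z -> has_egr_rational_j (d * Q).
  move=> e2 sx; have oe : ~~ (2 %| e)%Z by rewrite -(dvdz2X _ 1) e2.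
  apply: (has_egr_even sf curve RA A3t d2 (x := e * x) (y := y) (z := z)) => //.
  - by rewrite dvdz2M negb_or oe.
  - by rewrite conic exprMn e2 mul1r.
  - move=> p pp; rewrite Euclid_dvdzM // => /orP[pe|px]; last exact: prim px.
    have : (p %| e ^+ 2)%Z by rewrite expr2 dvdz_mulr.
    by rewrite e2 prime_dvdz1.
  move=> a1 t1 eA1 et1.
  have -> : a1 = a by clear -eA eA1; lia.
  by have -> : t1 = t' by clear -et et1; lia.
have oa : ~~ (2 %| 1 - 2 * a)%Z by clear; lia.
have [h|h] := odd_sign ot' ox oa; [apply: (egr 1) | apply: (egr (-1))] => //.
  by rewrite mul1r addrC.
by rewrite mulN1r mulNr addrC.
Qed.

Lemma remove_gcd (X Y Z : int) : X != 0 -> exists g x y z : int,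
  [/\ g != 0, X = g * x, Y = g * y, Z = g * z &
   forall p : nat, prime p -> (p %| x)%Z -> (p %| y)%Z -> (p %| z)%Z -> False].
Proof.
move=> X0; set g := gcdz X (gcdz Y Z).
have g0 : g != 0 by rewrite gcdz_eq0 negb_and X0.
have gX : (g %| X)%Z by exact: dvdz_gcdl.
have gYZ : (g %| gcdz Y Z)%Z by exact: dvdz_gcdr.
have gY : (g %| Y)%Z := dvdz_trans gYZ (dvdz_gcdl _ _).
have gZ : (g %| Z)%Z := dvdz_trans gYZ (dvdz_gcdr _ _).
exists g, (X %/ g)%Z, (Y %/ g)%Z, (Z %/ g)%Z.
split=> //; try by rewrite mulrC divzK.
move=> p pp px py pz.
have mul_dvd U : (g %| U)%Z -> (p %| U %/ g)%Z -> (p%:Z * g %| U)%Z.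
  by move=> gU pU; rewrite -[X in (_ %| X)%Z](divzK gU) dvdz_mul.
have : (p%:Z * g %| 1 * g)%Z by rewrite mul1r !dvdz_gcd !mul_dvd.
by rewrite dvdz_mul2r // prime_dvdz1.
Qed.

(** An odd D must be negative if it is 1 modulo 4 and positive if it is 3, so |D| = 3 modulo 4
    either way; 1 and -1 have the wrong sign, and an even D has [eps D] = -1. *)
Lemma abs_sign_cond (D : int) : good D -> sgnz D = - eps D ->
  [/\ D = sgnz D * `|D|, sgnz D ^+ 2 = 1, 1 < `|D| &
   if (2 %| D)%Z then 0 < D else (4 %| `|D| - 3)%Z].
Proof.
move=> [sfD _]; have [D0 _] := sfD.
have h4 : ~~ (4 %| D)%Z by rewrite -[4]/((2 : int) ^+ 2) (@squarefree_prime _ 2).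
clear sfD; rewrite /sgnz /eps; case: (ltrgtP D 0) D0 => [Dn|Dp|->] // _.
  case: eqVneq => // D1 _; have -> : `|D| = - D by lia.
  split; [ring | ring | lia | case: ifP; lia].
case: eqVneq => // D1 _; have -> : `|D| = D by lia.
by split; [ring | ring | lia | case: ifP; lia].
Qed.

(** Only the 2-adic shape of (X, Z) matters: the common 2^k also divides Y because Q is odd, and the
    gcd removed afterwards divides the odd X1, so parities survive. *)
Lemma counted_of_conic (D Q X Y Z X1 Z1 : int) (k : nat) :
  good D -> sgnz D = - eps D -> 0 < Q -> ~~ (2 %| Q)%Z -> squarefree (`|D| * Q) ->
  Q * Y ^+ 2 = Z ^+ 2 + `|D| * X ^+ 2 ->
  X = 2 ^+ k * X1 -> ~~ (2 %| X1)%Z -> ~~ (2 %| Z1)%Z ->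
  Z = 2 ^+ k * (if (2 %| D)%Z then Z1 else 2 * Z1) ->
  counted D (sgnz D * Q).
Proof.
move=> gD sD Q0 oQ sf conic eX oX1 oZ1 eZ.
have [DE s2 D1 Dpar] := abs_sign_cond gD sD.
have DQ : D * (sgnz D * Q) = `|D| * Q by rewrite {1}DE mulrACA -expr2 s2 mul1r.
rewrite /counted DQ; split=> //.
  by apply: lt_le_trans D1 _; rewrite ler_peMr //; clear -Q0; lia.
have p2 : (2 : int) ^+ k != 0 by rewrite expf_neq0.
have X10 : X1 != 0 by apply: contraNneq oX1 => ->.
have /dvdzP[Y1 eY] : (2 ^+ k %| Y)%Z.
  have := @dvdz_pow2_sqr Q Y k oQ.
  have -> : (2 ^ k)%:Z = 2 ^+ k by rewrite -[LHS]natz natrX.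
  apply; rewrite conic eX eZ !exprMn; apply: rpredD; first exact: dvdz_mulr.
  by rewrite mulrCA; apply: dvdz_mulr.
have [g [x [y [z [g0 ex ey ez prim]]]]] := remove_gcd Y1 Z1 X10.
have ox : ~~ (2 %| x)%Z by move: oX1; rewrite ex dvdz2M negb_or => /andP[].
have oz : ~~ (2 %| z)%Z by move: oZ1; rewrite ez dvdz2M negb_or => /andP[].
have kg0 : (2 ^+ k * g) ^+ 2 != 0 by rewrite expf_neq0 // mulf_neq0.
move: Dpar conic eZ; case: ifP => D2 Dpar conic eZ.
  have eD : `|D| = D by rewrite gtr0_norm.
  rewrite eD in sf conic *.
  apply: (counted_of_primitive_even gD D2 sf ox oz (y := y)) => //.
  apply: (mulfI kg0); move: conic; rewrite eX eY eZ ex ey ez => e.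
  by transitivity (Q * (g * y * 2 ^+ k) ^+ 2); [ring | rewrite e; ring].
apply: (counted_of_primitive_odd gD DE s2 Dpar sf ox oz (y := y)) => //.
apply: (mulfI kg0); move: conic; rewrite eX eY eZ ex ey ez => e.
by transitivity (Q * (g * y * 2 ^+ k) ^+ 2); [ring | rewrite e; ring].
Qed.

(** * Thue's lemma and composition of norms *)

Definition sqf (n : nat) : bool := (0 < n)%N && all (fun p => logn p n == 1%N) (primes n).

Lemma sqfP n : reflect ((0 < n)%N /\ forall p, prime p -> ~~ (p ^ 2 %| n)%N) (sqf n).
Proof.
apply: (iffP andP) => [[n0 /allP h]|[n0 h]]; split=> //.
  move=> p pp; rewrite pfactor_dvdn // -ltnNge ltnS.
  have [pn|] := boolP (p \in primes n); first by rewrite (eqP (h p pn)).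
  by rewrite -logn_gt0 -eqn0Ngt => /eqP ->.
apply/allP => p; rewrite -logn_gt0 => lp.
have pp : prime p by move: lp; rewrite logn_gt0 mem_primes => /andP[].
by move: (h p pp) lp; rewrite pfactor_dvdn //; clear; lia.
Qed.

Lemma sqfM a b : coprime a b -> sqf a -> sqf b -> sqf (a * b).
Proof.
move=> cab /sqfP[a0 ha] /sqfP[b0 hb]; apply/sqfP; split; first by rewrite muln_gt0 a0.
move=> p pp; apply/negP => dv.
have [pa|npa] := boolP (p %| a)%N.
  have npb : ~~ (p %| b)%N.
    apply/negP => pb; have : (p %| gcdn a b)%N by rewrite dvdn_gcd pa.
    by rewrite (eqP cab) Euclid_dvd1.
  by move: dv (ha p pp); rewrite Gauss_dvdl ?coprimeXl ?prime_coprime // => ->.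
by move: dv (hb p pp); rewrite Gauss_dvdr ?coprimeXl ?prime_coprime // => ->.
Qed.

Lemma squarefree_of_sqf (n : nat) : sqf n -> squarefree n.
Proof.
move=> /sqfP[n0 h]; split; first by rewrite -lt0n.
move=> k dv; have [//|k1] := eqVneq k 1%N; exfalso.
have k0 : (0 < k)%N by rewrite lt0n; apply: contraTneq dv => -> /=; rewrite dvd0n -lt0n.
have pp : prime (pdiv k) by apply: pdiv_prime; rewrite ltn_neqAle eq_sym k1.
have /negP[] := h _ pp; apply: dvdn_trans dv.
by rewrite -mulnn dvdn_mul ?pdiv_dvd.
Qed.

Lemma sqf_of_squarefree (D : int) : squarefree D -> sqf `|D|.
Proof.
move=> [D0 h]; apply/sqfP; split; first by rewrite absz_gt0.
by move=> p pp; apply/negP; rewrite -mulnn => /h p1; rewrite p1 in pp.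
Qed.

Lemma sqf_part n : (0 < n)%N -> exists a b, n = (a * b ^ 2)%N /\ sqf a.
Proof.
elim/ltn_ind: n => n IH n0.
have [sn|] := boolP (sqf n); first by exists n, 1%N; rewrite muln1.
rewrite negb_and n0 /= -has_predC => /hasP[p pn /= lp].
have pp : prime p by move: pn; rewrite mem_primes => /and3P[].
have l2 : (2 <= logn p n)%N by move: pn lp; rewrite -logn_gt0; case: (logn p n) => [|[]].
have /dvdnP[k ek] : (p ^ 2 %| n)%N by rewrite pfactor_dvdn.
have k0 : (0 < k)%N by move: n0; rewrite ek; case: k {ek}.
have kn : (k < n)%N.
  by rewrite ek ltn_Pmulr // (leq_trans (prime_gt1 pp)) // -mulnn leq_pmulr ?prime_gt0.
have [a [b [e sa]]] := IH k kn k0.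
by exists a, (b * p)%N; rewrite ek e -mulnA -expnMn.
Qed.

Lemma sqr_residue_sqf (d n : nat) : sqf n ->
  (forall p, p \in primes n -> exists h, (p %| h ^ 2 + d)%N) ->
  exists h, (n %| h ^ 2 + d)%N.
Proof.
elim/ltn_ind: n => n IH sn hn.
have [n1|n1] := leqP n 1; first by exists 0%N; case: n n1 sn {IH hn} => [|[]] // _ _; rewrite dvd1n.
have pp := pdiv_prime n1; set p := pdiv n in pp.
have /dvdnP[k ek] : (p %| n)%N := pdiv_dvd n.
have /sqfP[n0 h] := sn.
have npk : ~~ (p %| k)%N.
  by apply: contra (h p pp) => pk; rewrite ek -mulnn dvdn_mul.
have k0 : (0 < k)%N by move: n0; rewrite ek; case: k {ek npk}.
have cpk : coprime p k by rewrite prime_coprime.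
have kn : (k < n)%N by rewrite ek ltn_Pmulr ?prime_gt1.
have sk : sqf k.
  apply/sqfP; split=> // r pr; apply: contra (h r pr) => rk.
  by rewrite ek; apply: dvdn_mulr.
have [r rk|h1 dh1] := IH k kn sk.
  by apply: hn; move: rk; rewrite !mem_primes n0 => /and3P[-> _ rk] /=; rewrite ek dvdn_mulr.
have [h2 dh2] : exists h, (p %| h ^ 2 + d)%N.
  by apply: hn; rewrite mem_primes pp n0 pdiv_dvd.
exists (chinese p k h2 h1); rewrite ek mulnC Gauss_dvd //; apply/andP; split.
  rewrite /dvdn -modnDml -modnXm chinese_modl //.
  by rewrite modnXm modnDml.
by rewrite /dvdn -modnDml -modnXm chinese_modr // modnXm modnDml.
Qed.

Lemma sqr_absz (Z : int) : (`|Z| ^ 2)%N%:Z = Z ^+ 2.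
Proof. by rewrite -mulnn PoszM !abszE -normrM -expr2 ger0_norm ?sqr_ge0. Qed.

(* Thue's pigeonhole argument applied to the residues of z - h x modulo Q. *)
Lemma small_norm (d Q h : nat) : (0 < d)%N -> (0 < Q)%N -> (Q %| h ^ 2 + d)%N ->
  exists k x z : nat, [/\ (0 < k <= d.+1)%N, (x <= Q)%N, (z <= Q)%N &
    (z ^ 2 + d * x ^ 2 = k * Q)%N].
Proof.
move=> d0 Q0 dh.
have [r [r1 r2]] : exists r, (r ^ 2 <= Q)%N /\ (Q < r.+1 ^ 2)%N.
  have ex : exists r, (r ^ 2 <= Q)%N by exists 0%N.
  have bd r : (r ^ 2 <= Q)%N -> (r <= Q)%N.
    by move=> le; apply: leq_trans le; case: r => // r; rewrite -mulnn leq_pmulr.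
  exists (ex_maxn ex bd); case: ex_maxnP => r hr hm; split=> //.
  by rewrite ltnNge; apply/negP => /hm; rewrite ltnn.
have rQ : (r <= Q)%N by apply: leq_trans r1; case: r {r2} => // r; rewrite -mulnn leq_pmulr.
pose f (ij : 'I_r.+1 * 'I_r.+1) : 'I_Q := Ordinal (ltn_pmod (ij.1 * h + ij.2) Q0).
have /injectivePn[[i j] [[i' j'] ne]] : ~~ injectiveb f.
  apply/negP => /injectiveP /leq_card; rewrite card_prod !card_ord leqNgt.
  by move: r2; rewrite -mulnn => ->.
move=> /(congr1 val) /= eij.
pose X : int := i%:Z - i'%:Z; pose Z : int := j'%:Z - j%:Z.
have dX : (Q %| X * h%:Z - Z)%Z.
  have -> : X * h%:Z - Z = (i * h + j)%N%:Z - (i' * h + j')%N%:Z.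
    by rewrite /X /Z !PoszD !PoszM; ring.
  by rewrite -eqz_mod_dvd; apply/eqP; rewrite !modz_nat eij.
have dN : (Q %| Z ^+ 2 + d%:Z * X ^+ 2)%Z.
  have -> : Z ^+ 2 + d%:Z * X ^+ 2 = (h%:Z ^+ 2 + d%:Z) * X ^+ 2 - (X * h%:Z - Z) * (X * h%:Z + Z) by ring.
  apply: rpredB; last exact: dvdz_mulr.
  by apply: dvdz_mulr; rewrite -(sqr_absz h) -PoszD dvdzE.
have eN : (`|Z| ^ 2 + d * `|X| ^ 2)%N%:Z = Z ^+ 2 + d%:Z * X ^+ 2.
  by rewrite PoszD PoszM !sqr_absz.
have /dvdnP[k ek] : (Q %| `|Z| ^ 2 + d * `|X| ^ 2)%N by move: dN; rewrite -eN dvdzE.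
have lX : (`|X| <= r)%N.
  by have := ltn_ord i; have := ltn_ord i'; rewrite /X; clear; lia.
have lZ : (`|Z| <= r)%N.
  by have := ltn_ord j; have := ltn_ord j'; rewrite /Z; clear; lia.
exists k, `|X|%N, `|Z|%N; split=> //; try exact: leq_trans rQ.
apply/andP; split.
  rewrite lt0n; apply: contraNneq ne => k0; move/eqP: ek; rewrite k0 mul0n.
  rewrite addn_eq0 muln_eq0 !expn_eq0 !absz_eq0 !andbT (gtn_eqF d0) /= !subr_eq0.
  by rewrite !eqz_nat => /andP[/eqP ej /eqP ei]; apply/eqP; congr pair; apply: val_inj.
rewrite -(leq_pmul2r Q0) -ek mulSn; apply: leq_add.
  by apply: leq_trans r1; rewrite leq_exp2r.
by rewrite leq_mul2l; apply/orP; right; apply: leq_trans r1; rewrite leq_exp2r.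
Qed.

(* Multiplying (z + x sqrt(-d)) by the conjugate of a second element congruent to
   it modulo a high power of 2 gives an element 2-adically close to the rational
   number k Q; the last factor z2 + x2 sqrt(-d) then fixes the 2-adic shape. *)
Lemma compose_norms (d k k' Q Q1 x z x1 z1 u v e' : int) (kap : nat) :
  let M := 2 ^+ kap * (4 * e') in
  k = 2 ^+ kap * k' -> ~~ (2 %| k')%Z -> ~~ (2 %| Q)%Z ->
  z ^+ 2 + d * x ^+ 2 = k * Q -> z1 ^+ 2 + d * x1 ^+ 2 = k * Q1 ->
  x = x1 + M * u -> z = z1 + M * v ->
  exists z3 x3 : int, [/\ ~~ (2 %| z3)%Z, (4 %| x3)%Z &
    (2 ^+ kap * z3) ^+ 2 + d * (2 ^+ kap * x3) ^+ 2 = k ^+ 2 * Q * Q1].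
Proof.
move=> M ek ok oQ N N1 ex ez.
exists (k' * Q - 4 * e' * (z * v + d * x * u)), (4 * e' * (z * u - x * v)); split.
- have : ~~ (2 %| k' * Q)%Z by rewrite dvdz2M negb_or ok.
  rewrite -!mulrA; move: (k' * Q) (e' * _) => a b; clear; lia.
- by rewrite -!mulrA; apply: dvdz_mulr.
have e1 : x1 = x - M * u by rewrite ex addrK.
have e2 : z1 = z - M * v by rewrite ez addrK.
have eN : 2 ^+ kap * k' * Q = z ^+ 2 + d * x ^+ 2 by rewrite -ek N.
have -> : 2 ^+ kap * (k' * Q - 4 * e' * (z * v + d * x * u)) = z * z1 + d * x * x1.
  transitivity (2 ^+ kap * k' * Q - M * (z * v + d * x * u)); first by rewrite /M; ring.
  by rewrite eN e1 e2; ring.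
have -> : 2 ^+ kap * (4 * e' * (z * u - x * v)) = x * z1 - z * x1.
  by transitivity (M * (z * u - x * v)); [rewrite /M; ring | rewrite e1 e2; ring].
transitivity ((z ^+ 2 + d * x ^+ 2) * (z1 ^+ 2 + d * x1 ^+ 2)); first by ring.
by rewrite N N1; ring.
Qed.

(** The multiplier is bounded as in Thue's argument, so for fixed d and M only finitely many triples
    (k, x, z) arise while Q varies. *)
Definition norm_class (d M Q k x z : nat) : Prop :=
  (0 < k <= d.+1)%N /\ exists X Z : nat,
    [/\ (Z ^ 2 + d * X ^ 2 = k * Q)%N, (X %% M)%N = x & (Z %% M)%N = z].

Lemma eqmod_int (x y M : nat) : (x %% M = y %% M)%N -> exists u : int, x%:Z = y%:Z + M%:Z * u.
Proof.
move=> e; exists ((x %/ M)%N%:Z - (y %/ M)%N%:Z).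
rewrite {1}(divn_eq x M) {1}(divn_eq y M) e !PoszD !PoszM; ring.
Qed.

Lemma dvdz2_nat (n : nat) : (2 %| n%:Z)%Z = ~~ odd n.
Proof. by rewrite dvdzE dvdn2. Qed.

(** Two numbers of one class compose to a norm k^2 Q Q1 with z3 odd and 4 | x3. Multiplying by 1 +
    sqrt(-d), or by 2 + sqrt(-d) for odd D, makes X odd and gives Z its parity shape; the norm of
    this last factor is Q2 b^2, which is why Q2 enters. *)
Lemma counted_of_classes (D : int) (Q Q1 Q2 b k x z : nat) :
  let d := `|D|%N in
  good D -> sgnz D = - eps D ->
  sqf Q -> sqf Q1 -> sqf Q2 -> coprime Q Q1 -> coprime (Q * Q1) Q2 ->
  coprime d (Q * Q1 * Q2) -> odd (Q * Q1 * Q2) ->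
  ((if (2 %| D)%Z then 1 else 4) + d = Q2 * b ^ 2)%N ->
  norm_class d (2 ^ d.+2) Q k x z -> norm_class d (2 ^ d.+2) Q1 k x z ->
  counted D (sgnz D * (Q * Q1 * Q2)%N%:Z).
Proof.
move=> d gD sD sQ sQ1 sQ2 c1 c2 cd oQ en [/andP[k0 kd] [X [Z [N ex ez]]]].
move=> [_ [X1 [Z1 [N1 ex1 ez1]]]].
have eN (A B C E : nat) : (A ^ 2 + d * B ^ 2 = C * E)%N ->
    A%:Z ^+ 2 + d%:Z * B%:Z ^+ 2 = C%:Z * E%:Z.
  by move=> e; rewrite -!(sqr_absz (Posz _)) -!PoszM -PoszD /= e.
have [u eu] : exists u : int, X%:Z = X1%:Z + (2 ^ d.+2)%N%:Z * u by apply: eqmod_int; rewrite ex ex1.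
have [v ev] : exists v : int, Z%:Z = Z1%:Z + (2 ^ d.+2)%N%:Z * v by apply: eqmod_int; rewrite ez ez1.
have [k' ok' ek] := pfactor_coprime (isT : prime 2) k0.
set kap := logn 2 k in ek.
(* 2^kap <= k <= d + 1 forces kap <= d, so the modulus 2^(d+2) contains the factor 4 * 2^kap that
   [compose_norms] wants. *)
have kapd : (kap <= d)%N.
  have h : (2 ^ kap <= d.+1)%N by apply: leq_trans kd; rewrite dvdn_leq // pfactor_dvdnn.
  rewrite -ltnS -(ltn_exp2l _ _ (isT : (1 < 2)%N)); apply: leq_ltn_trans h _.
  exact: ltn_expl.
have eM : (2 ^ d.+2)%N%:Z = 2 ^+ kap * (4 * 2 ^+ (d - kap)) :> int.
  rewrite -[LHS]natz natrX -(subnKC kapd) -addnS -addnS exprD !exprS addKn; ring.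
have ekz : k%:Z = 2 ^+ kap * k'%:Z by rewrite ek mulnC PoszM -[X in X * _]natz natrX.
have odd3 : [/\ odd Q, odd Q1 & odd Q2] by move: oQ; rewrite !oddM => /andP[/andP[]].
case: odd3 => oddQ oddQ1 oddQ2.
have oz (n : nat) : odd n -> ~~ (2 %| n%:Z)%Z by rewrite dvdz2_nat negbK.
rewrite eM in eu ev.
have [z3 [x3 [oz3 x34 eq3]]] := compose_norms ekz
  (oz _ (etrans (esym (coprime2n _)) ok')) (oz _ oddQ) (eN _ _ _ _ N) (eN _ _ _ _ N1) eu ev.
have sf : squarefree (`|D| * (Q * Q1 * Q2)%N%:Z).
  rewrite -abszE -PoszM; apply/squarefree_of_sqf/sqfM => //.
    by apply: sqf_of_squarefree; case: gD.
  by apply: sqfM => //; apply: sqfM.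
have Q0 : (0 < Q * Q1 * Q2)%N by rewrite odd_gt0.
have dE : `|D| = d%:Z by rewrite -abszE.
have conic (P R : int) : P ^+ 2 + d%:Z * R ^+ 2 = Q2%:Z * b%:Z ^+ 2 ->
  (Q * Q1 * Q2)%N%:Z * (k%:Z * b%:Z) ^+ 2 =
    (2 ^+ kap * (z3 * P - d%:Z * x3 * R)) ^+ 2 + `|D| * (2 ^+ kap * (x3 * P + z3 * R)) ^+ 2.
  move=> e; rewrite !PoszM dE.
  transitivity (k%:Z ^+ 2 * Q%:Z * Q1%:Z * (Q2%:Z * b%:Z ^+ 2)); first by ring.
  by rewrite -eq3 -e; ring.
have /dvdzP[w ew] := x34.
have enz : (if (2 %| D)%Z then 1 else 4) + d%:Z = Q2%:Z * b%:Z ^+ 2.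
  rewrite -(sqr_absz b) -PoszM -en PoszD; by case: ifP.
have dpar : (2 %| D)%Z -> (2 %| d%:Z)%Z by rewrite !dvdzE.
move: enz; case: ifP => D2 enz.
  apply: (counted_of_conic gD sD _ (oz _ oQ) sf (conic 1 1 _) (erefl _) (k := kap)
    (Z1 := z3 * 1 - d%:Z * x3 * 1)) => //.
  - by rewrite expr1n !mulr1.
  - by rewrite ew; move: oz3; clear; lia.
  - have /dvdzP[d' ->] := dpar D2; rewrite !mulr1 (mulrAC d').
    by move: oz3; move: (d' * x3) => e; clear; lia.
  by rewrite D2.
apply: (counted_of_conic gD sD _ (oz _ oQ) sf (conic 2 1 _) (erefl _) (k := kap)
  (Z1 := z3 - d%:Z * w * 2)) => //.
- by rewrite expr1n mulr1.
- by rewrite ew; move: oz3; clear; lia.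
- by move: oz3 (d%:Z * w); clear; lia.
by rewrite D2 ew; ring.
Qed.

(** * The pigeonhole argument on classes of norm identities *)

Section Pigeonhole.
Variables (D : int) (P : pred nat).
Local Notation d := `|D|%N.
Local Notation n0 := ((if (2 %| D)%Z then 1 else 4) + d)%N.
Hypotheses (gD : good D) (sD : sgnz D = - eps D).
Hypothesis Pres : forall p, prime p -> P p -> exists h, (p %| h ^ 2 + d)%N.
Hypothesis Pcop : forall p, prime p -> P p -> ~~ (p %| 2 * d * n0)%N.

Local Notation M := (2 ^ d.+2)%N.
Let T : finType := ('I_d.+2 * ('I_M * 'I_M))%type.
Let nc (Q : nat) (c : T) := norm_class d M Q c.1 c.2.1 c.2.2.
Let okQ (Q : nat) := sqf Q && all P (primes Q).

Let d_gt0 : (0 < d)%N.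
Proof. by rewrite absz_gt0; case: gD => [[]]. Qed.

Let okQ_class Q : okQ Q -> exists c, nc Q c.
Proof.
move=> /andP[sQ /allP aQ].
have Q0 : (0 < Q)%N by case/sqfP: sQ.
have [h dh] : exists h, (Q %| h ^ 2 + d)%N.
  apply: sqr_residue_sqf => // p pQ; apply: Pres; last exact: aQ.
  by move: pQ; rewrite mem_primes => /andP[].
have [k [x [z [kd _ _ e]]]] := small_norm d_gt0 Q0 dh.
have M0 : (0 < M)%N by rewrite expn_gt0.
have kd2 : (k < d.+2)%N by case/andP: kd.
exists (Ordinal kd2, (Ordinal (ltn_pmod x M0), Ordinal (ltn_pmod z M0))).
by split=> //; exists x, z.
Qed.

Let okQ_coprime Q a : okQ Q -> (a %| 2 * d * n0)%N -> coprime Q a.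
Proof.
move=> /andP[sQ /allP aQ] da; apply/negPn/negP => nc'.
have g1 : (1 < gcdn Q a)%N.
  rewrite ltn_neqAle eq_sym nc' gcdn_gt0; by case/sqfP: sQ => ->.
have pp := pdiv_prime g1; have dg := pdiv_dvd (gcdn Q a).
have pQ : (pdiv (gcdn Q a) %| Q)%N := dvdn_trans dg (dvdn_gcdl _ _).
have pa : (pdiv (gcdn Q a) %| a)%N := dvdn_trans dg (dvdn_gcdr _ _).
have pin : pdiv (gcdn Q a) \in primes Q.
  by rewrite mem_primes pp pQ; case/sqfP: sQ => ->.
by have := Pcop pp (aQ _ pin); rewrite (dvdn_trans pa da).
Qed.

(** Each class keeps a representative [R c], and a most populated class holds a fixed fraction of
    [s]; its members n yield n * R c * Q2 up to sign. Their primes exceed [b], which exceeds every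
    [R c], so n and [R c] are coprime. *)
Lemma pigeonhole_counted : exists b C : nat, (0 < C)%N /\
  forall (s : seq nat) (X : nat), uniq s ->
    (forall n, n \in s -> [/\ sqf n, (n <= X)%N & all (fun p => P p && (b < p)%N) (primes n)]) ->
    exists s' : seq int, [/\ uniq s',
      forall q, q \in s' -> counted D q /\ (`|q| <= C * X)%N &
      (size s <= C * size s')%N].
Proof.
(* Choice over the finitely many classes, with the junk value 0 for an empty one. *)
have [R HR] : exists R : T -> nat, forall c, (exists Q, okQ Q /\ nc Q c) -> okQ (R c) /\ nc (R c) c.
  apply: (fin_all_exists (P := fun c n => (exists Q, okQ Q /\ nc Q c) -> okQ n /\ nc n c)) => c.
  have [[Q h]|h] := pselect (exists Q, okQ Q /\ nc Q c); first by exists Q.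
  by exists 0%N => h'; case: h.
have n00 : (0 < n0)%N by case: ifP.
have [Q2 [b [en sQ2]]] := sqf_part n00.
have Q20 : (0 < Q2)%N by case/sqfP: sQ2.
have dQ2n : (Q2 %| n0)%N by rewrite en dvdn_mulr.
have dodd : ~~ (2 %| D)%Z -> odd d by rewrite dvdzE dvdn2 negbK.
have copdQ2 : coprime d Q2.
  apply: coprime_dvdr dQ2n _; rewrite /coprime gcdnDr; case: ifP => [|/negbT] D2.
    by rewrite gcdn1.
  by apply: (@coprimeXr 2 d 2); rewrite coprimen2 dodd.
have oQ2 : odd Q2.
  apply: dvdn_odd dQ2n _; rewrite oddD; case: ifP => [|/negbT] D2; last exact: dodd.
  by move: D2; rewrite dvdzE dvdn2 /=.
pose K := (\prod_c (R c).+1)%N.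
have K0 : (0 < K)%N by rewrite prodn_gt0.
have RK c : (R c < K)%N.
  rewrite /K (bigD1 c) //= leq_pmulr // prodn_gt0 //.
exists K, (#|T|.+1 * K * Q2)%N; split.
  by rewrite !muln_gt0 Q20 K0.
move=> s X us hs.
have ok n : n \in s -> okQ n.
  move=> /hs [sn _ /allP an]; rewrite /okQ sn; apply/allP => p /an /andP[] //.
pose sc c := [seq n <- s | `[< nc n c >]].
have sum_sc : (size s <= \sum_c size (sc c))%N.
  rewrite /sc; have : forall n, n \in s -> exists c, nc n c by move=> n /ok /okQ_class.
  elim: s {us hs ok sc} => //= n s IH h.
  have [c hc] := h n (mem_head _ _).
  apply: leq_trans (_ : \sum_c (`[< nc n c >] + size [seq n <- s | `[< nc n c >]]) <= _)%N; last first.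
    by apply: leq_sum => c' _; case: `[< nc n c' >].
  rewrite big_split /= -add1n leq_add //.
    by rewrite (bigD1 c) //= (asboolT hc) leq_addr.
  by apply: IH => n' n's; apply: h; rewrite inE n's orbT.
have [c hc] : exists c, (size s <= #|T|.+1 * size (sc c))%N.
  apply/existsP; apply: contraT; rewrite negb_exists => /forallP h.
  have [s0|s0] := posnP (size s).
    have M0 : (0 < M)%N by rewrite expn_gt0.
    by have := h (ord0, (Ordinal M0, Ordinal M0)); rewrite s0.
  have le : (\sum_c #|T|.+1 * size (sc c) <= \sum_(c : T) size s)%N.
    by apply: leq_sum => c _; apply: ltnW; rewrite ltnNge.
  move: le; rewrite -big_distrr sum_nat_const /= => le.
  have : (#|T|.+1 * size s <= #|T| * size s)%N.
    by apply: leq_trans le; rewrite leq_mul2l sum_sc orbT.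
  by rewrite leq_mul2r ltnn orbF -leqn0 leqNgt s0.
exists [seq sgnz D * (n * R c * Q2)%N%:Z | n <- sc c]; split.
- rewrite map_inj_in_uniq ?filter_uniq // => n n' hn hn' /(mulfI _) e.
  have sg0 : sgnz D != 0 by have [_ s2 _ _] := abs_sign_cond gD sD; rewrite -sqrf_eq0 s2.
  have [okR _] : okQ (R c) /\ nc (R c) c.
    apply: HR; exists n; move: hn; rewrite mem_filter => /andP[/asboolP ncn ns].
    by split=> //; apply: ok.
  have R0 : (0 < R c)%N by case/andP: okR => /sqfP[].
  by apply/eqP; have /eqP := e sg0; rewrite eqz_nat !eqn_pmul2r.
- move=> q /mapP[n]; rewrite mem_filter => /andP[/asboolP ncn ns] ->.
  have okn := ok n ns; have [sn nX /allP bn] := hs n ns.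
  have [okR ncR] : okQ (R c) /\ nc (R c) c by apply: HR; exists n.
  have sR : sqf (R c) by case/andP: okR.
  have R0 : (0 < R c)%N by case/sqfP: sR.
  split.
    have cop2 : coprime 2 (n * R c).
      by rewrite coprime_sym coprimeMl !okQ_coprime // -mulnA dvdn_mulr.
    have copd : coprime d (n * R c).
      by rewrite coprime_sym coprimeMl !okQ_coprime // mulnAC dvdn_mull.
    apply: (counted_of_classes (b := b) gD sD sn sR sQ2 _ _ _ _ en ncn ncR).
    + rewrite coprime_has_primes //; last by case/sqfP: sn.
      apply/hasPn => p; rewrite mem_primes => /and3P[_ _ pR]; apply/negP => pn.
      have /andP[_ bp] := bn p pn.
      have := leq_trans bp (dvdn_leq R0 pR); rewrite leqNgt => /negP[].
      exact: ltnW (RK c).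
    + by rewrite coprimeMl !okQ_coprime // dvdn_mull.
    + by rewrite coprimeMr copd.
    by rewrite oddM oQ2 andbT -coprime2n.
  have -> : absz (sgnz D * (n * R c * Q2)%N%:Z) = (n * R c * Q2)%N.
    have [_ s2 _ _] := abs_sign_cond gD sD.
    by move/eqP: s2; rewrite sqrf_eq1 => /orP[] /eqP ->; rewrite ?mul1r ?mulN1r ?abszN.
  rewrite [X in (_ <= X)%N]mulnAC leq_mul2r; apply/orP; right.
  rewrite mulnC leq_mul //; apply: leq_trans (ltnW (RK c)) _.
  by rewrite leq_pmull.
rewrite size_map; apply: leq_trans hc _; rewrite leq_mul2r; apply/orP; right.
by rewrite -mulnA leq_pmulr // muln_gt0 Q20 K0.
Qed.

End Pigeonhole.

(** * Functions with the functional equation of the logarithm *)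

Section LogarithmLike.
Variables (R : realType) (lg : R -> R).
Hypothesis lgM : forall x y, 0 < x -> 0 < y -> lg (x * y) = lg x + lg y.
Hypothesis lg_le : forall x, 0 < x -> lg x <= x - 1.

Lemma lg1 : lg 1 = 0.
Proof. by have := lgM ltr01 ltr01; rewrite mulr1; lra. Qed.

Lemma lgV x : 0 < x -> lg x^-1 = - lg x.
Proof.
move=> x0; have := lgM x0 (_ : 0 < x^-1); rewrite invr_gt0 => /(_ x0).
by rewrite divff ?gt_eqF // lg1; lra.
Qed.

Lemma lg_ge x : 0 < x -> 1 - x^-1 <= lg x.
Proof. by move=> x0; have := @lg_le x^-1; rewrite invr_gt0 lgV // => /(_ x0); lra. Qed.

Lemma lg_ge0 x : 1 <= x -> 0 <= lg x.
Proof.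
move=> x1; have x0 : 0 < x by lra.
by apply: le_trans (lg_ge x0); rewrite subr_ge0 invf_le1.
Qed.

Lemma lg_div x y : 0 < x -> 0 < y -> lg (x / y) = lg x - lg y.
Proof. by move=> x0 y0; rewrite lgM ?invr_gt0 // lgV. Qed.

Lemma ler_lg x y : 0 < x -> x <= y -> lg x <= lg y.
Proof.
move=> x0 xy; have y0 : 0 < y by lra.
rewrite -subr_ge0 -lg_div //; apply: lg_ge0.
by rewrite ler_pdivlMr // mul1r.
Qed.

Lemma lgX x n : 0 < x -> lg (x ^+ n) = n%:R * lg x.
Proof.
move=> x0; elim: n => [|n IH]; first by rewrite expr0 lg1 mul0r.
by rewrite exprS lgM ?exprn_gt0 // IH -[n.+1]addn1 natrD; ring.
Qed.

Lemma lg_nat_ge0 n : (0 < n)%N -> 0 <= lg n%:R.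
Proof. by move=> n0; apply: lg_ge0; rewrite ler1n. Qed.

Lemma ler_lg_nat m n : (0 < m)%N -> (m <= n)%N -> lg m%:R <= lg n%:R.
Proof. by move=> m0 mn; apply: ler_lg; rewrite ?ltr0n ?ler_nat. Qed.

Lemma lg2_ge : 2^-1 <= lg 2.
Proof. by apply: le_trans (lg_ge _); [lra | ]. Qed.

Lemma lgS_diff n : (0 < n)%N -> lg n.+1%:R - lg n%:R <= n%:R^-1.
Proof.
move=> n0; have n0' : 0 < n%:R :> R by rewrite ltr0n.
rewrite -lg_div ?ltr0n //; apply: le_trans (lg_le _) _; first by rewrite divr_gt0 ?ltr0n.
by rewrite -[n.+1]addn1 natrD mulrDl divff ?gt_eqF // mul1r; lra.
Qed.

(* For n >= 4 the numerator of the difference is n (lg (n+1) - lg n) - lg n <= 1 - lg 4 <= 0. *)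
Lemma lg_over_id_decr n : (4 <= n)%N -> lg n.+1%:R / n.+1%:R <= lg n%:R / n%:R.
Proof.
move=> n4; have n0 : (0 < n)%N by apply: leq_trans n4.
have n0' : 0 < n%:R :> R by rewrite ltr0n.
have l4 : 1 <= lg n%:R.
  apply: le_trans (ler_lg_nat (_ : 0 < 4)%N n4) => //.
  have -> : 4%:R = 2 ^+ 2 :> R by ring.
  by rewrite lgX //; have := lg2_ge; lra.
rewrite ler_pdivrMr ?ltr0n // mulrAC ler_pdivlMr //.
have h : (lg n.+1%:R - lg n%:R) * n%:R <= 1.
  by rewrite -ler_pdivlMr // mul1r; apply: lgS_diff.
by move: h; rewrite -[n.+1]addn1 natrD; move: (lg (n%:R + 1)) => u; nra.
Qed.

(** Lower half of Stirling's estimate: the step from x to x + 1 rests on x (lg (x + 1) - lg x) <=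
    1. *)
Lemma sum_lg_ge x : x%:R * lg x%:R - x%:R <= \sum_(1 <= n < x.+1) lg n%:R.
Proof.
elim: x => [|x IH]; first by rewrite big_geq // mul0r subrr.
rewrite big_nat_recr //=.
have [->|x0] := posnP x; first by rewrite big_geq // lg1; lra.
have h : (lg x.+1%:R - lg x%:R) * x%:R <= 1.
  by rewrite -ler_pdivlMr ?ltr0n // mul1r; apply: lgS_diff.
move: IH h; rewrite -[x.+1]addn1 natrD; move: (\sum_(_ <= _ < _) _) (lg (x%:R + 1)) => S u; lra.
Qed.

Lemma sum_lg_le x : \sum_(1 <= n < x.+1) lg n%:R <= x%:R * lg x%:R.
Proof.
apply: le_trans (_ : \sum_(1 <= n < x.+1) lg x%:R <= _).
  rewrite !big_nat; apply: ler_sum => n /andP[n1]; rewrite ltnS => nx.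
  exact: ler_lg_nat.
by rewrite sumr_const_nat subn1 mulr_natl.
Qed.

(** The induction step of [sum_lg_over_sqr], with u and v in place of lg (n + 1) and lg n. *)
Lemma telescope_step (n u v : R) : 1 <= n -> 0 <= u -> u - v <= n^-1 ->
  2 - (v + 2) / n + u / (n + 1) ^+ 2 <= 2 - (u + 2) / (n + 1).
Proof.
move=> n1 u0 h; have n0 : 0 < n by lra.
have h1 : u - v <= 1 by apply: le_trans h _; rewrite invf_le1.
have h2 : (u - v) * n <= 1 by rewrite -ler_pdivlMr // mul1r.
have h3 : (u - v) * n * n <= n by rewrite ler_piMl // ltW.
rewrite -subr_ge0.
have -> : 2 - (u + 2) / (n + 1) - (2 - (v + 2) / n + u / (n + 1) ^+ 2)
  = ((v + 2) * (n + 1) ^+ 2 - (u + 2) * n * (n + 1) - u * n) / (n * (n + 1) ^+ 2).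
  by field; have n10 : n + 1 != 0 by [apply: lt0r_neq0; lra]; rewrite ?n10 ?gt_eqF.
apply: divr_ge0; last by rewrite mulr_ge0 ?sqr_ge0 //; lra.
have -> : (v + 2) * (n + 1) ^+ 2 - (u + 2) * n * (n + 1) - u * n
  = u + 2 * (n + 1) - ((u - v) * n * n + 2 * ((u - v) * n) + (u - v)) by ring.
lra.
Qed.

(* g n = (lg n + 2) / n telescopes: g (n - 1) - g n >= lg n / n^2. *)
Lemma sum_lg_over_sqr x : \sum_(2 <= n < x.+1) lg n%:R / n%:R ^+ 2 <= 2.
Proof.
suff h : forall y, \sum_(2 <= n < y.+2) lg n%:R / n%:R ^+ 2 <= 2 - (lg y.+1%:R + 2) / y.+1%:R.
  case: x => [|x]; first by rewrite big_geq.
  apply: le_trans (h x) _; rewrite gerBl divr_ge0 // addr_ge0 //; exact: lg_nat_ge0.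
elim=> [|y IH]; first by rewrite big_geq // lg1; lra.
rewrite big_nat_recr //=; apply: le_trans (lerD IH (lexx _)) _.
rewrite -[y.+2]addn1 natrD.
apply: telescope_step; rewrite ?ler1n //.
  by have := @lg_nat_ge0 y.+2 isT; rewrite -[y.+2]addn1 natrD.
by have := @lgS_diff y.+1 isT; rewrite -[y.+2]addn1 natrD.
Qed.

End LogarithmLike.

(** * Abel summation and Dirichlet convolution *)

Section Summation.
Variable R : realType.

Lemma abel_bound (a b : nat -> R) (B : R) m n : (m <= n)%N ->
  (forall k, (m <= k)%N -> `|\sum_(m <= i < k) a i| <= B) ->
  (forall i, (m <= i)%N -> b i.+1 <= b i) -> (forall i, (m <= i)%N -> 0 <= b i) ->
  `|\sum_(m <= i < n) a i * b i| <= B * b m.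
Proof.
move=> mn hB db b0.
have B0 : 0 <= B by apply: le_trans (hB m (leqnn m)).
(* The boundary term of the summation by parts is kept inside the induction, where the bound
   telescopes to B (b m - b (m + k)); it is restored at the end at the cost of B b n. *)
suff h k : `|\sum_(m <= i < m + k) a i * b i - (\sum_(m <= i < m + k) a i) * b (m + k)%N|
    <= B * (b m - b (m + k)%N).
  have {h} := h (n - m)%N; rewrite subnKC // => h.
  rewrite -[X in `|X|](subrK ((\sum_(m <= i < n) a i) * b n)).
  apply: le_trans (ler_normD _ _) _; rewrite normrM (ger0_norm (b0 n mn)).
  have := ler_wpM2r (b0 n mn) (hB n mn); lra.
elim: k => [|k IH]; first by rewrite addn0 !big_geq // mul0r !subrr normr0 mulr0.
have mk : (m <= m + k)%N by rewrite leq_addr.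
rewrite addnS !big_nat_recr //=.
set S := \sum_(_ <= _ < _) _ in IH *; set A := \sum_(_ <= _ < _) _ in IH *.
have -> : S + a (m + k)%N * b (m + k)%N - (A + a (m + k)%N) * b (m + k).+1
  = (S - A * b (m + k)%N) + (A + a (m + k)%N) * (b (m + k)%N - b (m + k).+1) by ring.
have d0 : 0 <= b (m + k)%N - b (m + k).+1 by rewrite subr_ge0 db.
apply: le_trans (ler_normD _ _) _; rewrite normrM (ger0_norm d0).
have hA : `|A + a (m + k)%N| <= B.
  by have := hB (m + k).+1 (leqW mk); rewrite big_nat_recr.
have := ler_wpM2r d0 hA; lra.
Qed.

Lemma sum_dvd_reindex (G : nat -> R) d X : (0 < d)%N ->
  \sum_(1 <= m < X.+1 | (d %| m)%N) G m = \sum_(1 <= k < (X %/ d).+1) G (d * k)%N.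
Proof.
move=> d0; elim: X => [|X IH]; first by rewrite div0n !big_geq.
rewrite big_mkcond big_nat_recr //= -big_mkcond IH divnS //.
case: ifP => dv /=; last by rewrite addr0 add0n.
rewrite add1n [RHS]big_nat_recr //=; congr (_ + G _).
have := divnK dv; rewrite divnS // dv add1n mulnC => ->//.
Qed.

Lemma sum_divisors (F : nat -> R) m X : (0 < m)%N -> (m <= X)%N ->
  \sum_(d <- divisors m) F d = \sum_(1 <= d < X.+1 | (d %| m)%N) F d.
Proof.
move=> m0 mX; rewrite -[RHS]big_filter; apply: perm_big; apply: uniq_perm.
- exact: divisors_uniq.
- by rewrite filter_uniq ?iota_uniq.
move=> d; rewrite -dvdn_divisors // mem_filter mem_index_iota ltnS.
have [dv|//] := boolP (d %| m)%N.
by rewrite (dvdn_gt0 m0 dv) (leq_trans (dvdn_leq m0 dv) mX).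
Qed.

Lemma dirichlet_sum (F : nat -> nat -> R) X :
  \sum_(1 <= m < X.+1) \sum_(d <- divisors m) F d (m %/ d)%N
  = \sum_(1 <= d < X.+1) \sum_(1 <= k < (X %/ d).+1) F d k.
Proof.
transitivity (\sum_(1 <= m < X.+1) \sum_(1 <= d < X.+1 | (d %| m)%N) F d (m %/ d)%N).
  rewrite !big_nat; apply: eq_bigr => m /andP[m0]; rewrite ltnS => mX.
  exact: sum_divisors.
transitivity (\sum_(1 <= d < X.+1) \sum_(1 <= m < X.+1 | (d %| m)%N) F d (m %/ d)%N).
  under eq_bigr do rewrite big_mkcond /=.
  by rewrite exchange_big /=; apply: eq_bigr => d _; rewrite -big_mkcond.
rewrite !big_nat; apply: eq_bigr => d /andP[d0 _].
rewrite (sum_dvd_reindex (fun m => F d (m %/ d)%N)) //.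
by apply: eq_bigr => k _; rewrite mulKn.
Qed.

Lemma dirichlet_sum_sym (F : nat -> nat -> R) X :
  \sum_(1 <= d < X.+1) \sum_(1 <= k < (X %/ d).+1) F d k
  = \sum_(1 <= k < X.+1) \sum_(1 <= d < (X %/ k).+1) F d k.
Proof.
have E (G : nat -> nat -> R) : \sum_(1 <= d < X.+1) \sum_(1 <= k < (X %/ d).+1) G d k =
   \sum_(1 <= d < X.+1) \sum_(1 <= k < X.+1 | (d * k <= X)%N) G d k.
  rewrite !big_nat; apply: eq_bigr => d /andP[d0 _].
  rewrite (@big_nat_widen _ _ _ 1 (X %/ d).+1 X.+1) ?ltnS ?leq_div //.
  by apply: eq_bigl => k; rewrite ltnS leq_divRL // mulnC.
rewrite E (E (fun k d => F d k)).
under eq_bigr do rewrite big_mkcond /=.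
rewrite exchange_big /=; apply: eq_bigr => d _; rewrite -big_mkcond /=.
by apply: eq_bigl => k; rewrite mulnC.
Qed.

(** The tool for comparing sums weighted by 1/m: the weight splits over m = d (m/d), and the pairs
    with d k <= X lie in the square d, k <= X. *)
Lemma conv_bound (f g h : nat -> R) X :
  (forall n, 0 <= f n) -> (forall n, 0 <= g n) ->
  (forall m, (0 < m)%N -> (m <= X)%N -> h m <= \sum_(d <- divisors m) f d * g (m %/ d)%N) ->
  \sum_(1 <= m < X.+1) h m / m%:R <=
  (\sum_(1 <= m < X.+1) f m / m%:R) * (\sum_(1 <= m < X.+1) g m / m%:R).
Proof.
move=> f0 g0 hfg.
apply: le_trans (_ : \sum_(1 <= m < X.+1) \sum_(d <- divisors m)
    (f d / d%:R) * (g (m %/ d)%N / (m %/ d)%:R) <= _).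
  rewrite !big_nat; apply: ler_sum => m /andP[m0]; rewrite ltnS => mX.
  apply: le_trans (_ : (\sum_(d <- divisors m) f d * g (m %/ d)%N) / m%:R <= _).
    by rewrite ler_wpM2r ?invr_ge0 ?ler0n // hfg.
  rewrite mulr_suml big_seq [leRHS]big_seq; apply: ler_sum => d.
  rewrite -dvdn_divisors // => dm.
  by rewrite -{2}(divnK dm) natrM invfM; lra.
rewrite (dirichlet_sum (fun d k => (f d / d%:R) * (g k / k%:R))) mulr_suml.
apply: ler_sum => d _; rewrite -mulr_sumr; apply: ler_wpM2l.
  by rewrite divr_ge0.
rewrite [leRHS](big_cat_nat (n := (X %/ d).+1)) ?ltnS ?leq_div //= lerDl.
by apply: sumr_ge0 => k _; rewrite divr_ge0.
Qed.

End Summation.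

(** * Non-vanishing of L(1, chi) *)

Lemma divisors_coprimeM a b : (0 < a)%N -> (0 < b)%N -> coprime a b ->
  perm_eq (divisors (a * b)) [seq (x * y)%N | x <- divisors a, y <- divisors b].
Proof.
move=> a0 b0 cab; have ab0 : (0 < a * b)%N by rewrite muln_gt0 a0.
apply: uniq_perm; first exact: divisors_uniq.
  apply: allpairs_uniq; try exact: divisors_uniq.
  have gl x y : (x %| a)%N -> (y %| b)%N -> gcdn (x * y) a = x.
    move=> xa yb; rewrite -{1}(divnK xa) [X in gcdn _ X]mulnC -muln_gcdr.
    suff /eqP -> : coprime y (a %/ x) by rewrite muln1.
    by apply: coprime_dvdl yb _; rewrite coprime_sym; apply: coprime_dvdl cab; apply: dvdn_div.
  have gr x y : (x %| a)%N -> (y %| b)%N -> gcdn (x * y) b = y.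
    move=> xa yb; rewrite -{1}(divnK yb) -muln_gcdl.
    suff /eqP -> : coprime x (b %/ y) by rewrite mul1n.
    by apply: coprime_dvdl xa _; apply: coprime_dvdr cab; apply: dvdn_div.
  move=> [x y] [x' y'] /allpairsP[[u v] /= [ua vb [-> ->]]] /allpairsP[[u' v'] /= [ua' vb' [-> ->]]] e.
  rewrite -!dvdn_divisors // in ua vb ua' vb'.
  have -> : u = u' by rewrite -[LHS](gl u v) // e gl.
  by have -> : v = v' by rewrite -[LHS](gr u v) // e gr.
move=> d; rewrite -dvdn_divisors //; apply/idP/allpairsP => [dab|[[x y] /= []]].
  exists (gcdn d a, gcdn d b); rewrite /= -!dvdn_divisors // !dvdn_gcdr; split=> //.
  apply/eqP; rewrite eqn_dvd; apply/andP; split; last first.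
    rewrite Gauss_dvd ?dvdn_gcdl //.
    by apply: coprime_dvdl (dvdn_gcdr _ _) _; apply: coprime_dvdr (dvdn_gcdr _ _) _.
  have h : (d %| gcdn d a * b)%N by rewrite muln_gcdl dvdn_gcd dvdn_mulr.
  by rewrite muln_gcdr dvdn_gcd h dvdn_mull.
by rewrite -!dvdn_divisors // => xa yb ->; apply: dvdn_mul.
Qed.

Lemma divisors_pfactor p j : prime p ->
  perm_eq (divisors (p ^ j)) [seq (p ^ i)%N | i <- iota 0 j.+1].
Proof.
move=> pp; have pj0 : (0 < p ^ j)%N by rewrite expn_gt0 prime_gt0.
apply: uniq_perm; first exact: divisors_uniq.
  by rewrite map_inj_uniq ?iota_uniq //; apply: expnI; apply: prime_gt1.
move=> d; rewrite -dvdn_divisors //; apply/(dvdn_pfactor _ _ pp)/mapP => [[i ij ->]|[i]].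
  by exists i; rewrite // mem_iota add0n ltnS.
by rewrite mem_iota add0n ltnS => ij ->; exists i.
Qed.

Lemma pfactor_ind (P : nat -> Prop) :
  P 1%N ->
  (forall p j m, prime p -> (0 < j)%N -> (0 < m)%N -> ~~ (p %| m)%N -> P m -> P (p ^ j * m)%N) ->
  forall n, (0 < n)%N -> P n.
Proof.
move=> P1 PS; elim/ltn_ind => n IH n0.
have [n1|n1] := leqP n 1; first by have -> : n = 1%N by apply/eqP; rewrite eqn_leq n1.
have pp := pdiv_prime n1.
have [m] := pfactor_coprime pp n0; rewrite prime_coprime // => npm en.
have j0 : (0 < logn (pdiv n) n)%N by rewrite -pfactor_dvdn // expn1 pdiv_dvd.
have m0 : (0 < m)%N by move: n0; rewrite {1}en muln_gt0 => /andP[].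
rewrite en mulnC; apply: PS => //; apply: IH => //.
by rewrite [X in (_ < X)%N]en ltn_Pmulr // -{1}(expn0 (pdiv n)) ltn_exp2l ?prime_gt1.
Qed.

Lemma exists_nat_ge (R : realType) (x : R) : exists n : nat, x <= n%:R.
Proof. by exists (Num.truncn x).+1; apply/ltW/truncnS_gt. Qed.

Section Character.
Variables (R : realType) (chi : nat -> R) (N : nat).
Hypotheses (N_gt0 : (0 < N)%N) (chi1 : chi 1 = 1).
Hypothesis chiM : forall m n, chi (m * n)%N = chi m * chi n.
Hypothesis chi_val : forall n, [\/ chi n = 0, chi n = 1 | chi n = -1].
Hypothesis chi_per : forall n, chi (n + N)%N = chi n.
Hypothesis chi_sum0 : \sum_(0 <= i < N) chi i = 0.
Hypothesis chi_zero : forall p, prime p -> chi p = 0 -> (p %| N)%N.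

Lemma chi_norm_le1 n : `|chi n| <= 1.
Proof. by case: (chi_val n) => ->; rewrite ?normr0 ?normrN ?normr1. Qed.

Lemma chiX p i : chi (p ^ i)%N = chi p ^+ i.
Proof. by elim: i => [|i IH]; rewrite ?expn0 ?expr0 // expnS chiM IH exprS. Qed.

Lemma chi_period_sum m : \sum_(m <= i < m + N) chi i = 0.
Proof.
elim: m => [|m IH]; first exact: chi_sum0.
have mN : (m <= m + N)%N by rewrite leq_addr.
have := IH; rewrite big_ltn ?(leq_ltn_trans (leq_addr 0 m)) ?addn0 ?ltnS //; last first.
  by rewrite -[X in (X < _)%N]addn0 ltn_add2l.
by rewrite addSn big_nat_recr /= ?chi_per 1?addrC // -[X in (X < _)%N]addn0 ltn_add2l.
Qed.

(** Whole periods cancel, and at most N terms of absolute value at most 1 are left. *)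
Lemma chi_partial_sum m n : `|\sum_(m <= i < n) chi i| <= N%:R.
Proof.
have [k] := ubnP (n - m)%N; elim: k m => // k IH m.
have [nm|nm] := leqP (n - m) N => [_|].
  apply: le_trans (ler_norm_sum _ _ _) _.
  apply: le_trans (_ : \sum_(m <= i < n) (1 : R) <= _).
    by apply: ler_sum => i _; apply: chi_norm_le1.
  by rewrite sumr_const_nat ler_nat.
rewrite ltnS => nk.
rewrite (big_cat_nat (n := (m + N)%N)) ?leq_addr //=; last by clear -nm; lia.
by rewrite chi_period_sum add0r; apply: IH; clear -nm nk N_gt0; lia.
Qed.

Definition Lsum x := \sum_(1 <= n < x.+1) chi n / n%:R.

Lemma Lsum_tail x y : (x <= y)%N -> `|Lsum y - Lsum x| <= N%:R / x.+1%:R.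
Proof.
move=> xy; rewrite /Lsum (big_cat_nat (n := x.+1)) //= addrAC subrr add0r.
apply: (abel_bound (b := fun n => n%:R^-1)) => //.
- by move=> k _; apply: chi_partial_sum.
- move=> i xi; have i0 : (0 < i)%N by apply: leq_trans xi.
  by rewrite lef_pV2 ?posrE ?ltr0n // ler_nat.
- by move=> i _; rewrite invr_ge0.
Qed.

(** L is the supremum of the lower bounds Lsum n - N/(n + 1): by [Lsum_tail] each of them is below
    each upper bound Lsum m + N/(m + 1). *)
Lemma Lsum_limit : exists L, forall x, `|Lsum x - L| <= N%:R / x.+1%:R.
Proof.
pose E : set R := fun z => exists n, z = Lsum n - N%:R / n.+1%:R.
have le_up n m : Lsum n - N%:R / n.+1%:R <= Lsum m + N%:R / m.+1%:R.
  have e0 k : 0 <= N%:R / k.+1%:R :> R by rewrite divr_ge0.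
  move: (e0 n) (e0 m); have [nm|/ltnW mn] := leqP n m.
    have := Lsum_tail nm; rewrite ler_norml => /andP[h _].
    by move: h; move: (N%:R / _) (N%:R / _) => u v; lra.
  have := Lsum_tail mn; rewrite ler_norml => /andP[_ h].
  by move: h; move: (N%:R / _) (N%:R / _) => u v; lra.
have Eub m : ubound E (Lsum m + N%:R / m.+1%:R) by move=> _ [n ->]; apply: le_up.
have hE : has_sup E.
  split; first by exists (Lsum 0 - N%:R / 1), 0%N.
  by exists (Lsum 0 + N%:R / 1); apply: Eub.
exists (sup E) => x.
have h1 : sup E <= Lsum x + N%:R / x.+1%:R by apply: ge_sup => //; case: hE.
have h2 : Lsum x - N%:R / x.+1%:R <= sup E by apply: ub_le_sup; [case: hE | exists x].
rewrite ler_norml; move: h1 h2; move: (N%:R / _) => e; lra.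
Qed.

(** The coefficients of zeta(s) L(s, chi): multiplicative, nonnegative, and at least 1 at the powers
    of 4. *)
Definition rchi n := \sum_(d <- divisors n) chi d.

Lemma rchiM a b : (0 < a)%N -> (0 < b)%N -> coprime a b -> rchi (a * b) = rchi a * rchi b.
Proof.
move=> a0 b0 cab; rewrite /rchi (perm_big _ (divisors_coprimeM a0 b0 cab)) /=.
rewrite big_allpairs_dep mulr_suml; apply: eq_bigr => x _.
by rewrite mulr_sumr; apply: eq_bigr => y _; rewrite chiM.
Qed.

Lemma rchi_pfactor p j : prime p -> rchi (p ^ j) = \sum_(0 <= i < j.+1) chi p ^+ i.
Proof.
move=> pp; rewrite /rchi (perm_big _ (divisors_pfactor j pp)) big_map.
by rewrite /index_iota subn0; apply: eq_bigr => i _; rewrite chiX.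
Qed.

Lemma rchi_pfactor_cases p j : prime p ->
  [\/ chi p = 0 /\ rchi (p ^ j) = 1,
      chi p = 1 /\ rchi (p ^ j) = j.+1%:R |
      chi p = -1 /\ rchi (p ^ j) = (~~ odd j)%:R].
Proof.
move=> pp; rewrite rchi_pfactor //; case: (chi_val p) => e; [apply: Or31|apply: Or32|apply: Or33];
  split=> //; rewrite e.
- by rewrite big_ltn // big_nat big1 ?addr0 // => i /andP[i0 _]; rewrite expr0n gtn_eqF.
- under eq_bigr do rewrite expr1n.
  by rewrite sumr_const_nat subn0.
elim: j => [|j IH]; first by rewrite big_nat1.
by rewrite big_nat_recr //= IH -signr_odd /=; case: (odd j);
  rewrite /= ?expr0 ?expr1 ?subrr ?add0r.
Qed.

Lemma rchi1 : rchi 1 = 1.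
Proof. by rewrite /rchi (_ : divisors 1 = [:: 1%N]) // big_seq1. Qed.

Lemma rchi_ge0 n : (0 < n)%N -> 0 <= rchi n.
Proof.
move: n; apply: pfactor_ind => [|p j m pp j0 m0 npm IH]; first by rewrite rchi1.
have cpm : coprime (p ^ j) m by apply: coprimeXl; rewrite prime_coprime.
have pj0 : (0 < p ^ j)%N by rewrite expn_gt0 prime_gt0.
rewrite rchiM //.
by apply: mulr_ge0 => //; case: (rchi_pfactor_cases j pp) => -[_ ->].
Qed.

Lemma rchi_sqr_pow2 i : 1 <= rchi (2 ^ i.*2).
Proof.
by case: (rchi_pfactor_cases i.*2 (isT : prime 2)) => -[_ ->]; rewrite ?odd_double ?ler1n.
Qed.

Section AtL.
Variable L : R.
Hypothesis LP : forall x, `|Lsum x - L| <= N%:R / x.+1%:R.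

(* Monsky's argument: if L vanished, the Lambert series \sum chi(n) t^n/(1 - t^n)
   would stay bounded as t -> 1, since its difference with \sum chi(n)/(n(1 - t))
   has the monotone weights b_n = 1/(n(1 - t)) - t^n/(1 - t^n). *)
Section Lambert.
Variable t : R.
Hypotheses (t0 : 0 <= t) (t1 : 0 < 1 - t).

Let geo n : R := \sum_(0 <= i < n) t ^+ i.

Let t_le1 : t <= 1. Proof. by move: t1; lra. Qed.

Lemma geoE n : (1 - t) * geo n = 1 - t ^+ n.
Proof.
elim: n => [|n IH]; first by rewrite /geo big_geq // expr0 mulr0 subrr.
by rewrite /geo big_nat_recr //= mulrDr IH exprS; ring.
Qed.

Lemma geoS n : geo n.+1 = 1 + t * geo n.
Proof. by apply: (mulfI (lt0r_neq0 t1)); rewrite geoE mulrDr mulrCA geoE exprS; ring. Qed.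

Lemma geo_gt0 n : (0 < n)%N -> 0 < geo n.
Proof.
case: n => // n _; rewrite geoS; apply: ltr_pwDl => //; apply: mulr_ge0 => //.
by apply: sumr_ge0 => i _; apply: exprn_ge0.
Qed.

Lemma power_bernoulli m : t ^+ m * (1 + m%:R * (1 - t)) <= 1.
Proof.
elim: m => [|m IH]; first by rewrite expr0; lra.
have tm : t ^+ m <= 1 by apply: exprn_ile1.
have -> : t ^+ m.+1 * (1 + m.+1%:R * (1 - t))
  = t * (t ^+ m * (1 + m%:R * (1 - t))) + t * (t ^+ m) * (1 - t).
  by rewrite exprS -[m.+1]addn1 natrD; ring.
have := ler_wpM2l t0 IH.
have : t * t ^+ m * (1 - t) <= 1 * (1 - t).
  by apply: ler_wpM2r; [exact: ltW | apply: le_trans (ler_wpM2l t0 tm) _; rewrite mulr1].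
lra.
Qed.

(** For t > 0, division by t^n shows the sum over j <= n of the Bernoulli bounds t^(-j) >= 1 + j (1
    - t). *)
Lemma geo_lower n : t ^+ n * ((n%:R + 1) + (1 - t) * (n%:R * (n%:R + 1) / 2)) <= geo n.+1.
Proof.
elim: n => [|n IH]; first by rewrite geoS /geo big_geq // expr0; lra.
rewrite geoS; have := ler_wpM2l t0 IH; have := power_bernoulli n.+1.
rewrite exprS -[n.+1]addn1 natrD => h1 h2; apply: le_trans (lerD h1 h2).
rewrite le_eqVlt; apply/orP; left; apply/eqP.
by field.
Qed.

(** After clearing denominators this is b (n + 1) <= b n for the weights below, because geo (n + 1)
    - t geo n = 1. *)
Lemma geo_product n : n%:R * (n%:R + 1) * t ^+ n <= geo n * geo n.+1.
Proof.
elim: n => [|n IH]; first by rewrite !mul0r [geo 0]big_geq // mul0r.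
have -> : geo n.+1 * geo n.+2 = (1 + t) * geo n.+1 + t ^+ 2 * (geo n * geo n.+1).
  by rewrite (geoS n.+1) {2}(geoS n); ring.
have h1 := ler_wpM2l (sqr_ge0 t) IH.
have h2 := geo_lower n.
have g0 : 0 <= geo n.+1 by apply/ltW/geo_gt0.
have h0 : 2 * t <= 1 + t by move: t_le1; lra.
have h3 : 2 * t * geo n.+1 <= (1 + t) * geo n.+1 by apply: ler_wpM2r.
have h4 : 2 * t * (t ^+ n * ((n%:R + 1) + (1 - t) * (n%:R * (n%:R + 1) / 2))) <= 2 * t * geo n.+1.
  by apply: ler_wpM2l => //; apply: mulr_ge0.
apply: le_trans (lerD (le_trans h4 h3) h1).
rewrite -[n.+1]addn1 natrD exprD expr1 le_eqVlt; apply/orP; left; apply/eqP.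
by field.
Qed.

Let b n := (n%:R * (1 - t))^-1 - t ^+ n / (1 - t ^+ n).

Lemma lambert_weightE n : (0 < n)%N -> b n = (n%:R^-1 - t ^+ n / geo n) / (1 - t).
Proof.
move=> n0; rewrite /b -geoE; have := geo_gt0 n0; move=> g0.
by field; rewrite (gt_eqF g0) (gt_eqF t1) pnatr_eq0 gtn_eqF.
Qed.

Lemma lambert_weight_decr n : (0 < n)%N -> b n.+1 <= b n.
Proof.
move=> n0; rewrite !lambert_weightE //; apply: ler_wpM2r; first by rewrite invr_ge0 ltW.
have g0 := geo_gt0 n0; have g1 := geo_gt0 (isT : (0 < n.+1)%N).
have n0' : 0 < n%:R :> R by rewrite ltr0n.
rewrite -subr_ge0.
have -> : n%:R^-1 - t ^+ n / geo n - (n.+1%:R^-1 - t ^+ n.+1 / geo n.+1)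
  = (geo n * geo n.+1 - n%:R * (n%:R + 1) * t ^+ n * (geo n.+1 - t * geo n))
     / (n%:R * (n%:R + 1) * (geo n * geo n.+1)).
  rewrite -[n.+1%:R]natr1 exprS; field.
  by rewrite (gt_eqF g0) (gt_eqF g1) (gt_eqF n0') gt_eqF //; lra.
apply: divr_ge0; last by rewrite !mulr_ge0 // ?(ltW g0) ?(ltW g1) //; lra.
by rewrite (geoS n) addrK mulr1 -geoS subr_ge0 geo_product.
Qed.

Lemma lambert_weight1 : b 1 = 1.
Proof. by rewrite /b expr1; field; rewrite gt_eqF. Qed.

Lemma lambert_weight_ge0 n : (0 < n)%N -> 0 <= b n.
Proof.
move=> n0; rewrite lambert_weightE //; apply: divr_ge0; last exact: ltW.
have g0 := geo_gt0 n0.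
rewrite subr_ge0 ler_pdivrMr // mulrC ler_pdivlMr ?ltr0n // mulrC.
rewrite /geo; apply: le_trans (_ : \sum_(0 <= i < n) t ^+ n <= _).
  by rewrite sumr_const_nat subn0 mulr_natl.
rewrite !big_nat; apply: ler_sum => i /andP[_ i_n].
by apply: ler_wiXn2l => //; apply: ltnW.
Qed.

(** When L = 0, t^n/(1 - t^n) may be replaced by - b n at the price of Lsum X/(1 - t), which is
    small for large X; the weights start at b 1 = 1, so Abel summation costs N. *)
Lemma lambert_sum_chi X : L = 0 ->
  \sum_(1 <= n < X.+1) chi n * (t ^+ n / (1 - t ^+ n)) <= N%:R / X.+1%:R / (1 - t) + N%:R.
Proof.
move=> L0.
have -> : \sum_(1 <= n < X.+1) chi n * (t ^+ n / (1 - t ^+ n))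
  = Lsum X / (1 - t) - \sum_(1 <= n < X.+1) chi n * b n.
  rewrite /Lsum mulr_suml -sumrB; apply: eq_bigr => n _.
  by rewrite /b invfM; ring.
apply: lerD.
  apply: ler_wpM2r; first by rewrite invr_ge0 ltW.
  by have := LP X; rewrite L0 subr0 => /(le_trans (ler_norm _)).
have := @abel_bound R chi b N%:R 1 X.+1 isT (fun k _ => chi_partial_sum _ _)
  lambert_weight_decr lambert_weight_ge0.
by rewrite lambert_weight1 mulr1 ler_norml => /andP[h _]; rewrite lerNl.
Qed.

(** Expanding r as a divisor sum yields geometric sums cut at d k <= X; the tail dropped for each d
    <= X is at most t^X/(1 - t). *)
Lemma lambert_truncation X :
  \sum_(1 <= m < X.+1) rchi m * t ^+ m
  <= \sum_(1 <= n < X.+1) chi n * (t ^+ n / (1 - t ^+ n)) + X%:R * (t ^+ X / (1 - t)).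
Proof.
have -> : \sum_(1 <= m < X.+1) rchi m * t ^+ m =
    \sum_(1 <= m < X.+1) \sum_(d <- divisors m) chi d * t ^+ (d * (m %/ d)).
  rewrite !big_nat; apply: eq_bigr => m /andP[m0 _].
  rewrite /rchi mulr_suml big_seq [RHS]big_seq; apply: eq_bigr => d.
  by rewrite -dvdn_divisors // mulnC => /divnK ->.
rewrite (dirichlet_sum (fun d k => chi d * t ^+ (d * k))).
have -> : X%:R * (t ^+ X / (1 - t)) = \sum_(1 <= n < X.+1) (t ^+ X / (1 - t)).
  by rewrite sumr_const_nat subn1 mulr_natl.
rewrite -big_split /= !big_nat; apply: ler_sum => d /andP[d0 _].
have g0 := geo_gt0 d0.
have td1 : 0 < 1 - t ^+ d by rewrite -geoE mulr_gt0.
have geo_sum Y : \sum_(1 <= k < Y.+1) t ^+ (d * k) = (t ^+ d - t ^+ (d * Y.+1)) / (1 - t ^+ d).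
  elim: Y => [|Y IH]; first by rewrite big_geq // muln1 subrr mul0r.
  rewrite big_nat_recr //= IH [in RHS](mulnS d Y.+1) exprD.
  by field; rewrite gt_eqF.
rewrite -mulr_sumr geo_sum mulrBl mulrBr lerD2l.
set e := t ^+ (d * _) / _.
have e0 : 0 <= e by rewrite /e divr_ge0 ?exprn_ge0 // ltW.
have eX : e <= t ^+ X / (1 - t).
  apply: ler_pM; rewrite ?exprn_ge0 ?invr_ge0 //; first exact: ltW.
    by apply: ler_wiXn2l => //; rewrite mulnC; apply/ltnW/ltn_ceil.
  have td : t ^+ d <= t ^+ 1 by apply: ler_wiXn2l.
  by rewrite lef_pV2 ?posrE //; move: td; rewrite expr1; lra.
apply: le_trans (ler_norm _) _; rewrite normrN normrM (ger0_norm e0).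
by apply: le_trans eX; rewrite -[leRHS]mul1r; apply: ler_wpM2r => //; apply: chi_norm_le1.
Qed.

(** The bound depends neither on t nor on M. The terms being nonnegative, the sum may be prolonged
    to 2n terms, with n so large that the two error terms, at most 2/(h^3 n) and N/(h n), add up to
    at most 1. *)
Lemma lambert_bounded M : L = 0 -> \sum_(1 <= m < M.+1) rchi m * t ^+ m <= N%:R + 1.
Proof.
move=> L0; set h := 1 - t.
have [n nP] := exists_nat_ge (2 / h ^+ 3 + N%:R / h + M%:R + 1).
have h3 : 0 < h ^+ 3 by rewrite exprn_gt0.
have q1 : 0 <= 2 / h ^+ 3 by rewrite divr_ge0 // ltW.
have q2 : 0 <= N%:R / h by rewrite divr_ge0 // ltW.
have M0 : 0 <= M%:R :> R by [].
have n1 : 1 <= n%:R :> R by move: nP; lra.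
have n0 : 0 < n%:R :> R by apply: lt_le_trans n1.
have Mn : (M <= n.*2)%N.
  by rewrite -addnn -(ler_nat R) natrD; move: nP; lra.
have D_le : \sum_(1 <= m < M.+1) rchi m * t ^+ m <= \sum_(1 <= m < n.*2.+1) rchi m * t ^+ m.
  rewrite [leRHS](big_cat_nat (n := M.+1)) //= lerDl big_nat.
  apply: sumr_ge0 => m /andP[Mm _]; apply: mulr_ge0; last exact: exprn_ge0.
  by apply: rchi_ge0; apply: leq_trans Mm.
apply: le_trans D_le _; apply: le_trans (lambert_truncation _) _; rewrite -/h.
have := lambert_sum_chi n.*2 L0; rewrite -/h => S_le.
have tn : t ^+ n * (n%:R * h) <= 1.
  apply: le_trans (power_bernoulli n); rewrite -/h; apply: ler_wpM2l; first exact: exprn_ge0.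
  lra.
have tn0 : 0 <= t ^+ n by apply: exprn_ge0.
have tn2 : t ^+ n.*2 * (n%:R * h) ^+ 2 <= 1.
  rewrite -mul2n mulnC exprM -exprMn exprn_ile1 //.
  by rewrite !mulr_ge0 // ltW.
have e1 : n.*2%:R * (t ^+ n.*2 / h) <= 2 / h ^+ 3 / n%:R.
  have -> : n.*2%:R * (t ^+ n.*2 / h) = 2 / h ^+ 3 / n%:R * (t ^+ n.*2 * (n%:R * h) ^+ 2).
    move: (t ^+ n.*2) => T; rewrite -muln2 natrM.
    by field; rewrite (gt_eqF n0) (gt_eqF t1).
  by rewrite ler_piMr // divr_ge0 // ltW.
have e2 : N%:R / n.*2.+1%:R / h <= N%:R / h / n%:R.
  have i : n.*2.+1%:R^-1 <= n%:R^-1 :> R.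
    rewrite lef_pV2 ?posrE // ?ltr0n // ler_nat -addnn; clear; lia.
  by rewrite [leLHS]mulrAC; apply: ler_wpM2l.
have e3 : 2 / h ^+ 3 / n%:R + N%:R / h / n%:R <= 1.
  by rewrite -mulrDl ler_pdivrMr // mul1r; move: nP; lra.
apply: le_trans (lerD S_le e1) _; move: e2 e3.
move: (N%:R / n.*2.+1%:R / h) (N%:R / h / n%:R) (2 / h ^+ 3 / n%:R) => u v w; lra.
Qed.

End Lambert.

Lemma sum_rchi_pow4 J : J.+1%:R <= \sum_(1 <= m < (2 ^ J.*2).+1) rchi m.
Proof.
elim: J => [|J IH]; first by rewrite big_nat1 rchi1.
have lt4 : (2 ^ J.*2 < 2 ^ J.+1.*2)%N by rewrite ltn_exp2l // ltn_double.
rewrite (big_cat_nat (n := (2 ^ J.*2).+1)) //=; last exact: ltnW.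
rewrite -[J.+2%:R]natr1; apply: lerD => //.
rewrite big_nat_recr //=; apply: le_trans (rchi_sqr_pow2 J.+1) _; rewrite lerDr big_nat.
by apply: sumr_ge0 => m /andP[Jm _]; apply: rchi_ge0; apply: leq_trans Jm.
Qed.

Lemma L_neq0 : L <> 0.
Proof.
(* At t = 1 - 1/(2M) all powers up to t^M are at least 1/2, so the Lambert sum is at least (J + 1)/2
   = N + 3/2, above the bound N + 1. *)
move=> L0; set J := (2 * N + 2)%N; set M := (2 ^ J.*2)%N.
have M0 : 0 < M%:R :> R by rewrite ltr0n expn_gt0.
have M1 : 1 <= M%:R :> R by rewrite ler1n expn_gt0.
set t : R := 1 - (2 * M%:R)^-1.
have i0 : 0 < (2 * M%:R)^-1 :> R by rewrite invr_gt0 mulr_gt0.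
have i1 : (2 * M%:R)^-1 <= 2^-1 :> R by rewrite lef_pV2 ?posrE ?mulr_gt0 // ler_peMr.
have t0 : 0 <= t by rewrite /t; lra.
have t_le1 : t <= 1 by rewrite /t; lra.
have t1 : 0 < 1 - t by rewrite /t; lra.
have half n : 1 - n%:R * (2 * M%:R)^-1 <= t ^+ n.
  elim: n => [|n IH]; first by rewrite expr0; lra.
  rewrite exprS; apply: le_trans (ler_wpM2l t0 IH).
  have : 0 <= n%:R * (2 * M%:R)^-1 * (2 * M%:R)^-1 :> R by rewrite !mulr_ge0 // ltW.
  by rewrite /t -[n.+1%:R]natr1; move: ((2 * M%:R)^-1) => e; nra.
have tM m : (m < M.+1)%N -> 2^-1 <= t ^+ m.
  rewrite ltnS => mM; apply: le_trans (half m).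
  have : m%:R * (2 * M%:R)^-1 <= M%:R * (2 * M%:R)^-1 :> R.
    by apply: ler_wpM2r; [exact: ltW | rewrite ler_nat].
  have -> : M%:R * (2 * M%:R)^-1 = 2^-1 :> R by field; rewrite gt_eqF.
  lra.
have h1 := lambert_bounded t0 t1 M L0.
have h2 : 2^-1 * \sum_(1 <= m < M.+1) rchi m <= \sum_(1 <= m < M.+1) rchi m * t ^+ m.
  rewrite mulr_sumr !big_nat; apply: ler_sum => m /andP[m0 mM].
  by rewrite mulrC; apply: ler_wpM2l; [apply: rchi_ge0 | apply: tM].
have h3 := sum_rchi_pow4 J; rewrite -/M in h3.
have : J.+1%:R = 2 * N%:R + 3 :> R by rewrite /J -addnS natrD natrM.
move: h1 h2 h3; lra.
Qed.

(** Summing over the cofactor k last leaves Lsum (z/k)/k in each term. Replacing Lsum by L costs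
    N/(z/k + 1) divided by k, which is at most N/z, and there are z terms. *)
Lemma sum_rchi_over_id z :
  `|\sum_(1 <= n < z.+1) rchi n / n%:R - L * \sum_(1 <= n < z.+1) n%:R^-1| <= N%:R.
Proof.
have -> : \sum_(1 <= n < z.+1) rchi n / n%:R
  = \sum_(1 <= k < z.+1) k%:R^-1 * Lsum (z %/ k).
  transitivity (\sum_(1 <= m < z.+1) \sum_(d <- divisors m) (chi d / d%:R) * (m %/ d)%:R^-1).
    rewrite !big_nat; apply: eq_bigr => m /andP[m0 _].
    rewrite /rchi mulr_suml big_seq [RHS]big_seq; apply: eq_bigr => d.
    by rewrite -dvdn_divisors // => dm; rewrite -{1}(divnK dm) natrM invfM; ring.
  rewrite (dirichlet_sum (fun d k => (chi d / d%:R) * k%:R^-1)).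
  rewrite (dirichlet_sum_sym (fun d k => (chi d / d%:R) * k%:R^-1)).
  by apply: eq_bigr => k _; rewrite mulr_sumr; apply: eq_bigr => d _; rewrite mulrC.
rewrite mulr_sumr -sumrB; apply: le_trans (ler_norm_sum _ _ _) _.
have [->|z0] := posnP z; first by rewrite big_geq.
apply: le_trans (_ : \sum_(1 <= k < z.+1) N%:R / z%:R <= _); last first.
  by rewrite sumr_const_nat subn1 /= -[leLHS]mulr_natr divfK // pnatr_eq0 -lt0n.
rewrite !big_nat; apply: ler_sum => k /andP[k0 _].
have k0' : 0 < k%:R :> R by rewrite ltr0n.
rewrite [L * _]mulrC -mulrBr normrM ger0_norm ?invr_ge0 //.
rewrite [_^-1 * _]mulrC ler_pdivrMr //; apply: le_trans (LP _) _.
rewrite -mulrA; apply: ler_wpM2l => //.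
have z0' : 0 < z%:R :> R by rewrite ltr0n.
have h : z%:R <= k%:R * (z %/ k).+1%:R :> R.
  by rewrite -natrM ler_nat mulnC; apply/ltnW; apply: ltn_ceil.
by rewrite mulrC ler_pdivlMr // mulrC ler_pdivrMr.
Qed.

End AtL.

End Character.

(** * Integers composed of split primes *)

Definition issq (n : nat) : bool := [exists k : 'I_n.+1, (k ^ 2 == n)%N].

Lemma issqP n : reflect (exists k, n = (k ^ 2)%N) (issq n).
Proof.
apply: (iffP existsP) => [[k /eqP <-]|[k ->]]; first by exists k.
have kk : (k < (k ^ 2).+1)%N by rewrite ltnS; case: k => // k; rewrite -mulnn leq_pmulr.
by exists (Ordinal kk).
Qed.

Section SimpleSums.
Variable R : realType.

Lemma sum_inv_sqr z : \sum_(1 <= j < z.+1) (j%:R ^+ 2)^-1 <= 2 :> R.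
Proof.
suff h y : \sum_(1 <= j < y.+2) (j%:R ^+ 2)^-1 <= 2 - y.+1%:R^-1 :> R.
  case: z => [|z]; first by rewrite big_geq.
  by apply: le_trans (h z) _; rewrite gerBl invr_ge0.
elim: y => [|y IH]; first by rewrite big_nat1; lra.
rewrite big_nat_recr //=; apply: le_trans (lerD IH (lexx _)) _.
rewrite -[y.+2%:R]natr1; have : 0 < y.+1%:R :> R by rewrite ltr0n.
move: (y.+1%:R : R) => n n0; rewrite -subr_ge0.
have -> : 2 - (n + 1)^-1 - (2 - n^-1 + ((n + 1) ^+ 2)^-1) = (n * (n + 1) ^+ 2)^-1.
  by field; rewrite (gt_eqF n0) gt_eqF //; lra.
by rewrite invr_ge0 mulr_ge0 ?sqr_ge0 // ltW.
Qed.

Lemma sum_pred1_le1 (c m n : nat) : \sum_(m <= i < n) (i == c)%:R <= 1 :> R.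
Proof.
have [ci|nci] := boolP (c \in index_iota m n).
  rewrite (bigD1_seq c) ?iota_uniq //= eqxx big1 ?addr0 // => i /negPf -> //.
rewrite big_seq big1 // => i ii; case: eqP => // ic.
by rewrite -ic ii in nci.
Qed.

Lemma sum_issq z : \sum_(1 <= n < z.+1) (issq n)%:R / n%:R <= 2 :> R.
Proof.
apply: le_trans (sum_inv_sqr z).
apply: le_trans (_ : \sum_(1 <= n < z.+1) \sum_(1 <= j < z.+1) (n == (j ^ 2)%N)%:R / (j%:R ^+ 2) <= _).
  rewrite !big_nat; apply: ler_sum => n /andP[n0 nz].
  case: issqP => [[k ek]|_]; last by rewrite mul0r; apply: sumr_ge0 => j _; rewrite divr_ge0 ?sqr_ge0.
  have k0 : (0 < k)%N by move: n0; rewrite ek; case: k {ek}.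
  have kz : (k < z.+1)%N by apply: leq_ltn_trans nz; rewrite ek -mulnn leq_pmulr.
  rewrite (bigD1_seq k) ?mem_index_iota ?k0 ?iota_uniq //= ek eqxx natrX lerDl.
  by apply: sumr_ge0 => j _; rewrite divr_ge0 ?sqr_ge0.
rewrite exchange_big /=; apply: ler_sum => j _.
by rewrite -mulr_suml ler_piMl ?invr_ge0 ?sqr_ge0 // sum_pred1_le1.
Qed.

Lemma sum_divides (B z : nat) : (0 < B)%N ->
  \sum_(1 <= e < z.+1) (e %| B)%:R / e%:R <= (size (divisors B))%:R :> R.
Proof.
move=> B0; apply: le_trans (_ : \sum_(1 <= e < z.+1) \sum_(d <- divisors B) (e == d)%:R <= _).
  rewrite !big_nat; apply: ler_sum => e /andP[e0 _].
  have [eB|_] := boolP (e %| B)%N; last by rewrite mul0r sumr_ge0.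
  rewrite (bigD1_seq e) ?divisors_uniq -?dvdn_divisors //= eqxx mul1r.
  by apply: ler_wpDr; [rewrite sumr_ge0 | rewrite invf_le1 ?ler1n // ltr0n].
rewrite exchange_big /=; apply: le_trans (_ : \sum_(d <- divisors B) 1 <= _).
  by apply: ler_sum => d _; apply: sum_pred1_le1.
by rewrite big_const_seq count_predT iter_addr addr0.
Qed.

End SimpleSums.

Section SplitNumbers.
Variables (R : realType) (chi : nat -> R) (N : nat).
Hypotheses (N_gt0 : (0 < N)%N) (chi1 : chi 1 = 1).
Hypothesis chiM : forall m n, chi (m * n)%N = chi m * chi n.
Hypothesis chi_val : forall n, [\/ chi n = 0, chi n = 1 | chi n = -1].
Hypothesis chi_zero : forall p, prime p -> chi p = 0 -> (p %| N)%N.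

Let pi : nat_pred := [pred p | chi p == 1].

Definition split_sqf (b n : nat) : bool :=
  sqf n && all (fun p => (chi p == 1) && (b < p)%N) (primes n).

Let F (n : nat) : R := (pi.-nat n)%:R.
Let tauF (n : nat) : R := \sum_(d <- divisors n) F d * F (n %/ d)%N.
Let isE (n : nat) : bool := has (fun e => (e %| n)%N && issq (n %/ e)) (divisors N).

Lemma chi_split n : pi.-nat n -> chi n = 1.
Proof.
move=> pn; have n0 : (0 < n)%N by case/andP: pn.
move: n n0 pn; apply: pfactor_ind => [_|p j m pp j0 m0 _ IH]; first exact: chi1.
have pj0 : (0 < p ^ j)%N by rewrite expn_gt0 prime_gt0.
rewrite pnatM pnatX => /andP[/orP[|]]; last by rewrite eqn0Ngt j0.
by rewrite pnatE // inE /= => /eqP pi_p pm; rewrite chiM chiX // pi_p expr1n mul1r IH.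
Qed.

Lemma rchi_split n : pi.-nat n -> rchi chi n = tauF n.
Proof.
move=> pn; have n0 : (0 < n)%N by case/andP: pn.
rewrite /rchi /tauF big_seq [RHS]big_seq; apply: eq_bigr => d; rewrite -dvdn_divisors // => dn.
have pd := pnat_dvd dn pn; rewrite /F pd (pnat_dvd _ pn) ?mulr1; last exact: dvdn_div.
exact: chi_split.
Qed.

(** At a prime with chi p = -1, r is 1 or 0 as the exponent is even or odd; at a prime with chi p =
    0 it is always 1. So r lives on the integers e k^2, where e collects the primes dividing N that
    have odd exponent. *)
Lemma rchi_nonsplit n : (negn pi).-nat n -> rchi chi n <= (isE n)%:R.
Proof.
move=> pn; have n0 : (0 < n)%N by case/andP: pn.
suff [->|[-> ->]] : rchi chi n = 0 \/ rchi chi n = 1 /\ isE n by rewrite ?ler0n.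
move: n n0 pn; apply: pfactor_ind => [_|p j m pp j0 m0 npm IH].
  right; rewrite rchi1 //; split=> //; apply/hasP; exists 1%N; first by rewrite -dvdn_divisors.
  by rewrite dvd1n divn1; apply/issqP; exists 1%N.
have pj0 : (0 < p ^ j)%N by rewrite expn_gt0 prime_gt0.
have cpm : coprime (p ^ j) m by apply: coprimeXl; rewrite prime_coprime.
rewrite pnatM pnatX => /andP[/orP[|]]; last by rewrite eqn0Ngt j0.
rewrite pnatE // !inE /= => npi /IH {IH} IH.
rewrite rchiM //; case: IH => [->|[-> /hasP[e]]]; first by left; rewrite mulr0.
rewrite -dvdn_divisors // => eN /andP[em /issqP[k ek]].
have em' : m = (e * k ^ 2)%N by rewrite -ek mulnC divnK.
have e0 : (0 < e)%N := dvdn_gt0 N_gt0 eN.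
have sqE f l : (f %| N)%N -> (0 < f)%N -> (p ^ j * m = f * l ^ 2)%N -> isE (p ^ j * m).
  move=> fN f0 E; apply/hasP; exists f; first by rewrite -dvdn_divisors.
  by rewrite E dvdn_mulr // mulKn //; apply/issqP; exists l.
rewrite mulr1; case: (rchi_pfactor_cases chi1 chiM chi_val j pp) => -[cp ->].
- right; split=> //.
  have cpe : coprime p e by apply: coprime_dvdr em _; rewrite prime_coprime.
  have [oj|ej] := boolP (odd j).
    apply: (sqE (p * e)%N (p ^ j./2 * k)%N).
    + by rewrite Gauss_dvd // chi_zero.
    + by rewrite muln_gt0 prime_gt0.
    rewrite em' -{1}(odd_double_half j) oj expnD expn1 -muln2 expnM expnMn; ring.
  apply: (sqE e (p ^ j./2 * k)%N) => //.
  by rewrite em' -{1}(odd_double_half j) (negPf ej) add0n -muln2 expnM expnMn; ring.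
- by rewrite cp eqxx in npi.
case: (boolP (odd j)) => [_|ej]; [by left | right; split=> //].
apply: (sqE e (p ^ j./2 * k)%N) => //.
by rewrite em' -{1}(odd_double_half j) (negPf ej) add0n -muln2 expnM expnMn; ring.
Qed.

Lemma tauF_ge0 n : 0 <= tauF n.
Proof. by apply: sumr_ge0 => d _; rewrite mulr_ge0. Qed.

(** Only the term where d is the split part of n is used: there r counts divisors, and
    [rchi_nonsplit] handles the complementary part. *)
Lemma rchi_le_conv n : (0 < n)%N ->
  rchi chi n <= \sum_(d <- divisors n) tauF d * (isE (n %/ d))%:R.
Proof.
move=> n0; have np := partnC pi n0.
rewrite (bigD1_seq (partn n pi)) ?divisors_uniq -?dvdn_divisors ?dvdn_part //=.
apply: ler_wpDr; first by apply: sumr_ge0 => d _; rewrite mulr_ge0 ?tauF_ge0.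
have -> : (n %/ (partn n pi) = (partn n (negn pi)))%N by rewrite -{1}np mulKn ?part_gt0.
rewrite -{1}np rchiM ?part_gt0 ?coprime_partC // rchi_split ?part_pnat //.
by apply: ler_wpM2l; [apply: tauF_ge0 | apply: rchi_nonsplit; apply: part_pnat].
Qed.

Lemma split_le_conv n : (0 < n)%N ->
  F n <= \sum_(d <- divisors n) (split_sqf 0 d)%:R * (issq (n %/ d))%:R.
Proof.
move=> n0; rewrite /F; have [pn|_] := boolP (pi.-nat n); last by apply: sumr_ge0 => d _; rewrite mulr_ge0.
have [a [k [e sa]]] := sqf_part n0; have an : (a %| n)%N by rewrite e dvdn_mulr.
have a0 : (0 < a)%N := dvdn_gt0 n0 an.
rewrite (bigD1_seq a) ?divisors_uniq -?dvdn_divisors //=.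
have -> : split_sqf 0 a.
  rewrite /split_sqf sa; apply/allP => p pa.
  have /allP h : all (mem pi) (primes a) by case/andP: (pnat_dvd an pn).
  have -> : chi p == 1 := h p pa.
  by rewrite prime_gt0 //; move: pa; rewrite mem_primes => /andP[].
have -> : issq (n %/ a) by rewrite e mulKn //; apply/issqP; exists k.
by rewrite mulr1 lerDl; apply: sumr_ge0 => d _; rewrite mulr_ge0.
Qed.

(** The part of n made of primes up to b is squarefree, hence divides b!; so discarding small primes
    costs a bounded factor. *)
Lemma split_sqf_le_conv b n : (0 < n)%N ->
  (split_sqf 0 n)%:R <= \sum_(d <- divisors n) (d %| b`!)%:R * (split_sqf b (n %/ d))%:R :> R.
Proof.
move=> n0; case: (boolP (split_sqf 0 n)) => [|_]; last by apply: sumr_ge0 => d _; rewrite mulr_ge0.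
move=> /andP[/andP[_ /allP sn] /allP cn].
pose ro : nat_pred := [pred p | (p <= b)%N].
have np := partnC ro n0.
have en : ((partn n ro) %| n)%N by apply: dvdn_part.
have en' : ((partn n (negn ro)) %| n)%N by apply: dvdn_part.
rewrite (bigD1_seq (partn n ro)) ?divisors_uniq -?dvdn_divisors //=.
have -> : (n %/ (partn n ro) = (partn n (negn ro)))%N by rewrite -{1}np mulKn ?part_gt0.
have prn p : prime p -> (p %| n)%N -> p \in primes n by move=> pp pn; rewrite mem_primes pp n0.
have -> : ((partn n ro) %| b`!)%N.
  apply/(dvdn_partP _ (part_gt0 _ _)) => p; rewrite mem_primes => /and3P[pp _ pe].
  have pb : (p <= b)%N.
    have /andP[_ /allP h] := part_pnat ro n.
    by apply: (h p); rewrite mem_primes pp part_gt0.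
  rewrite p_part; have : (logn p (partn n ro) <= 1)%N.
    by rewrite -(eqP (sn p (prn p pp (dvdn_trans pe en)))) dvdn_leq_log.
  case: (logn p _) => [|[|//]] _; first by rewrite expn0 dvd1n.
  by rewrite expn1 dvdn_fact // prime_gt0.
have -> : split_sqf b (partn n (negn ro)).
  apply/andP; split.
    rewrite /sqf part_gt0; apply/allP => p; rewrite mem_primes => /and3P[pp _ pe].
    rewrite eqn_leq -{1}(eqP (sn p (prn p pp (dvdn_trans pe en')))) dvdn_leq_log //=.
    by rewrite logn_gt0 mem_primes pp part_gt0.
  apply/allP => p; rewrite mem_primes => /and3P[pp _ pe].
  have /andP[-> _] := cn p (prn p pp (dvdn_trans pe en')).
  have /andP[_ /allP h] := part_pnat (negn ro) n.
  by rewrite ltnNge; apply: (h p); rewrite mem_primes pp part_gt0.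
by rewrite mulr1 lerDl; apply: sumr_ge0 => d _; rewrite mulr_ge0.
Qed.

Definition split_sum b z : R := \sum_(1 <= n < z.+1) (split_sqf b n)%:R / n%:R.

Lemma split_sum_ge0 b z : 0 <= split_sum b z.
Proof. by apply: sumr_ge0 => n _; rewrite divr_ge0. Qed.

(** Here the square root of the logarithm originates: up to convolution factors with bounded
    weighted sums, r is dominated by the split indicator convolved with itself, so the sum of r(n)/n
    is bounded by the square of [split_sum]. *)
Lemma sum_rchi_le_split_sum b : exists2 C : R, 0 < C &
  forall z, \sum_(1 <= n < z.+1) rchi chi n / n%:R <= C * split_sum b z ^+ 2.
Proof.
set K1 : R := (size (divisors N))%:R; set K2 : R := (size (divisors b`!))%:R.
have K1_ge0 : 0 <= K1 by []; have K2_ge0 : 0 <= K2 by [].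
exists (K1 * 2 * (2 * K2) ^+ 2 + 1); first by rewrite ltr_wpDl // !mulr_ge0 ?sqr_ge0.
move=> z; set S := split_sum b z; have S0 : 0 <= S := split_sum_ge0 b z.
have h1 : \sum_(1 <= n < z.+1) (isE n)%:R / n%:R <= K1 * 2.
  apply: le_trans (conv_bound (f := fun d => (d %| N)%:R) (g := fun d => (issq d)%:R) _ _ _) _ => //.
    move=> n n0 _; rewrite /isE; case: hasP => [[e eN /andP[en sq]]|_]; last by apply: sumr_ge0 => d _; rewrite mulr_ge0.
    rewrite -dvdn_divisors // in eN.
    rewrite (bigD1_seq e) ?divisors_uniq -?dvdn_divisors //= eN sq mulr1 lerDl.
    by apply: sumr_ge0 => d _; rewrite mulr_ge0.
  apply: ler_pM; [by apply: sumr_ge0 => d _; rewrite divr_ge0 .. | |].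
    exact: sum_divides.
  exact: sum_issq.
have h2 : \sum_(1 <= n < z.+1) (split_sqf 0 n)%:R / n%:R <= K2 * S.
  apply: le_trans (conv_bound (f := fun d => (d %| b`!)%:R) (g := fun d => (split_sqf b d)%:R) _ _ _) _ => //.
    by move=> n n0 _; apply: split_sqf_le_conv.
  by apply: ler_wpM2r => //; apply: sum_divides; apply: fact_gt0.
have h3 : \sum_(1 <= n < z.+1) F n / n%:R <= 2 * K2 * S.
  apply: le_trans (conv_bound (f := fun d => (split_sqf 0 d)%:R) (g := fun d => (issq d)%:R) _ _ _) _ => //.
    by move=> n n0 _; apply: split_le_conv.
  rewrite mulrC -mulrA; apply: ler_pM => //.
  - by apply: sumr_ge0 => d _; rewrite divr_ge0.
  - by apply: sumr_ge0 => d _; rewrite divr_ge0.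
  exact: sum_issq.
have F0 : 0 <= \sum_(1 <= n < z.+1) F n / n%:R by apply: sumr_ge0 => d _; rewrite divr_ge0.
have h4 : \sum_(1 <= n < z.+1) tauF n / n%:R <= (2 * K2 * S) ^+ 2.
  apply: le_trans (conv_bound (f := F) (g := F) _ _ _) _ => //; last by rewrite expr2; apply: ler_pM.
apply: le_trans (conv_bound (f := tauF) (g := fun d => (isE d)%:R) _ _ _) _.
- exact: tauF_ge0.
- by [].
- by move=> n n0 _; apply: rchi_le_conv.
apply: le_trans (_ : (2 * K2 * S) ^+ 2 * (K1 * 2) <= _).
  apply: ler_pM => //; apply: sumr_ge0 => d _; rewrite divr_ge0 //; exact: tauF_ge0.
rewrite exprMn mulrAC [_ * (K1 * 2)]mulrC; apply: ler_wpM2r; first exact: sqr_ge0.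
by rewrite lerDl.
Qed.

End SplitNumbers.

(** * Mertens estimates *)

Lemma prod_primes_dvd (r : seq nat) m : uniq r -> (forall p, p \in r -> prime p && (p %| m)%N) ->
  (\prod_(p <- r) p %| m)%N.
Proof.
elim: r => [|p r IH] /=; first by rewrite big_nil dvd1n.
move=> /andP[pr ur] h; have /andP[pp pm] := h p (mem_head _ _).
have hr q : q \in r -> prime q && (q %| m)%N by move=> qr; apply: h; rewrite inE qr orbT.
rewrite big_cons Gauss_dvd ?pm ?IH //.
rewrite prime_coprime // big_seq.
apply: (big_ind (fun a => ~~ (p %| a)%N)) => [|a b na nb|q qr].
- by rewrite dvdn1; case: eqP pp => // ->.
- by rewrite Euclid_dvdM // negb_or na.
have /andP[pq _] := hr q qr; rewrite dvdn_prime2 //.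
by apply: contraNneq pr => ->.
Qed.

Lemma middle_binomial_le k : ('C(k.*2.+1, k) <= 4 ^ k)%N.
Proof.
have sym : 'C(k.*2.+1, k.+1) = 'C(k.*2.+1, k).
  have kl : (k.+1 <= k.*2.+1)%N by rewrite ltnS -addnn leq_addr.
  by rewrite -(bin_sub kl) subSS -addnn addnK.
have : ('C(k.*2.+1, k) + 'C(k.*2.+1, k.+1) <= 2 ^ k.*2.+1)%N.
  have kb : (k.+1 < k.*2.+2)%N by rewrite !ltnS -addnn leq_addr.
  rewrite -[2%N]/(1 + 1)%N expnDn.
  under eq_bigr do rewrite !exp1n !muln1.
  rewrite (bigD1 (Ordinal (ltnW kb))) //= leq_add2l (bigD1 (Ordinal kb)) //= ?leq_addr //.
  by rewrite -val_eqE /= eqn_leq ltnn.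
by rewrite sym addnn expnS mul2n leq_double -mul2n expnM.
Qed.

(** Erdos' argument: for odd n = 2k + 1 the primes from k + 2 to n all divide the binomial
    coefficient C(2k+1, k) <= 4^k, and an even n > 2 is not prime. *)
Lemma primorial_le n : (\prod_(1 <= p < n.+1 | prime p) p <= 4 ^ n)%N.
Proof.
elim/ltn_ind: n => n IH.
have [|n3] := leqP n 2.
  by case: n {IH} => [|[|[|]]] // _; rewrite /index_iota /= ?big_cons big_nil.
have [on|en] := boolP (odd n); last first.
  case: n n3 en IH => // n n2 en IH.
  rewrite big_mkcond big_nat_recr //= -big_mkcond /= ifN ?muln1; last first.
    by apply: contra en => /even_prime[e|//]; rewrite e in n2.
  by apply: leq_trans (IH n _) _; rewrite ?leq_pexp2l.
pose k := n./2.
have en : n = k.*2.+1 by rewrite -(odd_double_half n) on.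
have k1 : (0 < k)%N by move: n3; rewrite en; case: (k).
have kn : (k.+1 < n)%N by rewrite en ltnS -addnn -[X in (X < _)%N]addn0 ltn_add2l.
rewrite (big_cat_nat (n := k.+2)) //=; last by rewrite ltnS ltnW.
have -> : (4 ^ n = 4 ^ k.+1 * 4 ^ k)%N by rewrite -expnD en -addnn addSn.
apply: leq_mul; first exact: IH.
apply: leq_trans (middle_binomial_le k); rewrite -en -big_filter; apply: dvdn_leq.
  by rewrite bin_gt0 en -addnn -addnS leq_addr.
apply: prod_primes_dvd => [|p]; first by rewrite filter_uniq ?iota_uniq.
rewrite mem_filter mem_index_iota => /and3P[pp kp pn]; rewrite pp /=.
have kln : (k <= n)%N by rewrite en -addnn -addnS leq_addr.
have := bin_fact kln; have : (p %| n`!)%N by rewrite dvdn_fact // prime_gt0.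
have -> : (n - k = k.+1)%N by rewrite en -addnn -addnS addKn.
have nd j : (j < p)%N -> ~~ (p %| j`!)%N.
  elim: j => [|j IHj] jp; first by rewrite fact0 dvdn1; case: eqP pp => // ->.
  by rewrite factS Euclid_dvdM // negb_or gtnNdvd // IHj // ltnW.
move=> pn' e; move: pn'; rewrite -e Euclid_dvdM // => /orP[//|]; rewrite Euclid_dvdM //.
by rewrite (negPf (nd _ (ltnW kp))) (negPf (nd _ kp)).
Qed.

Section Mertens.
Variables (R : realType) (lg : R -> R).
Hypothesis lgM : forall x y, 0 < x -> 0 < y -> lg (x * y) = lg x + lg y.
Hypothesis lg_le : forall x, 0 < x -> lg x <= x - 1.

Lemma theta_le x : \sum_(1 <= p < x.+1 | prime p) lg p%:R <= x%:R * lg 4%:R.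
Proof.
have E (r : seq nat) : all prime r ->
    (0 < \prod_(p <- r) p)%N /\ \sum_(p <- r) lg p%:R = lg (\prod_(p <- r) p)%:R.
  elim: r => [|p r IH] /=; first by rewrite !big_nil (lg1 lgM).
  move=> /andP[pp /IH[r0 ar]]; rewrite !big_cons muln_gt0 prime_gt0 //; split=> //.
  by rewrite ar natrM lgM ?ltr0n ?(prime_gt0 pp).
rewrite -big_filter; have [|p0 ->] := E [seq p <- index_iota 1 x.+1 | prime p].
  by apply/allP => p; rewrite mem_filter => /andP[].
rewrite -(lgX lgM) ?ltr0n // -natrX; apply: (ler_lg_nat lgM lg_le) => //.
by rewrite big_filter; apply: primorial_le.
Qed.

Lemma sum_le_nat l x : (l <= x)%N -> \sum_(1 <= k < x.+1) (k <= l)%N%:R = l%:R :> R.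
Proof.
move=> lx; rewrite (big_cat_nat (n := l.+1)) //= [X in _ + X]big_nat [X in _ + X]big1 ?addr0.
  rewrite big_nat (eq_bigr (fun _ => 1)) => [|k /andP[_]]; last by rewrite ltnS => ->.
  by rewrite -big_nat sumr_const_nat subn1.
by move=> k /andP[lk _]; rewrite leqNgt lk.
Qed.

(** Von Mangoldt's identity, with the ranges of p and j extended to a common x so that they can be
    exchanged with a sum over n. *)
Lemma lg_decomposition n x : (0 < n)%N -> (n <= x)%N ->
  lg n%:R = \sum_(1 <= p < x.+1 | prime p) \sum_(1 <= j < x.+1) (p ^ j %| n)%N%:R * lg p%:R.
Proof.
move=> n0 nx.
transitivity (\sum_(1 <= p < x.+1 | prime p) (logn p n)%:R * lg p%:R); last first.
  apply: eq_bigr => p pp; rewrite -mulr_suml; congr (_ * _).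
  rewrite (eq_bigr (fun j => (j <= logn p n)%N%:R)) ?sum_le_nat //; last first.
    by move=> j _; rewrite pfactor_dvdn.
  by apply: leq_trans nx; apply: ltnW; apply: ltn_logl.
move: n n0 nx; apply: pfactor_ind => [_|q j m pq j0 m0 nqm IH qmx].
  by rewrite (lg1 lgM) big1 // => p _; rewrite logn1 mul0r.
have qj0 : (0 < q ^ j)%N by rewrite expn_gt0 prime_gt0.
have qx : (q < x.+1)%N.
  rewrite ltnS; apply: leq_trans qmx; apply: leq_trans (leq_pmulr _ m0).
  by rewrite -{1}(expn1 q) leq_pexp2l ?(prime_gt0 pq).
rewrite natrM lgM ?ltr0n // IH ?(leq_trans _ qmx) ?leq_pmull //.
under [RHS]eq_bigr => p pp do rewrite lognM // natrD mulrDl lognX (logn_prime _ pq).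
rewrite big_split /=; congr (_ + _).
rewrite natrX (lgX lgM) ?ltr0n ?prime_gt0 //.
rewrite -big_filter (bigD1_seq q) ?mem_filter ?pq ?mem_index_iota ?prime_gt0 ?filter_uniq ?iota_uniq //=.
rewrite eqxx muln1 big1 ?addr0 // => p pq'.
by rewrite (negPf pq') muln0 mul0r.
Qed.

Lemma sum_lg_decomposition (f : nat -> R) x :
  \sum_(1 <= n < x.+1) f n * lg n%:R =
  \sum_(1 <= p < x.+1 | prime p) \sum_(1 <= j < x.+1)
     lg p%:R * \sum_(1 <= k < (x %/ p ^ j).+1) f (p ^ j * k)%N.
Proof.
transitivity (\sum_(1 <= n < x.+1) \sum_(1 <= p < x.+1 | prime p) \sum_(1 <= j < x.+1)
    (if (p ^ j %| n)%N then lg p%:R * f n else 0)).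
  rewrite !big_nat; apply: eq_bigr => n /andP[n0]; rewrite ltnS => nx.
  rewrite (lg_decomposition n0 nx) mulr_sumr; apply: eq_bigr => p _.
  rewrite mulr_sumr; apply: eq_bigr => j _.
  by case: (p ^ j %| n)%N; rewrite ?mul1r ?mul0r ?mulr0 // mulrC.
rewrite exchange_big /=; apply: eq_bigr => p pp.
rewrite exchange_big /=; apply: eq_bigr => j _.
rewrite -big_mkcond /= sum_dvd_reindex ?expn_gt0 ?prime_gt0 //.
by rewrite mulr_sumr.
Qed.

Lemma geometric_tail (q : R) x : 0 <= q -> q <= 2^-1 ->
  \sum_(2 <= j < x.+1) q ^+ j <= 2 * q ^+ 2.
Proof.
move=> q0 q2; suff h y : \sum_(2 <= j < y.+2) q ^+ j + 2 * q ^+ y.+2 <= 2 * q ^+ 2.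
  case: x => [|x]; first by rewrite big_geq // mulr_ge0 ?exprn_ge0.
  by apply: le_trans (h x); rewrite lerDl mulr_ge0 ?exprn_ge0.
elim: y => [|y IH]; first by rewrite big_geq // add0r.
rewrite big_nat_recr //= -addrA; apply: le_trans IH; rewrite lerD2l.
have := exprn_ge0 y.+2 q0; rewrite [q ^+ y.+3]exprS.
by move: (q ^+ y.+2) => e e0; nra.
Qed.

Lemma prime_powers_sum x :
  \sum_(1 <= p < x.+1 | prime p) \sum_(2 <= j < x.+1) lg p%:R * p%:R^-1 ^+ j <= 4.
Proof.
apply: le_trans (_ : \sum_(2 <= p < x.+1) 2 * (lg p%:R / p%:R ^+ 2) <= _); last first.
  by rewrite -mulr_sumr; have := sum_lg_over_sqr lgM lg_le x; lra.
have [->|x0] := posnP x; first by rewrite !big_geq.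
rewrite big_mkcond big_ltn //= add0r !big_nat; apply: ler_sum => p /andP[p2 _].
have l0 : 0 <= lg p%:R by apply: (lg_nat_ge0 lgM lg_le); apply: ltnW.
have pp0 : 0 < p%:R :> R by rewrite ltr0n ltnW.
case: ifP => pp; last by rewrite mulr_ge0 // divr_ge0 // exprn_ge0.
rewrite -mulr_sumr [leRHS]mulrCA -exprVn; apply: ler_wpM2l => //.
by apply: geometric_tail; rewrite ?invr_ge0 // lef_pV2 ?posrE // ler_nat.
Qed.

Definition mertens (f : nat -> R) x := \sum_(1 <= p < x.+1 | prime p) f p * (lg p%:R / p%:R).

Lemma sum_lg_prime_powers x : \sum_(1 <= n < x.+1) lg n%:R =
  \sum_(1 <= p < x.+1 | prime p) \sum_(1 <= j < x.+1) lg p%:R * (x %/ p ^ j)%:R.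
Proof.
rewrite -[LHS](eq_bigr _ (fun n _ => mul1r _)) (sum_lg_decomposition (fun _ => 1)).
by apply: eq_bigr => p _; apply: eq_bigr => j _; rewrite sumr_const_nat subn1.
Qed.

(** x/p is at most floor(x/p) + 1; the floors are bounded through the sum of lg n, and the ones
    through [theta_le]. *)
Lemma mertens_upper x : (0 < x)%N -> mertens (fun _ => 1) x <= lg x%:R + lg 4%:R.
Proof.
move=> x0; have x0' : 0 < x%:R :> R by rewrite ltr0n.
rewrite -(ler_pM2l x0') mulrDr.
apply: le_trans (lerD (sum_lg_le lgM lg_le x) (theta_le x)).
rewrite sum_lg_prime_powers -big_split /= /mertens mulr_sumr [leLHS]big_nat_cond [leRHS]big_nat_cond.
apply: ler_sum => p /andP[/andP[p0 px] pp]; rewrite mul1r.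
have l0 : 0 <= lg p%:R by apply: (lg_nat_ge0 lgM lg_le).
have p0' : 0 < p%:R :> R by rewrite ltr0n.
apply: le_trans (_ : lg p%:R * (x %/ p ^ 1)%:R + lg p%:R <= _); last first.
  rewrite lerD2r (big_ltn _) //= lerDl; apply: sumr_ge0 => j _; exact: mulr_ge0.
rewrite -[X in _ + X]mulr1 -mulrDr mulrCA; apply: ler_wpM2l => //.
rewrite ler_pdivrMr // natr1 -natrM ler_nat expn1; apply: ltnW; exact: ltn_ceil.
Qed.

(** The constant 5 is 1 from [sum_lg_ge] plus 4 from the prime powers with exponent at least 2. *)
Lemma mertens_lower x : (0 < x)%N -> lg x%:R - 5 <= mertens (fun _ => 1) x.
Proof.
move=> x0; have x0' : 0 < x%:R :> R by rewrite ltr0n.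
have h : x%:R * lg x%:R - x%:R <= x%:R * mertens (fun _ => 1) x + x%:R * 4.
  apply: le_trans (sum_lg_ge lgM lg_le x) _; rewrite sum_lg_prime_powers.
  apply: le_trans (lerD (lexx _) (ler_wpM2l (ltW x0') (prime_powers_sum x))).
  rewrite /mertens !mulr_sumr -big_split /= [leLHS]big_nat_cond [leRHS]big_nat_cond.
  apply: ler_sum => p /andP[/andP[p0 px] pp]; rewrite mul1r.
  have l0 : 0 <= lg p%:R by apply: (lg_nat_ge0 lgM lg_le).
  have p0' : 0 < p%:R :> R by rewrite ltr0n.
  have dj j : (x %/ p ^ j)%:R <= x%:R * p%:R^-1 ^+ j :> R.
    by rewrite exprVn ler_pdivlMr ?exprn_gt0 // -natrX -natrM ler_nat leq_divM.
  rewrite (big_ltn _) //= mulrCA; apply: lerD; first by apply: ler_wpM2l => //; apply: dj.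
  by rewrite mulr_sumr; apply: ler_sum => j _; rewrite mulrCA; apply: ler_wpM2l.
rewrite -(ler_pM2l x0'); move: h; move: (mertens _ x) => S; lra.
Qed.

End Mertens.

(** * Split primes in windows, and products with one large split prime *)

Lemma ler_sum_subset (R : realType) (T : eqType) (r1 r2 : seq T) (w : T -> R) :
  uniq r1 -> uniq r2 -> {subset r1 <= r2} -> (forall i, i \in r2 -> 0 <= w i) ->
  \sum_(i <- r1) w i <= \sum_(i <- r2) w i.
Proof.
move=> u1 u2 sub w0.
have -> : \sum_(i <- r1) w i = \sum_(i <- [seq i <- r2 | i \in r1]) w i.
  apply: perm_big; apply: uniq_perm; rewrite ?filter_uniq // => i.
  by rewrite mem_filter; have [/sub ->|] := boolP (i \in r1).
rewrite big_filter big_mkcond big_seq [leRHS]big_seq; apply: ler_sum => i /w0 wi.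
by case: ifP.
Qed.

Lemma split_primesM (m p w : nat) (m' p' : nat) :
  prime p -> prime p' -> (m <= w < p)%N -> (m' <= w < p')%N -> (0 < m)%N -> (0 < m')%N ->
  (m * p = m' * p')%N -> m = m' /\ p = p'.
Proof.
move=> pp pp' /andP[mw wp] /andP[mw' wp'] m0 m0' e.
have pE : p = p'.
  have : (p %| m' * p')%N by rewrite -e dvdn_mull.
  rewrite Euclid_dvdM // => /orP[|]; last by rewrite dvdn_prime2 // => /eqP.
  move=> /(dvdn_leq m0').
  by rewrite leqNgt (leq_ltn_trans mw' wp).
split=> //; move: e; rewrite -pE => /eqP; rewrite eqn_pmul2r ?prime_gt0 // => /eqP //.
Qed.

Section SplitPrimes.
Variables (R : realType) (lg : R -> R).
Hypothesis lgM : forall x y, 0 < x -> 0 < y -> lg (x * y) = lg x + lg y.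
Hypothesis lg_le : forall x, 0 < x -> lg x <= x - 1.
Variables (chi : nat -> R) (N : nat).
Hypotheses (N_gt0 : (0 < N)%N) (chi1 : chi 1 = 1).
Hypothesis chiM : forall m n, chi (m * n)%N = chi m * chi n.
Hypothesis chi_val : forall n, [\/ chi n = 0, chi n = 1 | chi n = -1].
Hypothesis chi_per : forall n, chi (n + N)%N = chi n.
Hypothesis chi_sum0 : \sum_(0 <= i < N) chi i = 0.
Hypothesis chi_zero : forall p, prime p -> chi p = 0 -> (p %| N)%N.

Let lg_ge0' n : (0 < n)%N -> 0 <= lg n%:R := lg_nat_ge0 lgM lg_le (n := n).

(** Abel summation starts at n = 4, from where [lg_over_id_decr] makes lg n/n decrease; the first
    three terms are bounded separately. *)
Lemma sum_chi_lg_bounded : exists C, forall x,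
  `|\sum_(1 <= n < x.+1) (chi n / n%:R) * lg n%:R| <= C.
Proof.
pose b n := lg n%:R / n%:R; have b0 n : (0 < n)%N -> 0 <= b n.
  by move=> n0; rewrite divr_ge0 // lg_ge0'.
have E n : chi n / n%:R * lg n%:R = chi n * b n by rewrite /b; ring.
have small x : (x <= 3)%N -> `|\sum_(1 <= n < x.+1) chi n / n%:R * lg n%:R| <= \sum_(1 <= n < 4) b n.
  move=> x3; apply: le_trans (ler_norm_sum _ _ _) _.
  apply: le_trans (_ : \sum_(1 <= n < x.+1) b n <= _).
    rewrite !big_nat; apply: ler_sum => n /andP[n0 _].
    rewrite E normrM (ger0_norm (b0 n n0)) ler_piMl ?b0 //; exact: chi_norm_le1.
  rewrite [leRHS](big_cat_nat (n := x.+1)) //= lerDl big_nat; apply: sumr_ge0 => n /andP[xn _].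
  by apply: b0; apply: leq_trans xn.
exists (\sum_(1 <= n < 4) b n + N%:R * b 4) => x.
have b4 : 0 <= N%:R * b 4 by rewrite mulr_ge0 // b0.
have [x3|x4] := leqP x 3.
  by apply: le_trans (small x x3) _; rewrite lerDl.
rewrite (big_cat_nat (n := 4)) //=; last by apply: leqW.
apply: le_trans (ler_normD _ _) _; apply: lerD; first exact: (small 3).
under eq_bigr do rewrite E.
apply: abel_bound; first exact: leqW.
- by move=> k _; apply: (chi_partial_sum N_gt0).
- by move=> n n4; apply: lg_over_id_decr.
- by move=> n n4; apply: b0; apply: leq_trans n4.
Qed.

Lemma harmonic_ge_lg z : lg z.+1%:R <= \sum_(1 <= n < z.+1) n%:R^-1.
Proof.
elim: z => [|z IH]; first by rewrite (lg1 lgM) big_geq.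
rewrite big_nat_recr //=; apply: le_trans (lerD IH (lexx _)).
by rewrite -lerBlDl; apply: (lgS_diff lgM lg_le).
Qed.

Section AtL.
Variable L : R.
Hypothesis LP : forall x, `|Lsum chi x - L| <= N%:R / x.+1%:R.

Lemma Lsum_bounded x : `|Lsum chi x| <= `|L| + N%:R.
Proof.
rewrite -[Lsum chi x](subrK L) addrC; apply: le_trans (ler_normD _ _) _; rewrite lerD2l.
apply: le_trans (LP x) _; rewrite ler_pdivrMr ?ltr0n // ler_peMr // ler1n.
exact: isT.
Qed.

(** Writing lg n over prime powers turns the bounded sum of chi(n) lg n/n into L times the Mertens
    sum of chi, up to T1 (replacing Lsum (x/p) by L) and T2 (exponents j >= 2), both bounded. L <> 0
    allows the division. *)
Lemma mertens_chi_bounded : exists C, forall x, `|mertens lg chi x| <= C.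
Proof.
have L0 := L_neq0 N_gt0 chi1 chiM chi_val chi_per chi_sum0 LP.
have nL : 0 < `|L| by rewrite normr_gt0; apply/eqP.
have [C HC] := sum_chi_lg_bounded.
exists ((C + N%:R * lg 4%:R + (`|L| + N%:R) * 4) / `|L|) => x.
rewrite ler_pdivlMr // -normrM.
set T := \sum_(1 <= n < x.+1) (chi n / n%:R) * lg n%:R.
pose T1 := \sum_(1 <= p < x.+1 | prime p) chi p * (lg p%:R / p%:R) * (Lsum chi (x %/ p) - L).
pose T2 := \sum_(1 <= p < x.+1 | prime p) \sum_(2 <= j < x.+1)
  lg p%:R * p%:R^-1 ^+ j * (chi p ^+ j * Lsum chi (x %/ p ^ j)).
have eT : mertens lg chi x * L = T - T1 - T2.
  rewrite /T (sum_lg_decomposition lgM) /T1 /T2 /mertens mulr_suml -!sumrB /=.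
  rewrite big_nat_cond [RHS]big_nat_cond; apply: eq_bigr => p /andP[/andP[p0 px] pp].
  have -> : \sum_(1 <= j < x.+1) lg p%:R * \sum_(1 <= k < (x %/ p ^ j).+1)
      chi (p ^ j * k)%N / (p ^ j * k)%:R
    = \sum_(1 <= j < x.+1) lg p%:R * p%:R^-1 ^+ j * (chi p ^+ j * Lsum chi (x %/ p ^ j)).
    apply: eq_bigr => j _; rewrite -mulrA; congr (_ * _).
    rewrite mulrA /Lsum mulr_sumr; apply: eq_bigr => k _.
    by rewrite chiM (chiX chi1 chiM) natrM natrX invfM exprVn; ring.
  rewrite [X in X - _ - _](big_ltn _) //=; last by apply: leq_ltn_trans px.
  by rewrite !expr1 expn1; ring.
have h1 : `|T1| <= N%:R * lg 4%:R.
  have [x0|x0] := posnP x.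
    by rewrite /T1 x0 big_geq // normr0 mulr_ge0 // lg_ge0'.
  have x0' : 0 < x%:R :> R by rewrite ltr0n.
  apply: le_trans (ler_norm_sum _ _ _) _.
  apply: le_trans (_ : \sum_(1 <= p < x.+1 | prime p) N%:R / x%:R * lg p%:R <= _); last first.
    rewrite -mulr_sumr -mulrA; apply: ler_wpM2l => //.
    by rewrite mulrC ler_pdivrMr // mulrC; apply: theta_le.
  rewrite [leLHS]big_nat_cond [leRHS]big_nat_cond; apply: ler_sum => p /andP[/andP[p0 px] pp].
  have p0' : 0 < p%:R :> R by rewrite ltr0n.
  have lp := lg_ge0' p0.
  have e0 : 0 <= lg p%:R / p%:R by rewrite divr_ge0.
  rewrite 2!normrM (ger0_norm e0).
  have hc := chi_norm_le1 chi_val p.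
  have hL : `|Lsum chi (x %/ p) - L| <= N%:R * p%:R / x%:R.
    apply: le_trans (LP _) _; rewrite ler_pdivrMr ?ltr0n // mulrAC ler_pdivlMr // -!mulrA.
    by apply: ler_wpM2l => //; rewrite -natrM ler_nat mulnC; apply: ltnW; apply: ltn_ceil.
  apply: le_trans (_ : 1 * (lg p%:R / p%:R) * (N%:R * p%:R / x%:R) <= _).
    apply: ler_pM => //; first by rewrite mulr_ge0 //.
    by apply: ler_wpM2r.
  by rewrite le_eqVlt; apply/orP; left; apply/eqP; field; rewrite !gt_eqF.
have h2 : `|T2| <= (`|L| + N%:R) * 4.
  have B0 : 0 <= `|L| + N%:R by rewrite addr_ge0.
  apply: le_trans (ler_wpM2l B0 (prime_powers_sum lgM lg_le x)).
  rewrite mulr_sumr; apply: le_trans (ler_norm_sum _ _ _) _.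
  rewrite [leLHS]big_nat_cond [leRHS]big_nat_cond; apply: ler_sum => p /andP[/andP[p0 px] pp].
  rewrite mulr_sumr; apply: le_trans (ler_norm_sum _ _ _) _; apply: ler_sum => j _.
  have e0 : 0 <= lg p%:R * p%:R^-1 ^+ j by rewrite mulr_ge0 ?exprn_ge0 ?invr_ge0 ?lg_ge0'.
  rewrite normrM (ger0_norm e0) mulrC; apply: ler_wpM2r => //.
  rewrite normrM -[leRHS]mul1r; apply: ler_pM => //; last exact: Lsum_bounded.
  by rewrite normrX exprn_ile1 //; apply: chi_norm_le1.
rewrite eT; apply: le_trans (ler_normB _ _) _; apply: lerD => //.
apply: le_trans (ler_normB _ _) _; apply: lerD => //; exact: HC.
Qed.

(** If L were negative, L times the divergent harmonic sum would pull the nonnegative sum of r(n)/n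
    below 0, by [sum_rchi_over_id]. *)
Lemma L_gt0 : 0 < L.
Proof.
have L0 := L_neq0 N_gt0 chi1 chiM chi_val chi_per chi_sum0 LP.
rewrite lt_neqAle eq_sym; apply/andP; split; first exact/eqP.
rewrite leNgt; apply/negP => Ln.
have [n nP] := exists_nat_ge ((N%:R + 1) / - L * 2).
have r0 : 0 <= \sum_(1 <= k < (2 ^ n).+1) rchi chi k / k%:R.
  rewrite big_nat; apply: sumr_ge0 => k /andP[k0 _]; rewrite divr_ge0 //.
  exact: (rchi_ge0 chi1 chiM chi_val).
have h := sum_rchi_over_id LP (2 ^ n).
have H : n%:R / 2 <= \sum_(1 <= k < (2 ^ n).+1) k%:R^-1 :> R.
  apply: le_trans (harmonic_ge_lg _).
  apply: le_trans (ler_lg_nat lgM lg_le (_ : 0 < 2 ^ n)%N (leqnSn _)); last by rewrite expn_gt0.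
  by rewrite natrX (lgX lgM) //; apply: ler_wpM2l => //; apply: (lg2_ge lgM lg_le).
have h2 := ler_wnM2l (ltW Ln) H.
move: h; rewrite ler_norml => /andP[_ h].
have h3 : N%:R + 1 <= - L * (n%:R / 2).
  have nL : 0 < - L by rewrite oppr_gt0.
  move: nP; rewrite mulrAC ler_pdivrMr //; lra.
move: r0 h h2 h3; rewrite mulNr; lra.
Qed.

(* Both sums over p <= x differ from lg x by a bounded amount, so a window
   (y, K y] with K large contains split primes of total weight at least 1. *)
Lemma split_window : exists K : nat, forall y : nat, (0 < y)%N ->
  1 <= \sum_(y.+1 <= p < (K * y).+1 | prime p && (chi p == 1)) lg p%:R / p%:R.
Proof.
have [C HC] := mertens_chi_bounded.
have C0 : 0 <= C by apply: le_trans (HC 0%N).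
pose C1 := lg N%:R + lg 4%:R.
(* lg 2 >= 1/2, hence the factor 2. Inside are twice the desired weight 1, the Mertens errors 5 and
   lg 4, twice the bound C for the character sum, and C1 for the primes with chi p = 0. *)
have [n nP] := exists_nat_ge (2 * (2 + 5 + lg 4%:R + 2 * C + C1)).
exists (2 ^ n)%N => y y0.
set x := (2 ^ n * y)%N.
have p2 : (0 < 2 ^ n)%N by rewrite expn_gt0.
have yx : (y <= x)%N by rewrite /x leq_pmull.
have x0 : (0 < x)%N := leq_trans y0 yx.
have lx : lg x%:R = n%:R * lg 2 + lg y%:R.
  by rewrite /x natrM lgM ?ltr0n // natrX (lgX lgM).
pose w p : R := lg p%:R / p%:R.
have w0 p : (0 < p)%N -> 0 <= w p by move=> p0; rewrite divr_ge0 // lg_ge0'.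
have diff f : mertens lg f x - mertens lg f y = \sum_(y.+1 <= p < x.+1 | prime p) f p * w p.
  by rewrite /mertens (big_cat_nat (n := y.+1)) //= addrAC subrr add0r.
have e1 : n%:R * lg 2 - 5 - lg 4%:R <= \sum_(y.+1 <= p < x.+1 | prime p) 1 * w p.
  rewrite -(diff (fun _ => 1)).
  have := mertens_lower lgM lg_le x0; have := mertens_upper lgM lg_le y0; rewrite lx; lra.
have e2 : - (2 * C) <= \sum_(y.+1 <= p < x.+1 | prime p) chi p * w p.
  rewrite -diff; have := HC x; have := HC y; rewrite !ler_norml => /andP[_ hy] /andP[hx _].
  by move: hx hy; move: (mertens _ _ _) (mertens _ _ _) => u v; lra.
have e3 : \sum_(y.+1 <= p < x.+1 | prime p && (chi p == 0)) w p <= C1.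
  apply: le_trans (_ : mertens lg (fun _ => 1) N <= _); last exact: mertens_upper.
  rewrite /mertens; under [leRHS]eq_bigr do rewrite mul1r.
  rewrite -[leLHS]big_filter -[leRHS]big_filter.
  apply: ler_sum_subset; rewrite ?filter_uniq ?iota_uniq // => p.
    rewrite !mem_filter !mem_index_iota => /andP[/andP[pp /eqP cp] /andP[yp _]].
    by rewrite pp prime_gt0 //= ltnS dvdn_leq // chi_zero.
  by rewrite mem_filter mem_index_iota => /and3P[_ p0 _]; apply: w0.
(* Twice the indicator of chi p = 1 is 1 + chi p minus the indicator of chi p = 0. *)
have e4 : 2 * \sum_(y.+1 <= p < x.+1 | prime p && (chi p == 1)) w p =
   \sum_(y.+1 <= p < x.+1 | prime p) 1 * w p + \sum_(y.+1 <= p < x.+1 | prime p) chi p * w p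
   - \sum_(y.+1 <= p < x.+1 | prime p && (chi p == 0)) w p.
  rewrite -big_split /= ![\sum_(_ <= _ < _ | prime _ && _) _]big_mkcondr /= mulr_sumr -sumrB.
  have m1 : (-1 == 1 :> R) = false by apply: lt_eqF; lra.
  have m0 : (-1 == 0 :> R) = false by rewrite oppr_eq0 oner_eq0.
  have o0 : (0 == 1 :> R) = false by rewrite eq_sym oner_eq0.
  by apply: eq_bigr => p _; case: (chi_val p) => ->; rewrite ?eqxx ?oner_eq0 ?o0 ?m1 ?m0; ring.
have l2 := lg2_ge lgM lg_le.
move: e1 e2 e3 e4 nP; move: (\sum_(_ <= _ < _ | _) _) (\sum_(_ <= _ < _ | _) _) (\sum_(_ <= _ < _ | _) _) (\sum_(_ <= _ < _ | _) _) => A B E S.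
have : n%:R * 2^-1 <= n%:R * lg 2 by apply: ler_wpM2l.
lra.
Qed.

(* One large prime p from the window is multiplied to each split squarefree m <= w:
   p > w makes the products squarefree and the map (m, p) -> m p injective. *)
Lemma split_count b : exists c : R, 0 < c /\ exists X0 : nat, forall X : nat, (X0 <= X)%N ->
  exists s : seq nat, [/\ uniq s, forall n, n \in s -> split_sqf chi b n && (n <= X)%N &
    c * X%:R <= (size s)%:R * Num.sqrt (lg X%:R)].
Proof.
have [C C0 HC] := sum_rchi_le_split_sum N_gt0 chi1 chiM chi_val chi_zero b.
have [K HK] := split_window.
have K0 : (0 < K)%N by have := HK 1%N isT; case: (K) => // h; move: h; rewrite big_geq // ler10.
have K0' : 0 < K%:R :> R by rewrite ltr0n.
have L0 := L_gt0.
pose c0 := Num.sqrt (L / (4 * C)).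
have c00 : 0 < c0 by rewrite sqrtr_gt0 divr_gt0 // mulr_gt0.
exists (c0 / (2 * K%:R)); split; first by rewrite divr_gt0 // mulr_gt0.
have lK : 0 <= lg K%:R by apply: lg_ge0'.
(* X is taken so large that lg X absorbs the error N of [sum_rchi_over_id] and the loss lg K in
   passing from X to w, leaving L/4 of the main term. *)
have [k kP] := exists_nat_ge (2 * (1 + (4 / L) * (L / 2 * lg K%:R + N%:R))).
exists (maxn (2 ^ k) (K * b.+1 ^ 2)) => X; rewrite geq_max => /andP[kX bX].
have X0 : (0 < X)%N by apply: leq_trans kX; rewrite expn_gt0.
have X0' : 0 < X%:R :> R by rewrite ltr0n.
have lX : 1 + (4 / L) * (L / 2 * lg K%:R + N%:R) <= lg X%:R.
  apply: le_trans (ler_lg_nat lgM lg_le (_ : 0 < 2 ^ k)%N kX); last by rewrite expn_gt0.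
  rewrite natrX (lgX lgM) //; apply: le_trans (_ : k%:R * 2^-1 <= _); first by move: kP; lra.
  by apply: ler_wpM2l => //; apply: (lg2_ge lgM lg_le).
have lX1 : 0 < lg X%:R.
  apply: lt_le_trans lX; apply: ltr_wpDr => //.
  apply: mulr_ge0; first by rewrite divr_ge0 // ltW.
  by apply: addr_ge0 => //; apply: mulr_ge0 => //; rewrite divr_ge0 // ltW.
(* w is about sqrt(X/K): for m <= w the window starting at y m = X/(K m) lies above w, and up to its
   end K * y m one still has m p <= X. *)
have [w [w1 w2]] : exists w, (K * w ^ 2 <= X)%N /\ (X < K * w.+1 ^ 2)%N.
  have ex : exists w, (K * w ^ 2 <= X)%N by exists 0%N; rewrite muln0.
  have bd r : (K * r ^ 2 <= X)%N -> (r <= X)%N.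
    move=> le; apply: leq_trans le; apply: leq_trans (leq_pmull _ K0).
    by case: r => // r; rewrite -mulnn leq_pmulr.
  exists (ex_maxn ex bd); case: ex_maxnP => r hr hm; split=> //.
  by rewrite ltnNge; apply/negP => /hm; rewrite ltnn.
have bw : (b < w)%N.
  have : (K * b.+1 ^ 2 < K * w.+1 ^ 2)%N by apply: leq_ltn_trans w2.
  by rewrite ltn_pmul2l // ltn_exp2r // ltnS.
pose y m := (X %/ (K * m))%N.
have yw m : (0 < m)%N -> (m <= w)%N -> (w <= y m)%N.
  move=> m0 mw; rewrite leq_divRL ?muln_gt0 ?K0 //; apply: leq_trans w1.
  by rewrite mulnCA leq_mul2l -mulnn leq_mul2l mw !orbT.
have yX m : (m * (K * y m) <= X)%N.
  by rewrite mulnCA mulnA mulnC; apply: leq_divM.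
pose ms := [seq m <- index_iota 1 w.+1 | split_sqf chi b m].
pose W m := [seq p <- index_iota (y m).+1 (K * y m).+1 | prime p && (chi p == 1)].
pose ps := [seq (m, p) | m <- ms, p <- W m].
have psP m p : (m, p) \in ps -> [/\ split_sqf chi b m, (0 < m)%N, (m <= w)%N & 
    [/\ prime p, chi p == 1, (w < p)%N & (p <= K * y m)%N]].
  move=> /allpairsPdep[m' [p' [mm pW [-> ->]]]].
  move: mm pW; rewrite !mem_filter !mem_index_iota !ltnS => /and3P[sm m0 mw] /andP[/andP[pp cp] /andP[yp pK]].
  by split=> //; split=> //; apply: leq_ltn_trans yp; apply: yw.
exists [seq (mp.1 * mp.2)%N | mp <- ps]; split.
- rewrite map_inj_in_uniq => [|[m p] [m' p'] /psP[_ m0 mw [pp _ wp _]] /psP[_ m0' mw' [pp' _ wp' _]] /= e].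
    apply: allpairs_uniq_dep; first by rewrite filter_uniq ?iota_uniq.
      by move=> m _; rewrite filter_uniq ?iota_uniq.
    by move=> [m p] [m' p'] _ _ /= [-> ->].
  by have [-> ->] := split_primesM pp pp' (introT andP (conj mw wp)) (introT andP (conj mw' wp')) m0 m0' e.
- move=> n /mapP[[m p] /psP[/andP[sm /allP cm] m0 mw [pp cp wp pK]] ->] /=.
  apply/andP; split; last by apply: leq_trans (yX m); rewrite leq_mul2l pK orbT.
  have npm : ~~ (p %| m)%N by rewrite gtnNdvd // (leq_ltn_trans mw).
  have cpm : coprime m p by rewrite coprime_sym prime_coprime.
  have sp : sqf p.
    apply/sqfP; split; first exact: prime_gt0.
    move=> r pr; apply/negP => rp; have : (r %| p)%N by apply: dvdn_trans rp; rewrite -mulnn dvdn_mulr.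
    rewrite dvdn_prime2 // => /eqP er; move: rp; rewrite er => /(dvdn_leq (prime_gt0 pp)).
    by rewrite -mulnn leqNgt ltn_Pmulr ?prime_gt1 // prime_gt0.
  rewrite /split_sqf sqfM //=; apply/allP => r; rewrite mem_primes => /and3P[pr _].
  rewrite Euclid_dvdM // => /orP[rm|]; first by apply: cm; rewrite mem_primes pr m0.
  by rewrite dvdn_prime2 // => /eqP ->; rewrite cp (ltn_trans bw).
rewrite size_map size_allpairs_dep sumnE big_map natr_sum.
(* A prime of the window weighs at most lg X / y m and the total weight is at least 1, so the window
   holds at least y m / lg X primes. *)
have hW m : m \in ms -> X%:R / (2 * K%:R) / m%:R <= (size (W m))%:R * lg X%:R.
  rewrite mem_filter mem_index_iota ltnS => /and3P[_ m0 mw].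
  have y0 : (0 < y m)%N by apply: leq_trans (yw m m0 mw); apply: leq_ltn_trans bw.
  have y0' : 0 < (y m)%:R :> R by rewrite ltr0n.
  have h1 : (y m)%:R <= (size (W m))%:R * lg X%:R.
    rewrite -[leLHS]mul1r -ler_pdivlMr //; apply: le_trans (HK (y m) y0) _.
    rewrite -big_filter -/(W m) big_seq.
    apply: le_trans (_ : \sum_(p <- W m | p \in W m) lg X%:R / (y m)%:R <= _).
      apply: ler_sum => p; rewrite mem_filter mem_index_iota ltnS => /andP[/andP[pp _] /andP[yp pK]].
      have p0 := prime_gt0 pp.
      apply: ler_pM; rewrite ?invr_ge0 ?lg_ge0' //.
        apply: (ler_lg_nat lgM lg_le) => //; apply: leq_trans (yX m); apply: leq_trans pK _.
        by rewrite leq_pmull.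
      by rewrite lef_pV2 ?posrE ?ltr0n // ler_nat ltnW.
    by rewrite -big_seq big_const_seq count_predT iter_addr addr0 -mulrA mulr_natl.
  apply: le_trans h1.
  have m0' : 0 < m%:R :> R by rewrite ltr0n.
  rewrite ler_pdivrMr // ler_pdivrMr ?mulr_gt0 // -!natrM ler_nat.
  have hc : (X < (y m).+1 * (K * m))%N by apply: ltn_ceil; rewrite muln_gt0 K0.
  apply: ltnW; apply: leq_trans hc _.
  have -> : (y m * m * (2 * K) = (2 * y m) * (K * m))%N by ring.
  by rewrite leq_mul2r mul2n -addnn -addn1 leq_add2l y0 orbT.
have hS : X%:R / (2 * K%:R) * split_sum chi b w <= (\sum_(m <- ms) (size (W m))%:R) * lg X%:R.
  rewrite /split_sum mulr_sumr mulr_suml /ms big_filter [leRHS]big_mkcond big_seq [leRHS]big_seq.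
  apply: ler_sum => m mi; case: ifP => sm; last by rewrite mul0r mulr0.
  by rewrite mul1r; apply: hW; rewrite mem_filter sm.
have S0 := split_sum_ge0 chi b w.
(* C times the squared sum bounds the sum of r(n)/n, which is at least L lg (w + 1) - N, while lg X
   <= lg K + 2 lg (w + 1). *)
have hS2 : c0 * Num.sqrt (lg X%:R) <= split_sum chi b w.
  have cc : 0 <= L / (4 * C) by apply/ltW/divr_gt0 => //; apply: mulr_gt0.
  rewrite /c0 -(sqrtrM _ cc) -[X in _ <= X](ger0_norm S0) -sqrtr_sqr; apply: ler_wsqrtr.
  have h1 := HC w; have h2 := sum_rchi_over_id LP w; have h3 := harmonic_ge_lg w.
  have h4 : lg X%:R <= lg K%:R + 2 * lg w.+1%:R.
    have := ler_lg_nat lgM lg_le X0 (ltnW w2).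
    by rewrite natrM lgM ?ltr0n ?expn_gt0 // natrX (lgX lgM).
  move: h2; rewrite ler_norml => /andP[h2 _].
  have h5 := ler_wpM2l (ltW L0) h3.
  have h6 := ler_wpM2l (ltW L0) h4.
  have h7 : L / 2 * lg K%:R + N%:R <= L / 4 * lg X%:R.
    have h : (4 / L) * (L / 2 * lg K%:R + N%:R) <= lg X%:R by move: lX; lra.
    have L4 : 0 <= L / 4 by apply/ltW/divr_gt0.
    have := ler_wpM2l L4 h.
    by rewrite mulrA (_ : L / 4 * (4 / L) = 1) ?mul1r //; field; rewrite gt_eqF.
  rewrite mulrAC ler_pdivrMr ?mulr_gt0 //.
  move: h1 h2 h5 h6 h7; move: (split_sum _ _ _ ^+ 2) (\sum_(_ <= _ < _) _) (\sum_(_ <= _ < _) _) => S r H; lra.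
have sl0 : 0 < Num.sqrt (lg X%:R) by rewrite sqrtr_gt0.
rewrite -(ler_pM2r sl0) -[X in _ <= X]mulrA -expr2 (sqr_sqrtr (ltW lX1)).
apply: le_trans hS.
apply: le_trans (ler_wpM2l _ hS2); last by apply: divr_ge0 => //; apply: mulr_ge0.
by rewrite le_eqVlt; apply/orP; left; apply/eqP; field; rewrite gt_eqF.
Qed.

End AtL.

End SplitPrimes.

(** * Quadratic Gauss sums *)

Section QuadraticCharacter.
Variable l : nat.
Hypotheses (pl : prime l) (l2 : (2 < l)%N).
Local Notation K := 'F_l.
Local Notation h := (l.-1./2).

Definition qc (a : K) : int := if a == 0 then 0 else if a ^+ h == 1 then 1 else -1.

Let l_odd : odd l.
Proof. by have [e|//] := even_prime pl; move: l2; rewrite e. Qed.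

Let pred_l : l.-1 = h.*2.
Proof.
have e := odd_double_half l; rewrite l_odd add1n in e.
by rewrite -e /= doubleK.
Qed.

Lemma Fp_expf_pred (a : K) : a != 0 -> a ^+ l.-1 = 1.
Proof.
move=> a0; apply: (mulfI a0); rewrite -exprS prednK ?prime_gt0 // mulr1.
by have := expf_card a; rewrite card_Fp.
Qed.

Lemma qc_half (a : K) : a != 0 -> a ^+ h = (qc a)%:~R.
Proof.
move=> a0; rewrite /qc (negPf a0); case: eqP => // /eqP ne.
have : (a ^+ h) ^+ 2 == 1 by rewrite -exprM muln2 -pred_l Fp_expf_pred.
by rewrite sqrf_eq1 (negPf ne) => /eqP ->.
Qed.

Lemma qc0 : qc 0 = 0. Proof. by rewrite /qc eqxx. Qed.

Lemma qc_val (a : K) : a != 0 -> qc a = 1 \/ qc a = -1.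
Proof. by move=> a0; rewrite /qc (negPf a0); case: ifP; [left|right]. Qed.

Lemma qc_sqr (a : K) : a != 0 -> qc a ^+ 2 = 1.
Proof. by move=> /qc_val[] ->; rewrite ?expr1n // sqrrN expr1n. Qed.

Let charK : l \in [pchar K]. Proof. exact: pchar_Fp. Qed.

Lemma Fp_sign_inj (u v : int) : u = 1 \/ u = -1 -> v = 1 \/ v = -1 ->
  (u%:~R : K) = v%:~R -> u = v.
Proof.
have two0 : (2%:R : K) != 0.
  by rewrite -(dvdn_pcharf charK) gtnNdvd.
have ne : (1 : K) != -1 by rewrite -addr_eq0 -[1 + 1]/(2%:R).
by move=> [] -> [] -> // /eqP; rewrite ?rmorphN /= ?(negPf ne) // eq_sym (negPf ne).
Qed.

Lemma qcM (a b : K) : qc (a * b) = qc a * qc b.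
Proof.
have [->|a0] := eqVneq a 0; first by rewrite mul0r qc0 mul0r.
have [->|b0] := eqVneq b 0; first by rewrite mulr0 qc0 mulr0.
have ab0 : a * b != 0 by rewrite mulf_neq0.
apply: Fp_sign_inj; first exact: qc_val.
  by case: (qc_val a0) => ->; case: (qc_val b0) => ->; [left|right|right|left].
by rewrite rmorphM /= -!qc_half // exprMn.
Qed.

Lemma qc1 : qc 1 = 1. Proof. by rewrite /qc oner_eq0 expr1n eqxx. Qed.

(** Otherwise all l - 1 = 2h nonzero elements would be roots of X^h - 1. *)
Lemma qc_nonresidue : exists2 c : K, c != 0 & qc c = -1.
Proof.
have [/existsP[c /andP[c0 /eqP qcc]]|] := boolP [exists c : K, (c != 0) && (qc c == -1)].
  by exists c.
rewrite negb_exists => /forallP none.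
have h0 : (0 < h)%N by rewrite -double_gt0 -pred_l -subn1 subn_gt0 prime_gt1.
have q0 : ('X^h - 1 : {poly K}) != 0 by rewrite -size_poly_gt0 size_XnsubC.
have rts : all (root ('X^h - 1 : {poly K})) (enum (predC1 (0 : K))).
  apply/allP => a; rewrite mem_enum => a0; rewrite rootE !hornerE.
  rewrite qc_half //; have [->|e] := qc_val a0; first by rewrite subrr.
  by have := none a; rewrite (a0 : a != 0) e.
have := max_poly_roots q0 rts (enum_uniq _).
rewrite size_XnsubC // -cardE cardC1 card_Fp // pred_l ltnS -addnn.
by move: (h) h0 => n; lia.
Qed.

Lemma sum_qc : \sum_a qc a = 0.
Proof.
have [c c0 qcc] := qc_nonresidue.
have e : \sum_a qc a = - \sum_a qc a.
  rewrite {1}(reindex_inj (mulfI c0)) /= -sumrN; apply: eq_bigr => a _.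
  by rewrite qcM qcc mulN1r.
by move: e; move: (\sum_a _) => S; lia.
Qed.

(** qc (-1) = (-1)^h with l = 2h + 1, so qc (-1) times l is the prime discriminant attached to l. *)
Lemma qc_opp1_mod4 : (4 %| (l%:Z * qc (-1) - 1)%R)%Z.
Proof.
have n1 : (-1 : K) != 0 by rewrite oppr_eq0 oner_eq0.
have e : qc (-1) = (-1) ^+ h.
  apply: Fp_sign_inj; first exact: qc_val.
    by rewrite -signr_odd; case: (odd h); [right|left].
  by rewrite -qc_half // rmorphXn rmorphN.
have el : l = h.*2.+1 by rewrite -pred_l prednK // prime_gt0.
rewrite e -signr_odd; move: el; rewrite -{1}(odd_double_half h); case: (odd h) => /= el;
 rewrite ?expr0 ?expr1; lia.
Qed.

Section GaussSum.
Variables (F : finFieldType) (p : nat) (zeta : F).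
Hypotheses (pF : p \in [pchar F]) (pz : l.-primitive_root zeta).

Let z (a : K) : F := zeta ^+ a.

Let zD (a b : K) : z (a + b) = z a * z b.
Proof.
rewrite /z -exprD -[RHS](prim_expr_mod pz).
exact: (congr1 (fun m => zeta ^+ ((a + b)%N %% m)%N) (Fp_cast pl)).
Qed.

Let z0 : z 0 = 1. Proof. exact: expr0. Qed.

Let zn (a : K) n : z a ^+ n = z (n%:R * a).
Proof.
elim: n => [|n IH]; first by rewrite mul0r z0.
by rewrite exprSr IH -zD -natr1 mulrDl mul1r.
Qed.

Let sum_z (e : K) : \sum_a z (a * e) = if e == 0 then l%:R else 0.
Proof.
case: eqP => [->|/eqP e0].
  under eq_bigr do rewrite mulr0 z0.
  by rewrite sumr_const card_Fp.
rewrite -(reindex_inj (mulIf e0) (P := predT) (F := z)) /=.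
have : z 1 * (\sum_a z a) = \sum_a z a.
  rewrite [RHS](reindex_inj (addrI (1 : K))) mulr_sumr /=.
  by apply: eq_bigr => a _; rewrite zD.
move/eqP; rewrite -subr_eq0 -[X in _ - X]mul1r -mulrBl mulf_eq0 => /orP[|/eqP //].
rewrite subr_eq0 /z /= Fp_cast // modn_small ?prime_gt1 // -(prim_order_dvd pz).
by rewrite dvdn1 => /eqP l1; move: l2; rewrite l1.
Qed.

Definition qgauss : F := \sum_a (qc a)%:~R * z a.

(** Substituting a c for the second index leaves qc c times the sum of z (a (1 + c)) over a <> 0.
    Completed by a = 0 this vanishes unless c = -1, where it is l; the correction adds up to the sum
    of qc, which is 0. *)
Lemma qgauss_sqr : qgauss ^+ 2 = (qc (-1) * l%:Z)%:~R.
Proof.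
rewrite expr2 {1}/qgauss mulr_suml (bigD1 0) //= qc0 !mul0r add0r.
transitivity (\sum_(a | a != 0) \sum_c ((qc c)%:~R * z (a * (1 + c)))).
  apply: eq_bigr => a a0; rewrite /qgauss (reindex_inj (mulfI a0)) mulr_sumr /=.
  apply: eq_bigr => c _; rewrite qcM mulrDr mulr1 zD mulrACA -rmorphM /=.
  by rewrite (mulrA (qc a)) -expr2 qc_sqr // mul1r.
have e (c : K) : \sum_(a | a != 0) ((qc c)%:~R * z (a * (1 + c))) =
   (qc c)%:~R * (if c == -1 then l%:R else 0) - (qc c)%:~R.
  rewrite -mulr_sumr -addr_eq0 [c + 1]addrC -sum_z [X in _ = _ * X - _](bigD1 0) //=.
  by rewrite mul0r z0; ring.
rewrite exchange_big /=; under eq_bigr do rewrite e.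
rewrite big_split /= sumrN -rmorph_sum /= sum_qc subr0 (bigD1 (-1)) //= eqxx big1 ?addr0.
  by rewrite rmorphM.
by move=> c /negPf ->; rewrite mulr0.
Qed.

Lemma qgauss_Frobenius : (p%:R : K) != 0 -> qgauss ^+ p = (qc p%:R)%:~R * qgauss.
Proof.
move=> p0; rewrite -pFrobenius_autE rmorph_sum /= [in RHS]/qgauss.
rewrite [in RHS](reindex_inj (mulfI p0)) mulr_sumr /=; apply: eq_bigr => a _.
rewrite rmorphM /= rmorph_int pFrobenius_autE zn mulrA -rmorphM /= qcM.
by rewrite (mulrA (qc _)) -expr2 qc_sqr // mul1r.
Qed.

End GaussSum.

End QuadraticCharacter.

(** * Quadratic characters realised by square roots in finite fields *)

Section QuadraticGaussData.
Variable M : nat.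

(** A real character chi modulo M tied to an integer c: in a finite field of characteristic p prime
    to M with a primitive M-th root of unity, c has a square root that Frobenius multiplies by chi
    p. This expresses that chi belongs to Q(sqrt c) in a form stable under products. *)
Record gauss_datum (chi : nat -> int) (c : int) : Prop := GaussDatum {
  gd1 : chi 1%N = 1;
  gdM : forall m n, chi (m * n)%N = chi m * chi n;
  gd_val : forall n, [\/ chi n = 0, chi n = 1 | chi n = -1];
  gd_per : forall n, chi (n + M)%N = chi n;
  gd_zero : forall p, prime p -> chi p = 0 -> (p %| M)%N;
  gd_root : forall (F : finFieldType) (p : nat) (zeta : F),
    p \in [pchar F] -> ~~ (p %| M)%N -> M.-primitive_root zeta ->
    exists2 g : F, g ^+ 2 = c%:~R & g ^+ p = (chi p)%:~R * g }.

Lemma gauss_datum1 : gauss_datum (fun=> 1) 1.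
Proof.
split=> //; first by constructor 2.
by move=> F p zeta _ _ _; exists 1; rewrite ?expr1n ?mulr1.
Qed.

Lemma gauss_datum_mul chi1 c1 chi2 c2 : gauss_datum chi1 c1 -> gauss_datum chi2 c2 ->
  gauss_datum (fun n => chi1 n * chi2 n) (c1 * c2).
Proof.
move=> d1 d2; split.
- by rewrite (gd1 d1) (gd1 d2).
- by move=> m n; rewrite (gdM d1) (gdM d2) mulrACA.
- move=> n; case: (gd_val d1 n) => ->; case: (gd_val d2 n) => ->;
    by [constructor 1|constructor 2|constructor 3].
- by move=> n; rewrite (gd_per d1) (gd_per d2).
- move=> p pp /eqP; rewrite mulf_eq0 => /orP[] /eqP; first exact: gd_zero d1 p pp.
  exact: gd_zero d2 p pp.
move=> F p zeta pF pM pz.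
have [g1 s1 f1] := gd_root d1 pF pM pz; have [g2 s2 f2] := gd_root d2 pF pM pz.
exists (g1 * g2); first by rewrite exprMn s1 s2 rmorphM.
by rewrite exprMn f1 f2 rmorphM /= mulrACA.
Qed.

Definition leg l n : int := qc (n%:R : 'F_l).

Lemma gauss_datum_leg l : prime l -> (2 < l)%N -> (l %| M)%N ->
  gauss_datum (leg l) (qc (-1 : 'F_l) * l%:Z).
Proof.
move=> pl l2 lM.
have charl : l \in [pchar 'F_l] by exact: pchar_Fp.
split.
- exact: qc1.
- by move=> m n; rewrite /leg natrM qcM.
- move=> n; have [e|n0] := eqVneq (n%:R : 'F_l) 0.
    by constructor 1; rewrite /leg e qc0.
  by have [] := qc_val n0; [constructor 2|constructor 3].
- move=> n; rewrite /leg natrD; have /eqP -> : (M%:R : 'F_l) == 0; last by rewrite addr0.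
  by rewrite -(dvdn_pcharf charl).
- move=> p pp lp; have [e|n0] := eqVneq (p%:R : 'F_l) 0; last first.
    by move: lp; rewrite /leg; have [] := qc_val n0 => ->.
  move/eqP: e; rewrite -(dvdn_pcharf charl) dvdn_prime2 // => /eqP <- //.
move=> F p zeta pF pM pz.
have pz' := dvdn_prim_root pz lM.
exists (qgauss l (zeta ^+ (M %/ l))); first by rewrite qgauss_sqr.
rewrite (qgauss_Frobenius pl l2 pF pz') //.
rewrite -(dvdn_pcharf charl); apply: contra pM => lp.
have pp : prime p by case/andP: pF.
by move: lp; rewrite dvdn_prime2 // => /eqP <-.
Qed.

(** The field of order p^(totient M) contains a primitive M-th root of unity by Euler's theorem, and
    there the root g of c satisfies g^p = g. The solutions of X^p = X are the images of 0, ..., p -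
    1, so g comes from an integer. *)
Lemma gauss_datum_root chi c p : (0 < M)%N -> gauss_datum chi c -> prime p -> ~~ (p %| M)%N -> chi p = 1 ->
  exists h : nat, (p%:Z %| h%:Z ^+ 2 - c)%Z.
Proof.
move=> M0 d pp pM c1.
have copM : coprime p M by rewrite prime_coprime.
have tM : (0 < totient M)%N by rewrite totient_gt0.
have [F pF cardF] := pPrimePowerField pp tM.
have q1 : (1 < #|F|)%N by rewrite cardF -(exp1n (totient M)) ltn_exp2r ?prime_gt1.
have q0 : (0 < #|F|.-1)%N by rewrite -subn1 subn_gt0.
have dM : (M %| #|F|.-1)%N.
  rewrite -subn1 -eqn_mod_dvd ?(ltnW q1) //; apply/eqP.
  by rewrite cardF; exact: Euler_exp_totient.
have : has (#|F|.-1).-primitive_root (enum (predC1 (0 : F))).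
  apply: has_prim_root => //; last by rewrite -cardE cardC1.
    apply/allP => a; rewrite mem_enum => a0; apply/unity_rootP.
    apply: (mulfI (a0 : a != 0)); rewrite -exprS prednK ?(ltnW q1) // mulr1.
    exact: expf_card.
  exact: enum_uniq.
case/hasP => w _ pw.
have [g g2 gp] := gd_root d pF pM (dvdn_prim_root pw dM).
rewrite c1 mul1r in gp.
pose P : {poly F} := 'X^p - 'X.
have szP : size P = p.+1.
  by rewrite /P size_polyDl ?size_polyXn // size_polyN size_polyX ltnS prime_gt1.
pose rs := [seq n%:R : F | n <- iota 0 p].
have urs : uniq rs.
  rewrite map_inj_in_uniq ?iota_uniq // => i j.
  rewrite !mem_iota /= add0n => ip jp.
  wlog ij : i j ip jp / (i <= j)%N.
    by move=> H e; case/orP: (leq_total i j) => /H; [apply=> //|move=> /(_ jp ip) h; rewrite h].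
  move=> e; apply/eqP; rewrite eqn_leq ij /= -subn_eq0.
  have : (p %| j - i)%N by rewrite (dvdn_pcharf pF) natrB // e subrr.
  by move=> /dvdn_leq; case: (j - i)%N (leq_subr i j) => // k kj /(_ isT); move: jp; lia.
have : g \in rs.
  apply/negPn/negP => gn.
  have P0 : P != 0 by rewrite -size_poly_gt0 szP.
  have rts : all (root P) (g :: rs).
    apply/allP => a; rewrite inE rootE /P !hornerE => /orP[/eqP ->|/mapP[n _ ->]].
      by rewrite gp subrr.
    by rewrite -pFrobenius_autE rmorph_nat subrr.
  have := max_poly_roots P0 rts; rewrite /= gn urs szP size_map size_iota.
  by move/(_ isT); rewrite ltnn.
case/mapP => n _ gE; exists n.
by rewrite (dvdz_pcharf pF) rmorphB rmorphXn /= -pmulrn -gE g2 subrr.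
Qed.

(* The characters of conductor 8 of Q(sqrt 2) and Q(sqrt -2). *)
Definition chi8 n : int := nth 0 [:: 0; 1; 0; -1; 0; -1; 0; 1] (n %% 8).
Definition chi8' n : int := nth 0 [:: 0; 1; 0; 1; 0; -1; 0; -1] (n %% 8).

Lemma prim8_4 (F : fieldType) (z : F) : 8.-primitive_root z -> z ^+ 4 = -1.
Proof.
move=> z8; have : (z ^+ 4) ^+ 2 == 1 by rewrite -exprM (prim_expr_order z8).
rewrite sqrf_eq1 -(prim_order_dvd z8) /= => /eqP //.
Qed.

Lemma odd_mod8 p : odd p -> [\/ p %% 8 = 1, p %% 8 = 3, p %% 8 = 5 | p %% 8 = 7]%N.
Proof.
move=> op; have : (p %% 8 < 8)%N by rewrite ltn_mod.
have : odd (p %% 8) by rewrite (@odd_mod p 8).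
by move: (p %% 8)%N => [|[|[|[|[|[|[|[|]]]]]]]] // _ _; [constructor 1|constructor 2|constructor 3|constructor 4].
Qed.

Hypothesis M8 : (8 %| M)%N.

Let datum8 (chi : nat -> int) (c : int) :
  chi 1%N = 1 ->
  (forall m n, chi (m * n)%N = chi m * chi n) ->
  (forall n, [\/ chi n = 0, chi n = 1 | chi n = -1]) ->
  (forall n, chi n = chi (n %% 8)%N) ->
  (forall n, odd n -> chi n != 0) ->
  (forall (F : finFieldType) (p : nat) (z : F),
    p \in [pchar F] -> odd p -> z ^+ 4 = -1 -> z ^+ p = z ^+ (p %% 8) ->
    exists2 g : F, g ^+ 2 = c%:~R & g ^+ p = (chi p)%:~R * g) ->
  gauss_datum chi c.
Proof.
move=> c1 cM cv cmod codd croot; split=> //.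
- by move=> n; rewrite cmod [RHS]cmod -modnDmr (eqP M8) addn0.
- move=> p pp c0; have [->|op] := even_prime pp; first exact: dvdn_trans M8.
  by have := codd p op; rewrite c0 eqxx.
move=> F p zeta pF pM pz; have z8 := dvdn_prim_root pz M8.
have pp : prime p by case/andP: pF.
have op : odd p.
  by have [e|//] := even_prime pp; move: pM; rewrite e (dvdn_trans _ M8).
by apply: croot pF op (prim8_4 z8) _; rewrite (prim_expr_mod z8).
Qed.

Lemma gauss_datum8 : gauss_datum chi8 2.
Proof.
apply: datum8 => //.
- move=> m n; rewrite /chi8 -modnMm; have: (m %% 8 < 8)%N by rewrite ltn_mod.
  have: (n %% 8 < 8)%N by rewrite ltn_mod.
  by move: (n %% 8)%N (m %% 8)%N => [|[|[|[|[|[|[|[|?]]]]]]]] [|[|[|[|[|[|[|[|?]]]]]]]].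
- move=> n; rewrite /chi8; have: (n %% 8 < 8)%N by rewrite ltn_mod.
  by move: (n %% 8)%N => [|[|[|[|[|[|[|[|?]]]]]]]] // _; by [constructor 1|constructor 2|constructor 3].
- by move=> n; rewrite /chi8 modn_mod.
- by move=> n /odd_mod8; rewrite /chi8; case=> ->.
(* z^7 is the inverse of z, so the witness is z + 1/z, a square root of 2; Frobenius changes its
   sign for p = 3, 5 modulo 8. *)
move=> F p z pF op z4 zp; exists (z + z ^+ 7).
  have -> : (z + z ^+ 7) ^+ 2 = z ^+ 2 + 2 * (z ^+ 4) ^+ 2 + (z ^+ 4) ^+ 3 * z ^+ 2 by ring.
  by rewrite z4 sqrrN expr1n -signr_odd /= expr1 mulN1r mulr1 addrAC subrr add0r.
rewrite -pFrobenius_autE rmorphD rmorphXn /= pFrobenius_autE zp /chi8.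
have z7 : z ^+ 7 = - z ^+ 3 by rewrite (exprD z 4 3) z4 mulN1r.
case: (odd_mod8 op) => -> /=; rewrite ?mulrN1z ?mulr1z.
- by rewrite mul1r.
- rewrite (_ : (z ^+ 3) ^+ 7 = (z ^+ 4) ^+ 5 * z); last by ring.
  by rewrite z7 z4; ring.
- rewrite (_ : (z ^+ 5) ^+ 7 = (z ^+ 4) ^+ 8 * z ^+ 3); last by ring.
  by rewrite (exprD z 4 1) z7 z4; ring.
- rewrite (_ : (z ^+ 7) ^+ 7 = (z ^+ 4) ^+ 12 * z); last by ring.
  by rewrite z7 z4; ring.
Qed.

Lemma gauss_datum8' : gauss_datum chi8' (-2).
Proof.
apply: datum8 => //.
- move=> m n; rewrite /chi8' -modnMm; have: (m %% 8 < 8)%N by rewrite ltn_mod.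
  have: (n %% 8 < 8)%N by rewrite ltn_mod.
  by move: (n %% 8)%N (m %% 8)%N => [|[|[|[|[|[|[|[|?]]]]]]]] [|[|[|[|[|[|[|[|?]]]]]]]].
- move=> n; rewrite /chi8'; have: (n %% 8 < 8)%N by rewrite ltn_mod.
  by move: (n %% 8)%N => [|[|[|[|[|[|[|[|?]]]]]]]] // _; by [constructor 1|constructor 2|constructor 3].
- by move=> n; rewrite /chi8' modn_mod.
- by move=> n /odd_mod8; rewrite /chi8'; case=> ->.
(* z + z^3 is a square root of -2, fixed by Frobenius for p = 1, 3 modulo 8. *)
move=> F p z pF op z4 zp; exists (z + z ^+ 3).
  have -> : (z + z ^+ 3) ^+ 2 = z ^+ 2 + 2 * z ^+ 4 + z ^+ 4 * z ^+ 2 by ring.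
  by rewrite z4; ring.
rewrite -pFrobenius_autE rmorphD rmorphXn /= pFrobenius_autE zp /chi8'.
case: (odd_mod8 op) => -> /=; rewrite ?mulrN1z ?mulr1z.
- by rewrite mul1r.
- rewrite (_ : (z ^+ 3) ^+ 3 = (z ^+ 4) ^+ 2 * z); last by ring.
  by rewrite z4; ring.
- rewrite (_ : (z ^+ 5) ^+ 3 = (z ^+ 4) ^+ 3 * z ^+ 3); last by ring.
  by rewrite (exprD z 4 1) z4; ring.
- rewrite (_ : (z ^+ 7) ^+ 3 = (z ^+ 4) ^+ 5 * z); last by ring.
  by rewrite (exprD z 4 3) z4; ring.
Qed.

Lemma gauss_datum_prod (s : seq nat) (sgn := \prod_(l <- s) qc (-1 : 'F_l)) :
  all (fun l => [&& prime l, 2 < l & l %| M]%N) s ->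
  gauss_datum (fun n => \prod_(l <- s) leg l n) (sgn * (\prod_(l <- s) l)%N%:Z).
Proof.
rewrite {}/sgn; elim: s => [_|l s IH /= /andP[/and3P[pl l2 lM] /IH d]].
  have -> : (fun n => \prod_(l <- [::]) leg l n) = (fun=> 1); last by rewrite !big_nil; exact: gauss_datum1.
  by apply: boolp.funext => n; rewrite big_nil.
have -> : (fun n => \prod_(i <- l :: s) leg i n) = (fun n => leg l n * \prod_(i <- s) leg i n).
  by apply: boolp.funext => n; rewrite big_cons.
rewrite !big_cons PoszM mulrACA; exact: gauss_datum_mul (gauss_datum_leg pl l2 lM) d.
Qed.

End QuadraticGaussData.

(** The value at M - 1 makes chi odd, and i -> M - i then turns the sum into its opposite. *)
Lemma gauss_datum_sum0 M chi c : (0 < M)%N -> gauss_datum M chi c -> chi M.-1 = -1 ->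
  \sum_(0 <= i < M) chi i = 0.
Proof.
move=> M0 d cM.
have perk n k : chi (n + k * M)%N = chi n.
  by elim: k => [|k IH]; rewrite ?addn0 // mulSn [(M + _)%N]addnC addnA (gd_per d).
have neg i : (0 < i <= M)%N -> chi (M - i)%N = - chi i.
  move=> /andP[i0 iM]; rewrite -mulN1r -cM -(gdM d).
  (* (M - 1) i exceeds M - i by i - 1 full periods. *)
  rewrite -(perk (M - i)%N i.-1); congr chi.
  case: M M0 i i0 iM {d cM perk} => // M _ [//|i] _ iM /=.
  by rewrite subSS !mulnS; move: iM; clear; nia.
have c0 : chi 0%N = 0.
  by have := gdM d 0 M.-1; rewrite mul0n cM mulrN1; lia.
rewrite big_ltn // c0 add0r.
have e : \sum_(1 <= i < M) chi i = - \sum_(1 <= i < M) chi i.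
  rewrite {1}big_nat_rev -sumrN big_nat_cond [RHS]big_nat_cond; apply: eq_bigr => i.
  rewrite andbT => /andP[i1 iM]; rewrite add1n subSS neg // i1 ltnW //.
by move: e; move: (\sum_(_ <= _ < _) _) => S; lia.
Qed.

Lemma sqf_prod_primes n : sqf n -> (\prod_(p <- primes n) p)%N = n.
Proof.
case/andP=> n0 /allP sn; rewrite [RHS](prod_prime_decomp n0) prime_decompE big_map /=.
by rewrite big_seq [RHS]big_seq; apply: eq_bigr => p /sn /eqP ->; rewrite expn1.
Qed.

Lemma prod_qc_opp1 (s : seq nat) (sgn := \prod_(l <- s) qc (-1 : 'F_l)) :
  all (fun l => prime l && (2 < l)%N) s ->
  (sgn = 1 \/ sgn = -1) /\ (4 %| (sgn * (\prod_(l <- s) l)%N%:Z - 1)%R)%Z.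
Proof.
rewrite {}/sgn; elim: s => [_|l s IH /= /andP[/andP[pl l2] /IH]].
  by rewrite !big_nil; split; [left|].
rewrite !big_cons PoszM => -[h1 h2]; have h3 := qc_opp1_mod4 pl l2.
have n1 : (-1 : 'F_l) != 0 by rewrite oppr_eq0 oner_eq0.
have h4 := qc_val n1.
split; first by case: h1 => ->; case: h4 => ->; [left|right|right|left].
move: h1 h4 h2 h3; move: (\prod_(_ <- _) _) (qc _) (Posz (\prod_(_ <- _) _)) => a b c.
by move=> [] -> [] -> /dvdzP[u hu] /dvdzP[v hv]; apply/dvdzP;
 exists (4 * u * v + u + v); nia.
Qed.

(** The prime discriminants of the odd primes of d multiply to plus or minus their product,
    whichever is 1 modulo 4. For odd d = 3 modulo 4 this is already -d; for d = 2n it is n or -n,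
    and the character of -2 or of 2 supplies the missing factor. *)
Lemma odd_gauss_datum (d : nat) : sqf d -> (1 < d)%N -> (~~ (2 %| d) -> 4 %| d - 3)%N ->
  exists2 chi, gauss_datum (8 * d) chi (- d%:Z) & chi (8 * d).-1 = -1.
Proof.
move=> sd d1 d3; have d0 : (0 < d)%N by exact: ltnW.
have prods n (s := primes n) (sgn := \prod_(l <- s) qc (-1 : 'F_l)) : sqf n -> odd n -> (n %| d)%N ->
    [/\ gauss_datum (8 * d) (fun k => \prod_(l <- s) leg l k) (sgn * n%:Z),
        \prod_(l <- s) leg l (8 * d).-1 = sgn, sgn = 1 \/ sgn = -1 & (4 %| (sgn * n%:Z - 1)%R)%Z].
  move=> sn on nd.
  have hs : all (fun l => [&& prime l, 2 < l & l %| 8 * d]%N) s.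
    apply/allP => l; rewrite mem_primes => /and3P[pl _ ln].
    rewrite pl /= dvdn_mull ?(dvdn_trans ln) // andbT.
    by rewrite ltn_neqAle prime_gt1 // andbT; apply/eqP => l2; move: on ln; rewrite -l2 dvdn2 => ->.
  have hs' : all (fun l => prime l && (2 < l)%N) s.
    by apply: sub_all hs => l /and3P[-> ->].
  have := gauss_datum_prod hs; have := prod_qc_opp1 hs'; rewrite (sqf_prod_primes sn).
  move=> [h1 h2] h3; split=> //.
  rewrite /sgn big_seq [RHS]big_seq; apply: eq_bigr => l /(allP hs) /and3P[pl _ lM].
  rewrite /leg; congr qc; apply/eqP; rewrite -addr_eq0 natr1 prednK ?muln_gt0 //.
  by rewrite -(dvdn_pcharf (pchar_Fp pl)).
have e7 : ((8 * d).-1 %% 8 = 7)%N by move: d0; clear; lia.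
have M8 : (8 %| 8 * d)%N by rewrite dvdn_mulr.
have [d2|d2] := boolP (2 %| d)%N; last first.
  have [] := prods d sd _ (dvdnn d); first by rewrite dvdn2 negbK in d2.
  move: (\prod_(l <- primes d) qc _) => sgn g cM [] e h; rewrite e in g cM h.
    by have := d3 d2; lia.
  by exists (fun k => \prod_(l <- primes d) leg l k); last exact: cM; rewrite -mulN1r.
have [n en] := dvdnP d2; rewrite mulnC in en.
have n0 : (0 < n)%N by move: d0; rewrite en; case: (n).
have on : odd n.
  apply/negPn/negP; rewrite -dvdn2 => n2.
  have /sqfP[_ /(_ 2 isT)/negP[]] := sd.
  by rewrite en expnS dvdn_pmul2l.
have sn : sqf n.
  apply/sqfP; split=> // p pp; have /sqfP[_ /(_ p pp)] := sd; apply: contra => h.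
  by rewrite en dvdn_mull.
have nd : (n %| d)%N by rewrite en dvdn_mull.
have [] := prods n sn on nd.
move: (\prod_(l <- primes n) qc _) => sgn g cM [] e h; rewrite e in g cM h.
  exists (fun k => chi8' k * \prod_(l <- primes n) leg l k).
    rewrite (_ : - d%:Z = -2 * (1 * n%:Z)); last by rewrite en; lia.
    exact: gauss_datum_mul (gauss_datum8' M8) g.
  by rewrite cM /chi8' e7.
exists (fun k => chi8 k * \prod_(l <- primes n) leg l k).
  rewrite (_ : - d%:Z = 2 * (-1 * n%:Z)); last by rewrite en; lia.
  exact: gauss_datum_mul (gauss_datum8 M8) g.
by rewrite cM /chi8 e7.
Qed.

(** * Counting *)

Lemma counted_lower_bound (R : realType) (lg : R -> R)
    (lgM : forall x y, 0 < x -> 0 < y -> lg (x * y) = lg x + lg y)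
    (lg_le : forall x, 0 < x -> lg x <= x - 1) (D : int) :
  good D -> sgnz D = - eps D ->
  exists c : R, 0 < c /\ exists X0 : nat, forall X : nat, (X0 <= X)%N ->
    exists s : seq int, [/\ uniq s, forall q, q \in s -> (`|q| <= X)%N /\ counted D q &
      c * X%:R <= (size s)%:R * Num.sqrt (lg X%:R)].
Proof.
move=> gD sD; have [eD s2 d1 d3] := abs_sign_cond gD sD.
have sqD := sqf_of_squarefree (proj1 gD).
set d := `|D|%N in eD d1 d3 sqD *.
have d0 : (0 < d)%N by exact: ltnW.
have d3' : (~~ (2 %| d) -> 4 %| d - 3)%N.
  move=> d2; move: d3; rewrite (_ : (2 %| D)%Z = false).
    by rewrite /d; move: d1; clear; lia.
  by apply/negbTE; move: d2; rewrite /d; clear; lia.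
have [chi gd cM] := odd_gauss_datum sqD d1 d3'.
have M0 : (0 < 8 * d)%N by rewrite muln_gt0.
have csum := gauss_datum_sum0 M0 gd cM.
pose n0 := ((if (2 %| D)%Z then 1 else 4) + d)%N.
have n00 : (0 < n0)%N by rewrite /n0; case: ifP.
(* A prime above B divides neither the period 8 d nor 2 d n0. *)
pose B := (8 * d * n0)%N.
pose P p := (chi p == 1) && (B < p)%N.
have Pres p : prime p -> P p -> exists h, (p %| h ^ 2 + d)%N.
  move=> pp /andP[/eqP c1 Bp].
  have pM : ~~ (p %| 8 * d)%N.
    rewrite gtnNdvd //; apply: leq_ltn_trans Bp; exact: leq_pmulr.
  have [h hp] := gauss_datum_root M0 gd pp pM c1.
  by exists h; move: hp; rewrite opprK -rmorphXn.
have Pcop p : prime p -> P p -> ~~ (p %| 2 * d * n0)%N.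
  move=> pp /andP[_ Bp]; rewrite gtnNdvd //.
    by rewrite !muln_gt0 d0 n00.
  by apply: leq_ltn_trans Bp; rewrite /B -!mulnA leq_mul2r orbT.
have [b [C [C0 HC]]] := pigeonhole_counted gD sD Pres Pcop.
pose chiR n : R := (chi n)%:~R.
have chi1 : chiR 1%N = 1 by rewrite /chiR (gd1 gd).
have chiM m n : chiR (m * n)%N = chiR m * chiR n by rewrite /chiR (gdM gd) rmorphM.
have chi_val n : [\/ chiR n = 0, chiR n = 1 | chiR n = -1].
  by rewrite /chiR; case: (gd_val gd n) => ->; [constructor 1|constructor 2|constructor 3].
have chi_per n : chiR (n + 8 * d)%N = chiR n by rewrite /chiR (gd_per gd).
have chi_sum0 : \sum_(0 <= i < 8 * d) chiR i = 0 by rewrite -rmorph_sum /= csum.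
have chi_zero p : prime p -> chiR p = 0 -> (p %| 8 * d)%N.
  by move=> pp /eqP; rewrite intr_eq0 => /eqP; exact: (gd_zero gd pp).
have [L LP] := Lsum_limit M0 chi_val chi_per chi_sum0.
have [c [c0 [X0 HX]]] := split_count lgM lg_le M0 chi1 chiM chi_val chi_per chi_sum0 chi_zero LP (B + b).
have CR : 0 < C%:R :> R by rewrite ltr0n.
exists (c / (2 * C%:R ^+ 2)); split; first by rewrite divr_gt0 // mulr_gt0 // exprn_gt0.
exists (C * X0.+1)%N => X XX.
(* The integers produced from numbers up to Y are bounded by C Y <= X, and X <= 2 C Y, so the
   rescaling loses only a constant factor. *)
pose Y := (X %/ C)%N.
have Y1 : (X0 < Y)%N by rewrite leq_divRL // mulnC.
have YX : (C * Y <= X)%N by rewrite mulnC leq_divM.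
have XY : (X <= 2 * (C * Y))%N.
  have := ltn_ceil X C0; rewrite -/Y mulSn mulnC.
  have : (C <= C * Y)%N by rewrite leq_pmulr // (leq_ltn_trans _ Y1).
  by move: (C * Y)%N => u; lia.
have [s [us hs szs]] := HX Y (ltnW Y1).
have [] := HC s Y us.
  move=> n /hs /andP[/andP[-> /allP h] ->]; split=> //; apply/allP => p /h /andP[cp Bp].
  rewrite /P (leq_ltn_trans (leq_addr _ _) Bp) (leq_ltn_trans (leq_addl _ _) Bp) !andbT.
  by rewrite -(eqr_int R).
move=> s' [us' hs' szs']; exists s'; split=> //.
  by move=> q /hs' [h1 h2]; split=> //; exact: leq_trans h2 YX.
have lYX : Num.sqrt (lg Y%:R) <= Num.sqrt (lg X%:R).
  apply: ler_wsqrtr; apply: (ler_lg_nat lgM lg_le); first exact: leq_ltn_trans Y1.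
  by apply: leq_trans YX; rewrite leq_pmull.
have h1 : (size s)%:R * Num.sqrt (lg Y%:R) <= C%:R * ((size s')%:R * Num.sqrt (lg X%:R)).
  by rewrite mulrA -natrM; apply: ler_pM => //; [exact: sqrtr_ge0|rewrite ler_nat].
have h2 : X%:R <= 2 * C%:R * Y%:R :> R by rewrite -!natrM ler_nat -mulnA.
rewrite mulrAC ler_pdivrMr ?mulr_gt0 ?exprn_gt0 //.
apply: le_trans (ler_wpM2l (ltW c0) h2) _.
have h3 := ler_wpM2l (ltW (mulr_gt0 (ltr0n R 2) CR)) (le_trans szs h1).
by move: h3; rewrite expr2; move: (_ * Num.sqrt _) => u; lra.
Qed.

Lemma nprimes_gt0 (D : int) : good D -> sgnz D = - eps D -> (0 < nprimes D)%N.
Proof.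
move=> gD sD; have [_ _ D1 _] := abs_sign_cond gD sD.
have := pdiv_prime (D1 : (1 < `|D|)%N); rewrite /nprimes => pp.
have : pdiv `|D| \in primes `|D|.
  by rewrite mem_primes pp pdiv_dvd andbT /= (ltnW (D1 : (1 < `|D|)%N)).
by case: (primes _).
Qed.

(** * Passage to the real logarithm *)

Lemma RlnM (x y : Rdefinitions.R) : 0 < x -> 0 < y ->
  Rpower.ln (x * y) = Rpower.ln x + Rpower.ln y.
Proof. by move=> /RltP x0 /RltP y0; exact: Rpower.ln_mult. Qed.

Lemma Rln_le_subr1 (x : Rdefinitions.R) : 0 < x -> Rpower.ln x <= x - 1.
Proof.
move=> x0; rewrite lerBrDl; apply/RleP.
by have := Rpower.exp_ineq1_le (Rpower.ln x); rewrite Rpower.exp_ln //; apply/RltP.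
Qed.

From Stdlib Require Import Reals.

Local Close Scope ring_scope.

Lemma ln_nat_ge1 (n : nat) : (3 <= n)%N -> (1 <= ln (INR n))%R.
Proof.
move=> n3; have := le_INR 3 n (elimT ssrnat.leP n3); rewrite [INR 3]INR_IZR_INZ /= => n3R.
have n0 : (0 < INR n)%R by Lra.lra.
apply: Rnot_lt_le => /exp_increasing; rewrite exp_ln //.
by have := exp_le_3; Lra.lra.
Qed.

(** The exponent is smallest, namely 1/2, at r = 1, and powers of a base at least 1 increase with
    the exponent. *)
Lemma sqrt_le_Rpower (x : R) (r : nat) : (1 <= x)%R -> (0 < r)%N ->
  (sqrt x <= Rpower x (1 - / 2 ^ r))%R.
Proof.
move=> x1 r0; rewrite -Rpower_sqrt; last exact: Rlt_le_trans Rlt_0_1 x1.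
apply: Rle_Rpower => //.
have h : (/ 2 ^ r <= / 2)%R.
  apply: Rinv_le_contravar; first exact: Rlt_0_2.
  by rewrite -{1}(pow_1 2); apply: Rle_pow; [Lra.lra|apply/ssrnat.leP].
by Lra.lra.
Qed.

(* R_D(X) >> X / (log X)^(1 - 1/2^r), expressed as: there are c > 0 and X0 such
   that for every integer X >= X0 there are at least c X/(log X)^(1-1/2^r)
   distinct integers q with |q| <= X satisfying [counted D q]. *)
Theorem theorem1p5 (D : int) :
  good D -> sgnz D = GRing.opp (eps D) ->
  exists c : R, (0 < c)%R /\ exists X0 : nat, forall X : nat, (X0 <= X)%N ->
    exists s : seq int, uniq s /\
      (forall q, q \in s -> (`|q| <= X)%N /\ counted D q) /\
      (c * INR X / Rpower (ln (INR X)) (1 - / 2 ^ nprimes D) <= INR (size s))%R.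

Proof.
move=> gD sD.
have [c [/RltP c0 [X0 HX]]] := counted_lower_bound RlnM Rln_le_subr1 gD sD.
(* 3 is at least e, so X >= 3 ensures ln X >= 1, the base that [sqrt_le_Rpower] requires. *)
exists c; split=> //; exists (maxn X0 3) => X; rewrite geq_max => /andP[XX X3].
have [s [us hs /RleP szs]] := HX X XX; exists s; split=> //; split=> //.
have l1 := ln_nat_ge1 X3.
have h := sqrt_le_Rpower l1 (nprimes_gt0 gD sD).
have p0 : (0 < Rpower (ln (INR X)) (1 - / 2 ^ nprimes D))%R by exact: exp_pos.
apply: (Rmult_le_reg_r _ _ _ p0); rewrite /Rdiv Rmult_assoc Rinv_l ?Rmult_1_r; last first.
  exact: Rgt_not_eq.
rewrite -!INRE -RsqrtE in szs.
apply: (Rle_trans _ _ _ szs); exact: Rmult_le_compat_l (pos_INR _) h.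
Qed.
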